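(* Let $q\in L^1[-1,1]$ be real-valued, $q(x)=0$ for $|x|>1$, and suppose that the operator $-\frac{d^2}{dx^2}+q(x)$ in $L^2(\mathbb{R})$ has no negative eigenvalues. For $k>0$ let $u(x,k)$ solve $$u''+k^2u-q(x)u=-\delta(x),\quad -\infty<x<\infty,\qquad \frac{\partial u}{\partial|x|}-iku\to0\ \text{ as }|x|\to\infty .$$ Then the data $\{u(-1,k),u(1,k)\}$, known for all $k>0$, determine $q$ uniquely. That is, if two real-valued potentials $q_1,q_2\in L^1[-1,1]$, with $q_j(x)=0$ for $|x|>1$ and such that the operator $-\frac{d^2}{dx^2}+q_j(x)$ in $L^2(\mathbb{R})$ has no negative eigenvalues, $j=1,2$, generate the same data $\{u(-1,k),u(1,k)\}$ for all $k>0$, then $q_1=q_2$ almost everywhere.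
   Context: $\delta$ is the delta-function; primes denote derivatives in $x$. *)

(* Defs.v *)
From mathcomp Require Import all_boot all_order all_algebra.
From mathcomp Require Import all_classical all_reals all_analysis.
From mathcomp Require Export complex.

Set Implicit Arguments.
Unset Strict Implicit.
Unset Printing Implicit Defensive.

Import Order.TTheory GRing.Theory Num.Theory numFieldNormedType.Exports.

Local Open Scope ring_scope.
Local Open Scope complex_scope.
Local Open Scope classical_set_scope.

Local Notation Re := complex.Re.
Local Notation Im := complex.Im.

(* Functions R -> R[i] of a real variable are differentiated and integrated
   through their real and imaginary parts. *)
Section ComplexValued.
Context {R : realType}.
Local Notation mu := (@lebesgue_measure R).
Implicit Types f : R -> R[i].

Definition ccontinuous f : Prop :=
  continuous (fun x => Re (f x)) /\ continuous (fun x => Im (f x)).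

Definition cderivable f (x : R) : Prop :=
  derivable (fun y => Re (f y)) x 1 /\ derivable (fun y => Im (f y)) x 1.

Definition cderive f (x : R) : R[i] :=
  (fun y => Re (f y))^`() x +i* (fun y => Im (f y))^`() x.

Definition cintegral f : R[i] :=
  (\int[mu]_x Re (f x))%R +i* (\int[mu]_x Im (f x))%R.

Definition clocally_integrable f : Prop :=
  locally_integrable setT (fun x => Re (f x)) /\
  locally_integrable setT (fun x => Im (f x)).

Definition cL2 f : Prop :=
  (fun x => Re (f x)) \in Lfun mu 2%:E /\
  (fun x => Im (f x)) \in Lfun mu 2%:E.

End ComplexValued.

(* Distributions on the line, as functionals on test functions. Real-valued
   test functions suffice: two complex distributions that agree on them agree. *)
Section Distributions.
Context {R : realType}.
Implicit Types (phi : R -> R) (T : (R -> R) -> R[i]).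

Definition test_function phi : Prop :=
  (forall (n : nat) (x : R), derivable phi^`(n) x 1) /\
  (exists a : R, forall x : R, a < `|x| -> phi x = 0).

Definition regular_distr (f : R -> R[i]) phi : R[i] :=
  cintegral (fun x => f x * (phi x)%:C).

Definition delta_distr phi : R[i] := (phi 0)%:C.

Definition distr_derive T phi : R[i] := - T phi^`().

End Distributions.

Section Schrodinger.
Context {R : realType}.
Local Notation mu := (@lebesgue_measure R).
Implicit Types (q : R -> R) (f g u : R -> R[i]).

Definition potential q : Prop :=
  mu.-integrable `[-1, 1]%classic (EFin \o q) /\
  (forall x : R, 1 < `|x| -> q x = 0).

(* The graph of -d^2/dx^2 + q in L^2(R): f is in the domain when f is in L^2,
   q f is locally integrable and - f'' + q f, computed in the sense of
   distributions, is a function g of L^2. Since then f'' is locally integrable,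
   this is the domain {f in L^2 | f, f' locally absolutely continuous and
   - f'' + q f in L^2}. *)
Definition schrodinger q f g : Prop :=
  [/\ cL2 f, cL2 g,
      clocally_integrable (fun x => (q x)%:C * f x) &
      forall phi, test_function phi ->
        - distr_derive (distr_derive (regular_distr f)) phi
        + regular_distr (fun x => (q x)%:C * f x) phi
        = regular_distr g phi].

(* Elements of L^2 are classes modulo a.e. equality, hence the a.e. in the
   condition f <> 0. *)
Definition schrodinger_eigenvalue q (lambda : R) : Prop :=
  exists f, ~ {ae mu, forall x, f x = 0} /\
            schrodinger q f (fun x => lambda%:C * f x).

Definition no_negative_eigenvalue q : Prop :=
  forall lambda : R, lambda < 0 -> ~ schrodinger_eigenvalue q lambda.

(* The derivative of u along |x|, minus i k u. *)
Definition radiation_defect (k : R) u (x : R) : R[i] :=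
  (Num.sg x)%:C * cderive u x - 'i%C * k%:C * u x.

Definition radiation_condition (k : R) u : Prop :=
  [/\ \forall x \near +oo, cderivable u x,
      \forall x \near -oo, cderivable u x,
      Normc.normc (radiation_defect k u x) @[x --> +oo] --> (0 : R) &
      Normc.normc (radiation_defect k u x) @[x --> -oo] --> (0 : R)].

(* The equation u'' + k^2 u - q u = - delta holds in the sense of
   distributions; continuity of u makes q u a locally integrable function and
   gives a meaning to the values of u at given points. *)
Definition point_source_solution q (k : R) u : Prop :=
  [/\ ccontinuous u,
      forall phi, test_function phi ->
        distr_derive (distr_derive (regular_distr u)) phi
        + (k ^+ 2)%:C * regular_distr u phi
        - regular_distr (fun x => (q x)%:C * u x) phi
        = - delta_distr phi &
      radiation_condition k u].

End Schrodinger.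

(* Main.v *)
Require Import Defs.
From mathcomp Require Import all_boot all_order all_algebra.
From mathcomp Require Import all_classical all_reals all_analysis.
From mathcomp Require Import measurable_realfun ring lra.
Import Order.TTheory GRing.Theory Num.Theory numFieldNormedType.Exports.
Local Open Scope classical_set_scope.
Local Open Scope ring_scope.

(* Let f+ and f- be the Jost solutions of the potentials q(x) and q(-x) on the half line x > 0,
   with values F+, F- and derivatives F+', F-' at 0, and let W = -(F+' F- + F+ F-'). Wronskian
   identities give u(1, k) = e^{ik} F-(k) / W(k) and u(-1, k) = e^{ik} F+(k) / W(k), so that F+ / W
   and F- / W are known for k > 0.

   The absence of negative eigenvalues says that W has no zero on the positive imaginary axis;
   then g = F+ F- / W = u(0, .) is regular in the upper half plane. On the real axis Im g equals
   k (|F+ / W|^2 + |F- / W|^2), which is known. For two potentials with the same data, the maximum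
   principle applied to k^2 (g1 - g2) gives g1 = g2, hence equal F+ and equal F-. The function
   Im g is positive for Re k > 0, so g decreases along the imaginary axis and stays positive
   there; hence F+ and F- do not vanish, and the maximum principle applied to the difference of
   the F+' divided by F+ gives equal F+', and likewise equal F-'.

   Finally, equality of F+ and F+' at k = i x, x > 0, says that the integral of
   (q1 - q2) f1 f2 over the half line vanishes. Since f = e^{ikx} (1 + int B(x, t) e^{2ikt} dt), this
   is the vanishing of the Laplace transform of p + (Volterra operator) p with p = q1 - q2, and
   therefore p = 0. *)

Set Implicit Arguments.
Unset Strict Implicit.
Unset Printing Implicit Defensive.


(** * Complex numbers and Taylor expansions *)

Local Open Scope complex_scope.

Notation Re := complex.Re.
Notation Im := complex.Im.
Notation nC := (@Normc.normc _).

Section ComplexBasics.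
Context {R : realType}.
Implicit Types (z w h : R[i]) (x y : R).

(** Two difficulties shape the proof. One is the point [k = 0], where [W] may or may not vanish, and
    [F+] too. Since [|W(s)| >= 2 s] for [s > 0], a zero of [W] there is simple, and the factor [k^2]
    absorbs the singularity of [g] in either case; for the quotient by [F+] only the imaginary part
    is shown to be continuous at 0. The other is the weak decay that integrable potentials give: the
    transforms are bounded in the closed half plane and are known to tend to 0 only along the
    imaginary axis. The maximum principle therefore serves to make an imaginary part vanish; the
    function is then constant, and the decay on that axis makes the constant 0. The step from [g] to
    [F+] and [F-] rests on the product of the two data, [F+ F- / W^2 = g / W], which gives [W]. The
    Jost solutions are built from the kernel [B] and not by iteration for each [k]: the kernel
    yields at once the analyticity in [k], the bounds, and the Laplace transform of the last
    step. *)

Lemma ceq z w : Re z = Re w -> Im z = Im w -> z = w.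
Proof. by case: z w => a b [c d] /= -> ->. Qed.

Lemma ReD z w : Re (z + w) = Re z + Re w. Proof. by case: z w => ? ? []. Qed.
Lemma ImD z w : Im (z + w) = Im z + Im w. Proof. by case: z w => ? ? []. Qed.
Lemma ReN z : Re (- z) = - Re z. Proof. by case: z. Qed.
Lemma ImN z : Im (- z) = - Im z. Proof. by case: z. Qed.
Lemma ReM z w : Re (z * w) = Re z * Re w - Im z * Im w.
Proof. by case: z w => ? ? []. Qed.
Lemma ImM z w : Im (z * w) = Re z * Im w + Im z * Re w.
Proof. by case: z w => ? ? []. Qed.
Lemma ReC x : Re x%:C = x. Proof. by []. Qed.
Lemma ImC x : Im x%:C = 0. Proof. by []. Qed.
Lemma Re0 : Re (0 : R[i]) = 0. Proof. by []. Qed.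
Lemma Im0 : Im (0 : R[i]) = 0. Proof. by []. Qed.
Lemma Re1 : Re (1 : R[i]) = 1. Proof. by []. Qed.
Lemma Im1 : Im (1 : R[i]) = 0. Proof. by []. Qed.
Lemma Rei : Re ('i%C : R[i]) = 0. Proof. by []. Qed.
Lemma Imi : Im ('i%C : R[i]) = 1. Proof. by []. Qed.
Lemma ReJ z : Re z^*%C = Re z. Proof. by case: z. Qed.
Lemma ImJ z : Im z^*%C = - Im z. Proof. by case: z. Qed.
Lemma ReMn z n : Re (z *+ n) = Re z *+ n.
Proof. by elim: n => // n IH; rewrite !mulrS ReD IH. Qed.
Lemma ImMn z n : Im (z *+ n) = Im z *+ n.
Proof. by elim: n => // n IH; rewrite !mulrS ImD IH. Qed.
Lemma ReP x y : Re (x +i* y) = x. Proof. by []. Qed.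
Lemma ImP x y : Im (x +i* y) = y. Proof. by []. Qed.

(** Real and imaginary parts are distributed over sums and products only, so [expr2] is included to
    open squares. *)
Definition reim := (ReP, ImP, ReD, ImD, ReN, ImN, ReMn, ImMn, ReM, ImM, ReC, ImC,
  Re0, Im0, Re1, Im1, Rei, Imi, ReJ, ImJ, expr2).

Lemma normcD z w : nC (z + w) <= nC z + nC w.
Proof. exact: (@le_normcD R z w). Qed.
Lemma normcN z : nC (- z) = nC z.
Proof. exact: (@complex.normcN R z). Qed.
Lemma normcB z w : nC (z - w) <= nC z + nC w.
Proof. by rewrite -(normcN w) normcD. Qed.
Lemma normcM z w : nC (z * w) = nC z * nC w. Proof. exact: Normc.normcM. Qed.
Lemma normcV z : nC z^-1 = (nC z)^-1. Proof. exact: Normc.normcV. Qed.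
Lemma normc0 : nC (0 : R[i]) = 0. Proof. exact: Normc.normc0. Qed.
Lemma normc1 : nC (1 : R[i]) = 1. Proof. exact: Normc.normc1. Qed.
Lemma normcX z n : nC (z ^+ n) = nC z ^+ n.
Proof. by elim: n => [|n IH]; rewrite ?normc1 ?expr0 ?normc1 // !exprS normcM IH. Qed.
Lemma normc_ge0 z : 0 <= nC z.
Proof. by case: z => a b; apply: sqrtr_ge0. Qed.
Lemma normc_sq z : nC z ^+ 2 = Re z ^+ 2 + Im z ^+ 2.
Proof. by case: z => a b; rewrite sqr_sqrtr // addr_ge0 // sqr_ge0. Qed.
Lemma normc_eq0 z : (nC z == 0) = (z == 0).
Proof. by apply/eqP/eqP => [/Normc.eq0_normc|->] //; exact: normc0. Qed.
Lemma normc_gt0 z : (0 < nC z) = (z != 0).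
Proof. by rewrite lt_def normc_ge0 andbT normc_eq0. Qed.
Lemma normc_Re z : `|Re z| <= nC z.
Proof. by rewrite -(@ler_pXn2r _ 2) ?nnegrE ?normc_ge0 // normc_sq real_normK ?num_real // lerDl sqr_ge0. Qed.
Lemma normc_Im z : `|Im z| <= nC z.
Proof. by rewrite -(@ler_pXn2r _ 2) ?nnegrE ?normc_ge0 // normc_sq real_normK ?num_real // lerDr sqr_ge0. Qed.
Lemma normc_le z : nC z <= `|Re z| + `|Im z|.
Proof.
rewrite -(@ler_pXn2r _ 2) ?nnegrE ?normc_ge0 ?addr_ge0 // normc_sq sqrrD.
by rewrite !real_normK ?num_real // lerD2r lerDl mulrn_wge0 // mulr_ge0.
Qed.
Lemma normcC x : nC (x%:C) = `|x|.
Proof. by rewrite /Normc.normc /= expr0n addr0 sqrtr_sqr. Qed.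
Lemma normci : nC ('i%C : R[i]) = 1.
Proof. by rewrite /Normc.normc /= expr0n add0r expr1n sqrtr1. Qed.
Lemma normcJ z : nC z^*%C = nC z.
Proof. by case: z => a b; rewrite /Normc.normc /= sqrrN. Qed.
Lemma normc2 z w : nC z - nC w <= nC (z - w).
Proof. by rewrite lerBlDr -[X in nC X <= _](subrK w) normcD. Qed.

End ComplexBasics.

(** * Remainder estimates near the origin *)

Section BigO.
Context {R : realType}.
Implicit Types (r g : R[i] -> R[i]) (k h c : R[i]) (n m : nat).

Definition bigO n r := exists C d : R, [/\ 0 < d, 0 <= C &
  forall h, nC h < d -> nC (r h) <= C * nC h ^+ n].

Lemma eq_bigO n r g : r =1 g -> bigO n r -> bigO n g.
Proof. by move=> e [C [d [d0 C0 H]]]; exists C, d; split=> // h hd; rewrite -e H. Qed.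

Lemma bigOD n r g : bigO n r -> bigO n g -> bigO n (fun h => r h + g h).
Proof.
move=> [C [d [d0 C0 H]]] [C' [d' [d'0 C'0 H']]].
exists (C + C'), (Num.min d d'); split; rewrite ?lt_min ?d0 ?addr_ge0 // => h.
rewrite lt_min => /andP[h1 h2]; apply: le_trans (normcD _ _) _.
by rewrite mulrDl lerD ?H ?H'.
Qed.

Lemma bigON n r : bigO n r -> bigO n (fun h => - r h).
Proof. by move=> [C [d [d0 C0 H]]]; exists C, d; split=> // h hd; rewrite normcN H. Qed.

Lemma bigOB n r g : bigO n r -> bigO n g -> bigO n (fun h => r h - g h).
Proof. by move=> H1 H2; apply: bigOD => //; apply: bigON. Qed.

Lemma bigOM n m r g : bigO n r -> bigO m g -> bigO (n + m) (fun h => r h * g h).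
Proof.
move=> [C [d [d0 C0 H]]] [C' [d' [d'0 C'0 H']]].
exists (C * C'), (Num.min d d'); split; rewrite ?lt_min ?d0 ?mulr_ge0 // => h.
rewrite lt_min => /andP[h1 h2]; rewrite normcM exprD mulrACA.
by apply: ler_pM; rewrite ?normc_ge0 ?H ?H'.
Qed.

Lemma bigOcst c : bigO 0 (fun _ => c).
Proof. by exists (nC c), 1; split=> // [|h _]; rewrite ?normc_ge0 // expr0 mulr1. Qed.

Lemma bigOh n c : bigO n (fun h => c * h ^+ n).
Proof. by exists (nC c), 1; split=> // [|h _]; rewrite ?normc_ge0 // normcM normcX. Qed.

Lemma bigOle n m r : (n <= m)%N -> bigO m r -> bigO n r.
Proof.
move=> nm [C [d [d0 C0 H]]]; exists C, (Num.min d 1).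
split; rewrite ?lt_min ?d0 ?ltr01 // => h.
rewrite lt_min => /andP[h1 h2]; apply: le_trans (H _ h1) _.
by apply: ler_wpM2l => //; apply: ler_wiXn2l => //; [exact: normc_ge0 | exact: ltW].
Qed.

(** Close to 0 the value stays within |c| / 2 of [c], so its inverse is at most 2 / |c|. Dividing by
    [C + 1] covers the case [C = 0]. *)
Lemma bigO_inv r c : c != 0 -> bigO 1 (fun h => r h - c) -> bigO 0 (fun h => (r h)^-1).
Proof.
rewrite -normc_gt0 => c0 [C [d [d0 C0 H]]].
have C1 : 0 < C + 1 by lra.
have e0 : 0 < nC c / 2 / (C + 1) by rewrite !divr_gt0.
exists (nC c / 2)^-1, (Num.min d (nC c / 2 / (C + 1))).
split; rewrite ?lt_min ?d0 ?e0 ?invr_ge0 ?divr_ge0 ?normc_ge0 // => h.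
rewrite lt_min => /andP[h1]; rewrite ltr_pdivlMr // => h2; rewrite expr0 mulr1 normcV.
have := H h h1; rewrite expr1 => h3; have := normc2 c (c - r h).
have -> : c - (c - r h) = r h by ring.
have -> : nC (c - r h) = nC (r h - c) by rewrite -normcN opprB.
have := normc_ge0 h => h4 h5.
have h6 : nC c / 2 <= nC (r h) by nra.
by rewrite lef_pV2 // posrE; lra.
Qed.

End BigO.

Section Jets.
Context {R : realType}.
Implicit Types (E G : R[i] -> R[i]) (k h c : R[i]).

(* Second order Taylor expansions stand in for holomorphy: they are stable under products and
   inverses and suffice for the maximum principle. *)
Definition jet E k := exists e1 e2, bigO 3 (fun h => E (k + h) - (E k + e1 * h + e2 * h ^+ 2)).

Lemma eq_jet E G k : E =1 G -> jet E k -> jet G k.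
Proof. by move=> e [a [b H]]; exists a, b; apply: eq_bigO H => h; rewrite !e. Qed.

Lemma jet_cst c k : jet (fun _ => c) k.
Proof.
exists 0, 0; apply: eq_bigO (bigOh 3 0) => h; ring.
Qed.

Lemma jet_id k : jet (fun z => z) k.
Proof. exists 1, 0; apply: eq_bigO (bigOh 3 0) => h; ring. Qed.

Lemma jetD E G k : jet E k -> jet G k -> jet (fun z => E z + G z) k.
Proof.
move=> [a [b H]] [a' [b' H']]; exists (a + a'), (b + b').
apply: eq_bigO (bigOD H H') => h; ring.
Qed.

Lemma jetN E k : jet E k -> jet (fun z => - E z) k.
Proof. by move=> [a [b H]]; exists (- a), (- b); apply: eq_bigO (bigON H) => h; ring. Qed.

Lemma jetB E G k : jet E k -> jet G k -> jet (fun z => E z - G z) k.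
Proof. by move=> H1 H2; apply: jetD => //; apply: jetN. Qed.

Lemma jet_tangent E k : jet E k ->
  exists e1, bigO 2 (fun h => E (k + h) - (E k + e1 * h)).
Proof.
move=> [a [b H]]; exists a.
apply: eq_bigO (bigOD (@bigOle _ 2 3 _ isT H) (bigOh 2 b)) => h; ring.
Qed.

Lemma jet_lip E k : jet E k -> bigO 1 (fun h => E (k + h) - E k).
Proof.
move=> /jet_tangent[a H].
apply: eq_bigO (bigOD (@bigOle _ 1 2 _ isT H) (bigOh 1 a)) => h; ring.
Qed.

Lemma jet_bounded E k : jet E k -> bigO 0 (fun h => E (k + h)).
Proof.
move=> /jet_lip H.
apply: eq_bigO (bigOD (@bigOle _ 0 1 _ isT H) (bigOcst (E k))) => h; ring.
Qed.

Lemma jetM E G k : jet E k -> jet G k -> jet (fun z => E z * G z) k.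
Proof.
move=> HE HG; have bG := jet_bounded HG; move: HE HG => [a [b H]] [a' [b' H']].
exists (E k * a' + a * G k), (E k * b' + a * a' + b * G k).
have bP : bigO 0 (fun h => E k + a * h + b * h ^+ 2).
  apply: bigOD; first apply: bigOD; first exact: bigOcst.
    by apply: (@bigOle _ 0 1) => //; apply: eq_bigO (bigOh 1 a) => h; rewrite expr1.
  by apply: (@bigOle _ 0 2) => //; exact: bigOh.
(* With P and P' the two quadratic polynomials, E G = (E - P) G + P (G - P') + P P'; [t3] and [t4]
   are the terms of degree 3 and 4 of P P'. *)
have t1 := bigOM H bG; have t2 := bigOM bP H'.
have t3 := bigOh 3 (a * b' + b * a').
have t4 := @bigOle _ 3 4 _ isT (bigOh 4 (b * b')).
apply: eq_bigO (bigOD (bigOD t1 t2) (bigOD t3 t4)) => h; ring.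
Qed.

(** With P the polynomial of [G] and p the inverse of P up to degree 2, 1 / G - p = - (p (G - P) +
    (p P - 1)) / G, and p P - 1 has only terms of degree 3 and 4. *)
Lemma jetV G k : G k != 0 -> jet G k -> jet (fun z => (G z)^-1) k.
Proof.
move=> G0 HG; have lG := jet_lip HG; have iG := bigO_inv G0 lG.
have bG := jet_bounded HG; move: HG => [a [b H]].
exists (- a / G k ^+ 2), (a ^+ 2 / G k ^+ 3 - b / G k ^+ 2).
pose p h : R[i] := (G k)^-1 + (- a / G k ^+ 2) * h + (a ^+ 2 / G k ^+ 3 - b / G k ^+ 2) * h ^+ 2.
have bP : bigO 0 p.
  apply: bigOD; first apply: bigOD; first exact: bigOcst.
    by apply: (@bigOle _ 0 1) => //; apply: eq_bigO (bigOh 1 _) => h; rewrite expr1.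
  by apply: (@bigOle _ 0 2) => //; exact: bigOh.
have t1 := bigOM bP H.
have t3 := bigOh 3 (- a * b / G k ^+ 2 + a * (a ^+ 2 / G k ^+ 3 - b / G k ^+ 2)).
have t4 := @bigOle _ 3 4 _ isT (bigOh 4 (b * (a ^+ 2 / G k ^+ 3 - b / G k ^+ 2))).
have [C [d [d0 C0 L]]] := lG.
have [e e0 nz] : exists2 e : R, 0 < e & forall h, nC h < e -> G (k + h) != 0.
  have C1 : 0 < C + 1 by lra.
  move: (G0); rewrite -normc_gt0 => g0.
  exists (Num.min d (nC (G k) / (C + 1))); first by rewrite lt_min d0 divr_gt0.
  move=> h; rewrite lt_min ltr_pdivlMr // => /andP[h1 h2].
  have := L h h1; rewrite expr1 => h3; rewrite -normc_gt0.
  have := normc2 (G k) (G k - G (k + h)).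
  have -> : G k - (G k - G (k + h)) = G (k + h) by ring.
  have -> : nC (G k - G (k + h)) = nC (G (k + h) - G k) by rewrite -normcN opprB.
  have := normc_ge0 h; nra.
have [C' [d' [d'0 C'0 F]]] := bigOM (bigON (bigOD t1 (bigOD t3 t4))) iG.
exists C', (Num.min d' e); split=> //; first by rewrite lt_min d'0.
move=> h; rewrite lt_min => /andP[h1 h2].
rewrite -[(3)%N]addn0; suff <- : - (p h * (G (k + h) - (G k + a * h + b * h ^+ 2)) +
   ((- a * b / G k ^+ 2 + a * (a ^+ 2 / G k ^+ 3 - b / G k ^+ 2)) * h ^+ 3 +
    (b * (a ^+ 2 / G k ^+ 3 - b / G k ^+ 2)) * h ^+ 4)) * (G (k + h))^-1 =
    (G (k + h))^-1 - p h by exact: F.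
have := nz h h2; rewrite /p; move: (G (k + h)) (G k) G0 => g g' g'0 g0.
by field; rewrite g0 g'0.
Qed.

End Jets.


(** * A maximum principle in the upper half plane *)

Section RealDerivative.
Context {R : realType}.
Implicit Types (f : R -> R) (x a : R).

Lemma is_derive_eps f x a : (forall e : R, 0 < e -> exists2 d : R, 0 < d &
    forall h : R, `|h| < d -> `|f (x + h) - f x - a * h| <= e * `|h|) ->
  is_derive x (1 : R) f a.
Proof.
move=> H.
have L : (fun h : R => h^-1 *: ((f \o shift x) (h *: (1 : R)) - f x)) @ (0 : R)^' --> a.
  apply/cvgrPdist_le => e e0; have [d d0 Hd] := H e e0.
  near=> h.
  have h0 : h != 0 by near: h; exact: nbhs_dnbhs_neq.
  have hd : `|h| < d by near: h; apply: dnbhs0_lt.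
  rewrite /GRing.scale /= mulr1 (addrC h).
  have -> : a - h^-1 * (f (x + h) - f x) = - (h^-1 * (f (x + h) - f x - a * h)).
    by field.
  rewrite normrN normrM normrV ?unitfE // ler_pdivrMl ?normr_gt0 // [leRHS]mulrC.
  exact: Hd.
split; last by apply/cvg_lim => //; exact: norm_hausdorff.
by apply/cvg_ex; exists a.
Unshelve. all: by end_near. Qed.

Lemma is_derive_quad f x a : (exists C d : R, 0 < d /\
    forall h, `|h| < d -> `|f (x + h) - f x - a * h| <= C * h ^+ 2) ->
  is_derive x (1 : R) f a.
Proof.
move=> [C [d [d0 H]]]; apply: is_derive_eps => e e0.
have C1 : 0 < `|C| + 1 by rewrite ltr_wpDl.
exists (Num.min d (e / (`|C| + 1))); first by rewrite lt_min d0 divr_gt0.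
move=> h; rewrite lt_min ltr_pdivlMr // => /andP[h1 h2].
apply: le_trans (H h h1) _; rewrite -real_normK ?num_real //.
by have := normr_ge0 h; have := ler_norm C; nra.
Qed.

Lemma nonincreasing_quad f (c : R) :
  (forall x, c < x -> exists a C d : R, [/\ 0 < d, a <= 0 &
     forall h, `|h| < d -> `|f (x + h) - f x - a * h| <= C * h ^+ 2]) ->
  forall x y, c < x -> x <= y -> f y <= f x.
Proof.
move=> H x y cx xy.
have D z : c < z -> exists2 a, a <= 0 & is_derive z (1 : R) f a.
  move=> cz; have [a [C [d [d0 a0 Hd]]]] := H z cz; exists a => //.
  by apply: is_derive_quad; exists C, d.
apply: (@ler0_derive1_nincry R f x) => //.
- by move=> z; rewrite in_itv /= andbT => xz; have [a _ []] := D z (lt_trans cx xz).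
- move=> z; rewrite in_itv /= andbT => xz; have [a a0 da] := D z (lt_trans cx xz).
  by rewrite derive1E derive_val.
- apply: derivable_within_continuous => z; rewrite in_itv /= andbT => xz.
  by have [a _ []] := D z (lt_le_trans cx xz).
Qed.

(** Divide by t and let t tend to 0. Below it reads off coefficients of order one, and turns
    impossible estimates into equations such as 2 = 0. *)
Lemma linear_quad0 (a C d : R) : 0 < d -> (forall t, 0 < t -> t < d -> `|a * t| <= C * t ^+ 2) -> a = 0.
Proof.
move=> d0 H; apply/eqP; rewrite -normr_le0 leNgt; apply/negP => a0.
have C1 : 0 < `|C| + 1 by rewrite ltr_wpDl.
pose t := Num.min (d / 2) (`|a| / (`|C| + 1) / 2).
have t0 : 0 < t by rewrite lt_min !divr_gt0.
have td : t < d by rewrite gt_min; apply/orP; left; lra.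
have ta : t * (`|C| + 1) <= `|a| / 2.
  have -> : `|a| / 2 = (`|a| / (`|C| + 1) / 2) * (`|C| + 1) by field; rewrite lt0r_neq0.
  by apply: ler_wpM2r; [exact: ltW | rewrite ge_min lexx orbT].
have := H t t0 td; rewrite normrM (gtr0_norm t0) expr2 mulrA ler_pM2r // => h.
have := ler_norm C; nra.
Qed.

End RealDerivative.

Section HalfPlane.
Context {R : realType}.
Implicit Types (E : R[i] -> R[i]) (k h : R[i]).

(** Only the imaginary part is asked to be continuous. One of the functions used below is a quotient
    whose denominator may vanish at 0: its value there is 0 by the convention on inverses, whereas
    its limit is a real number that need not be 0. *)
Definition Im_continuous_closed E := forall k, 0 <= Im k -> forall e : R, 0 < e ->
  exists2 d : R, 0 < d & forall h, nC h < d -> 0 <= Im (k + h) -> `|Im (E (k + h)) - Im (E k)| < e.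

(* The barrier is strictly superharmonic, so that no jet remainder can hide an
   interior maximum, and it dominates 1 on three sides of the rectangle. *)
Definition barrier (r : R) (p : R * R) : R :=
  (p.1 ^+ 2 - 2 * p.2 ^+ 2) / r ^+ 2 + 3 * p.2 / r.

(** With p = (x, y), the excess over 1 is y (3 r - 2 y) / r^2 when |x| = r, and x^2 / r^2 when y =
    r. *)
Lemma barrier_ge1 r p : 0 < r -> 0 <= p.2 <= r -> `|p.1| = r \/ (p.2 = r) -> 1 <= barrier r p.
Proof.
move=> r0 /andP[p0 pr] H; rewrite /barrier.
have -> : (p.1 ^+ 2 - 2 * p.2 ^+ 2) / r ^+ 2 + 3 * p.2 / r =
  (p.1 ^+ 2 - 2 * p.2 ^+ 2 + 3 * p.2 * r) / r ^+ 2 by field; rewrite lt0r_neq0.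
rewrite ler_pdivlMr ?exprn_gt0 // mul1r.
case: H => [H|->]; last by have := sqr_ge0 p.1; nra.
have : p.1 ^+ 2 = r ^+ 2 by rewrite -H real_normK ?num_real.
nra.
Qed.

(* At an interior maximum of [Im E - M barrier] the mean over the four points [k + d], [k - d],
   [k + i d], [k - i d] cancels the terms of order 1 and 2 of [E], while the barrier drops by
   order [d^2]. *)
Lemma halfplane_le0 E (M r0 : R) :
  (forall k, 0 < Im k -> jet E k) -> Im_continuous_closed E ->
  (forall s : R, Im (E s%:C%C) = 0) ->
  (forall k, 0 <= Im k -> r0 <= nC k -> Im (E k) <= M) ->
  forall k, 0 < Im k -> Im (E k) <= 0.
Proof.
move=> jE cE E0 bE k0 k0_gt0; rewrite leNgt; apply/negP => u0.
wlog M0 : M bE / 0 < M.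
  move=> /(_ (Num.max M 1)); apply; last by rewrite lt_max ltr01 orbT.
  by move=> k k1 k2; rewrite le_max bE.
set s0 := Re k0; set y0 := Im k0 in k0_gt0; set u := Im (E k0) in u0.
(* [r] passes [r0] and the coordinates of [k0]. The last summand makes [M] times the barrier at [k0]
   at most u / 2, so that [f] is positive there. *)
pose r := 1 + `|r0| + `|s0| + y0 + 2 * M * (s0 ^+ 2 + 3 * y0) / u.
have Q0 : 0 <= 2 * M * (s0 ^+ 2 + 3 * y0) / u.
  by apply: divr_ge0; [have := sqr_ge0 s0; nra | exact: ltW].
have n1 := normr_ge0 r0; have n2 := normr_ge0 s0; have n3 := ler_norm r0.
have r1 : 1 <= r by rewrite /r; lra.
have rgt0 : 0 < r by lra.
pose K := `[- r, r]%classic `*` `[0, r]%classic : set (R * R).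
have cK : compact K by apply: compact_setX; exact: segment_compact.
pose f (p : R * R) : R := Im (E (p.1 +i* p.2)%C) - M * barrier r p.
have cf : {within K, continuous f}.
  apply/subspace_continuousP => p Kp; apply: (@cvgB _ R^o).
    apply/cvgrPdist_lt => e e0.
    move: Kp => [/=]; rewrite !in_itv /= => _ /andP[p20 _].
    have [d d0 Hd] := cE (p.1 +i* p.2)%C p20 e e0.
    have d2 : 0 < d / 2 by lra.
    have c1 : q.1 @[q --> p] --> p.1 by exact: cvg_fst.
    have c2 : q.2 @[q --> p] --> p.2 by exact: cvg_snd.
    have N1 : \forall q \near p, `|p.1 - q.1| < d / 2.
      by move/cvgrPdist_lt : c1; apply.
    have N2 : \forall q \near p, `|p.2 - q.2| < d / 2.
      by move/cvgrPdist_lt : c2; apply.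
    rewrite near_withinE; near=> q => - [/=]; rewrite !in_itv /= => _ /andP[q20 _].
    have := Hd ((q.1 +i* q.2)%C - (p.1 +i* p.2)%C); rewrite subrKC distrC; apply => //.
    apply: le_lt_trans (normc_le _) _; rewrite !reim /=.
    have -> : d = d / 2 + d / 2 by lra.
    apply: ltrD; rewrite distrC.
      by near: q; exact: N1.
    by near: q; exact: N2.
  apply: cvg_within_filter.
  have c1 : fst @ p --> p.1 by exact: cvg_fst.
  have c2 : snd @ p --> p.2 by exact: cvg_snd.
  apply: (@cvgM R); first exact: cvg_cst.
  apply: (@cvgD _ R^o).
    apply: (@cvgM R); last exact: cvg_cst.
    apply: (@cvgB _ R^o); first by apply: (@cvgM R).
    by apply: (@cvgM R); [exact: cvg_cst | apply: (@cvgM R)].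
  apply: (@cvgM R); last exact: cvg_cst.
  by apply: (@cvgM R) => //; exact: cvg_cst.
have k0K : K (s0, y0).
  split; rewrite /= in_itv /=; last by rewrite ltW //= /r; lra.
  by rewrite -ler_norml /r; lra.
have [c /set_mem Kc cmax] := @compact_EVT_max _ _ f K (ex_intro _ _ k0K) cK cf.
have f0 : 0 < f (s0, y0).
  rewrite /f subr_gt0 /=.
  have -> : (s0 +i* y0)%C = k0 by rewrite /s0 /y0; case: (k0).
  rewrite -/u /barrier /=.
  apply: (@le_lt_trans _ _ (M * ((s0 ^+ 2 + 3 * y0) / r))).
    rewrite ler_pM2l // [leRHS]mulrDl lerD2r.
    apply: (@le_trans _ _ (s0 ^+ 2 / r ^+ 2)).
      by rewrite ler_pM2r ?invr_gt0 ?exprn_gt0 //; nra.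
    by apply: ler_wpM2l; rewrite ?sqr_ge0 // lef_pV2 ?posrE ?exprn_gt0 // expr2; nra.
  rewrite mulrA ltr_pdivrMr //.
  have : u * (2 * M * (s0 ^+ 2 + 3 * y0) / u) = 2 * M * (s0 ^+ 2 + 3 * y0).
    by field; rewrite lt0r_neq0.
  have := sqr_ge0 s0; rewrite /r; nra.
have fc : 0 < f c by apply: lt_le_trans f0 _; apply: cmax; exact: mem_set.
move: Kc => [/=]; rewrite !in_itv /= => c1r /andP[c20 c2r].
have c1r' : `|c.1| <= r by rewrite ler_norml.
(* On these three sides Im E is at most [M] and the barrier at least 1, so [f] cannot be
   positive. *)
have side : `|c.1| = r \/ c.2 = r -> False.
  move=> H; have := @barrier_ge1 r c rgt0; rewrite c20 c2r => /(_ isT H) b1.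
  move: fc; rewrite /f subr_gt0 ltNge => /negP; apply.
  apply: (@le_trans _ _ M); last by rewrite ler_pMr.
  apply: bE => //; apply: (@le_trans _ _ r); first by rewrite /r; lra.
  case: H => <-; first exact: (normc_Re (c.1 +i* c.2)%C).
  by apply: le_trans (normc_Im (c.1 +i* c.2)%C); exact: ler_norm.
have c1lt : `|c.1| < r by rewrite lt_neqAle c1r' andbT; apply/eqP => ?; apply: side; left.
have c2lt : c.2 < r by rewrite lt_neqAle c2r andbT; apply/eqP => ?; apply: side; right.
have c2gt : 0 < c.2.
  rewrite lt_neqAle c20 andbT; apply/eqP => e; move: fc; rewrite /f -e.
  rewrite (E0 c.1) sub0r /barrier -e !mulr0 mul0r addr0 expr0n /= mulr0 subr0 oppr_gt0 ltNge.
  by move/negP; apply; apply: mulr_ge0; [exact: ltW | apply: divr_ge0; exact: sqr_ge0].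
have [e1 [e2 [C [d [d0 C0 Hd]]]]] := jE (c.1 +i* c.2)%C c2gt.
have D1 : 0 < 2 * (C + 1) * r ^+ 2 by rewrite !mulr_gt0 ?exprn_gt0 //; lra.
(* The four comparisons will add up to 2 M D^2 / r^2 <= 4 C D^3, that is M <= 2 C D r^2, which the
   bound involving [M] excludes. The other entries keep the four points in the rectangle and in the
   range of the jet. *)
pose D := Num.min (Num.min (d / 2) (M / (2 * (C + 1) * r ^+ 2))) (Num.min (r - `|c.1|) (Num.min c.2 (r - c.2))).
have Dgt0 : 0 < D by rewrite !lt_min !divr_gt0 ?c2gt //=; lra.
have Dd : D < d by rewrite !gt_min; apply/orP; left; apply/orP; left; lra.
have DM : D * (2 * (C + 1) * r ^+ 2) <= M.
  by rewrite -ler_pdivlMr // !ge_min lexx !orbT.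
have Dc1 : D <= r - `|c.1| by rewrite !ge_min lexx !orbT.
have Dc2 : D <= c.2 by rewrite !ge_min lexx !orbT.
have Dc3 : D <= r - c.2 by rewrite !ge_min lexx !orbT.
have c1a : - r <= c.1 - D /\ c.1 + D <= r.
  by have := ler_norm c.1; have := ler_norm (- c.1); rewrite normrN; lra.
have inK (a b : R) : `|a| <= D -> `|b| <= D -> f (c.1 + a, c.2 + b) <= f c.
  rewrite !ler_norml => /andP[a1 a2] /andP[b1 b2]; apply: cmax; apply: mem_set.
  by split; rewrite /= in_itv /=; apply/andP; split; lra.
have nD (x : R) : `|x| = D -> nC (x +i* 0)%C = D.
  by move=> xD; rewrite /Normc.normc expr0n addr0 sqrtr_sqr.
have nD' (x : R) : `|x| = D -> nC (0 +i* x)%C = D.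
  by move=> xD; rewrite /Normc.normc expr0n add0r sqrtr_sqr.
have DD : `|D| = D by rewrite gtr0_norm.
have nDD : `|- D| = D by rewrite normrN.
have B1 := inK D 0; rewrite DD normr0 lexx ltW // in B1; have {}B1 := B1 isT isT.
have B2 := inK (- D) 0; rewrite nDD normr0 lexx ltW // in B2; have {}B2 := B2 isT isT.
have B3 := inK 0 D; rewrite DD normr0 lexx ltW // in B3; have {}B3 := B3 isT isT.
have B4 := inK 0 (- D); rewrite nDD normr0 lexx ltW // in B4; have {}B4 := B4 isT isT.
have J h : nC h = D -> `|Im (E ((c.1 +i* c.2)%C + h) - (E (c.1 +i* c.2)%C + e1 * h + e2 * h ^+ 2))| <= C * D ^+ 3.
  by move=> hD; apply: le_trans (normc_Im _) _; rewrite -[in leRHS]hD; apply: Hd; rewrite hD.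
have J1 := J _ (nD _ DD); have J2 := J _ (nD _ nDD).
have J3 := J _ (nD' _ DD); have J4 := J _ (nD' _ nDD).
have cpl (a b : R) : (c.1 +i* c.2)%C + (a +i* b)%C = ((c.1 + a) +i* (c.2 + b))%C by [].
rewrite !cpl in J1 J2 J3 J4; rewrite !reim in J1 J2 J3 J4.
rewrite /f /barrier /= in B1 B2 B3 B4.
have bar (a b : R) : ((c.1 + a) ^+ 2 - 2 * (c.2 + b) ^+ 2) / r ^+ 2 + 3 * (c.2 + b) / r =
   (c.1 ^+ 2 - 2 * c.2 ^+ 2) / r ^+ 2 + 3 * c.2 / r + (2 * c.1 * a - 4 * c.2 * b) / r ^+ 2 + 3 * b / r
    + (a ^+ 2 - 2 * b ^+ 2) / r ^+ 2 by ring.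
rewrite !bar in B1 B2 B3 B4.
set W := (c.1 ^+ 2 - 2 * c.2 ^+ 2) / r ^+ 2 + 3 * c.2 / r in B1 B2 B3 B4.
move: J1 J2 J3 J4; rewrite !ler_norml => /andP[J1 _] /andP[J2 _] /andP[J3 _] /andP[J4 _].
set P1 := Im (E _) in J1 B1; set P2 := Im (E _) in J2 B2; set P3 := Im (E _) in J3 B3; set P4 := Im (E _) in J4 B4.
have key : 2 * M * D ^+ 2 / r ^+ 2 <= 4 * C * D ^+ 3.
  have S := lerD (lerD (lerD B1 B2) (lerD B3 B4)) (lerD (lerD J1 J2) (lerD J3 J4)).
  rewrite -subr_ge0; rewrite -subr_ge0 in S; apply: le_trans S _.
  rewrite le_eqVlt; apply/orP; left; apply/eqP.
  by field; rewrite lt0r_neq0.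
move: key; rewrite ler_pdivrMr ?exprn_gt0 //.
have -> : 4 * C * D ^+ 3 * r ^+ 2 = 2 * D ^+ 2 * (D * (2 * C * r ^+ 2)) by ring.
rewrite (_ : 2 * M * D ^+ 2 = 2 * D ^+ 2 * M); last ring.
rewrite ler_pM2l ?mulr_gt0 ?exprn_gt0 //.
have : 0 < D * r ^+ 2 by rewrite mulr_gt0 // exprn_gt0.
nra.
Unshelve. all: by end_near. Qed.

(** The derivative e1 satisfies Im (e1 z) = 0 for z = 1 and for z = i, so both its parts vanish. *)
Lemma jet_Im0_tangent E k : 0 < Im k -> jet E k -> (forall k, 0 < Im k -> Im (E k) = 0) ->
  bigO 2 (fun h => E (k + h) - E k).
Proof.
move=> k0 /jet_tangent[e1 [C [d [d0 C0 Hd]]]] I0.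
suff e10 : e1 = 0 by exists C, d; split=> // h hd; have := Hd h hd; rewrite e10 mul0r addr0.
have T (z : R[i]) : nC z = 1 -> Im (e1 * z) = 0.
  move=> z1; apply: (@linear_quad0 _ _ C (Num.min d (Im k))); first by rewrite lt_min d0.
  move=> t t0; rewrite lt_min => /andP[td tk].
  have nt : nC (t%:C%C * z) = t by rewrite normcM z1 mulr1 normcC gtr0_norm.
  have := Hd (t%:C%C * z); rewrite nt => /(_ td); apply: le_trans.
  apply: le_trans (normc_Im _); rewrite !(ImD, ImN) (I0 k) // I0; last first.
    rewrite ImD; have := normc_Im (t%:C%C * z); rewrite nt ler_norml => /andP[? _]; lra.
  by rewrite !reim -normrN le_eqVlt; apply/orP; left; apply/eqP; congr `|_|; ring.
apply: ceq; rewrite reim; last by have := T 1 normc1; rewrite mulr1.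
by have := T 'i%C normci; rewrite !reim mulr1 mulr0 addr0.
Qed.

(** The previous bound for E and for - E gives Im E = 0. The derivative then vanishes, E is constant
    along horizontal and vertical lines, and the decay on the imaginary axis fixes the constant. *)
Lemma halfplane_zero E (M r0 : R) :
  (forall k, 0 < Im k -> jet E k) -> Im_continuous_closed E ->
  (forall s : R, Im (E s%:C%C) = 0) ->
  (forall k, 0 <= Im k -> r0 <= nC k -> nC (E k) <= M) ->
  (forall e : R, 0 < e -> exists K : R, forall x, K < x -> nC (E (0 +i* x)%C) < e) ->
  forall k, 0 < Im k -> E k = 0.
Proof.
move=> jE cE E0 bE lE.
have I0 k : 0 < Im k -> Im (E k) = 0.
  move=> k0; apply/eqP; rewrite eq_le; apply/andP; split.
    apply: (@halfplane_le0 E M r0) => // z z0 zr.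
    by apply: le_trans (bE z z0 zr); apply: le_trans (normc_Im _); exact: ler_norm.
  rewrite -oppr_le0 -ImN; apply: (@halfplane_le0 (fun z => - E z) M r0) => //.
  - by move=> z z0; apply: jetN; exact: jE.
  - move=> z z0 e e0; have [d d0 H] := cE z z0 e e0; exists d => // h hd hz.
    by rewrite !ImN -opprD normrN H.
  - by move=> s; rewrite ImN E0 oppr0.
  - move=> z z0 zr; apply: le_trans (bE z z0 zr); rewrite -normcN.
    by apply: le_trans (normc_Im _); exact: ler_norm.
have T k (k0 : 0 < Im k) := jet_Im0_tangent k0 (jE k k0) I0.
(* [g] runs along a line at unit speed; the increments of E being quadratic, Re E and - Re E are
   both nonincreasing along it. *)
have mono (g : R -> R[i]) (c x y : R) :
    (forall t : R, c < t -> 0 < Im (g t)) -> (forall t h : R, nC (g (t + h) - g t) = `|h|) ->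
    c < x -> x <= y -> Re (E (g y)) = Re (E (g x)).
  move=> g0 gn cx xy.
  have Q t : c < t -> exists C d : R, 0 < d /\ forall h : R, `|h| < d ->
      `|Re (E (g (t + h))) - Re (E (g t))| <= C * h ^+ 2.
    move=> ct; have [C [d [d0 C0 Hd]]] := T _ (g0 t ct); exists C, d; split=> // h hd.
    have := Hd (g (t + h) - g t); rewrite gn real_normK ?num_real // subrKC => /(_ hd).
    by apply: le_trans; apply: le_trans (normc_Re _); rewrite !reim.
  apply/eqP; rewrite eq_le; apply/andP; split.
    apply: (@nonincreasing_quad _ (fun t => Re (E (g t))) c) => // t ct.
    have [C [d [d0 H]]] := Q t ct; exists 0, C, d; split=> // h hd.
    by rewrite mul0r subr0 H.
  rewrite -lerN2; apply: (@nonincreasing_quad _ (fun t => - Re (E (g t))) c) => // t ct.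
  have [C [d [d0 H]]] := Q t ct; exists 0, C, d; split=> // h hd.
  by rewrite mul0r subr0 -opprD normrN H.
move=> k k0; rewrite [k]complexE; apply: ceq; last by rewrite Im0 I0 // !reim; lra.
set s := Re k; set y := Im k in k0.
have -> : s%:C%C + 'i%C * y%:C%C = (s +i* y)%C by apply: ceq; rewrite !reim; ring.
have -> : Re (E (s +i* y)%C) = Re (E (0 +i* y)%C).
  have H (a b : R) : a <= b -> Re (E (b +i* y)%C) = Re (E (a +i* y)%C).
    move=> ab; apply: (@mono (fun t => (t +i* y)%C) (a - 1)) => //; last lra.
    move=> t h; have -> : ((t + h) +i* y)%C - (t +i* y)%C = h%:C%C.
      by apply: ceq; rewrite !reim; ring.
    exact: normcC.
  have [/ltW|] := ltrP s 0 => s0; first by rewrite (H s 0).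
  by rewrite (H 0 s).
apply/eqP; rewrite Re0 -normr_le0; apply/ler_addgt0Pr => e e0; rewrite add0r.
have [K HK] := lE e e0.
pose x := Num.max y (K + 1).
have -> : Re (E (0 +i* y)%C) = Re (E (0 +i* x)%C).
  symmetry; apply: (@mono (fun t => (0 +i* t)%C) 0) => //; last by rewrite le_max lexx.
  move=> t h; have -> : (0 +i* (t + h))%C - (0 +i* t)%C = 'i%C * h%:C%C.
    by apply: ceq; rewrite !reim; ring.
  by rewrite normcM normci mul1r normcC.
apply: le_trans (normc_Re _) _; apply: ltW; apply: HK.
by rewrite lt_max; apply/orP; right; lra.
Qed.

End HalfPlane.


(** * Green functions of pairs of half line problems *)

Section RealLine.
Context {R : realType}.
Implicit Types (r E F D G : R[i] -> R[i]) (k h : R[i]) (a t s : R).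

Lemma bigO2_slope r a : bigO 2 r -> (exists2 d : R, 0 < d &
  forall t, 0 < t -> t < d -> `|a * t| <= nC (r t%:C%C)) -> a = 0.
Proof.
move=> [C [d [d0 C0 H]]] [d' d'0 H']; apply: (@linear_quad0 _ a C (Num.min d d')).
  by rewrite lt_min d0.
move=> t t0; rewrite lt_min => /andP[td td']; apply: le_trans (H' t t0 td') _.
have nt : nC (t%:C%C) = t by rewrite normcC gtr0_norm.
by have := H (t%:C%C); rewrite nt => /(_ td).
Qed.

Lemma linear_quad_ge0 a (C d : R) : 0 < d -> (forall t, 0 < t -> t < d -> - (C * t ^+ 2) <= a * t) -> 0 <= a.
Proof.
move=> d0 H; rewrite leNgt; apply/negP => a0.
have : a = 0; last by lra.
apply: (@linear_quad0 _ a C d) => // t t0 td; have := H t t0 td.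
by rewrite ltr0_norm ?nmulr_rlt0 //; lra.
Qed.

(** A boundary point [k] is approached through k + i t. *)
Lemma jet_limit0 E k : jet E k -> 0 <= Im k -> (forall k, 0 < Im k -> E k = 0) -> E k = 0.
Proof.
move=> /jet_lip[C [d [d0 C0 H]]] k0 Z; apply/eqP; rewrite -normc_eq0.
apply/eqP; apply: (@linear_quad0 _ _ C d) => // t t0 td.
have nt : nC ('i%C * t%:C%C) = t by rewrite normcM normci mul1r normcC gtr0_norm.
have := H ('i%C * t%:C%C); rewrite nt => /(_ td); rewrite Z; last by rewrite !reim; lra.
rewrite sub0r normcN expr1 normrM ger0_norm ?normc_ge0 // gtr0_norm //.
by have := normc_ge0 (E k); nra.
Qed.

Lemma bigO1_small r e : 0 < e -> bigO 1 r -> exists2 d : R, 0 < d & forall h, nC h < d -> nC (r h) < e.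
Proof.
move=> e0 [C [d [d0 C0 H]]]; have C1 : 0 < C + 1 by lra.
exists (Num.min d (e / (C + 1))); first by rewrite lt_min d0 divr_gt0.
move=> h; rewrite lt_min ltr_pdivlMr // => /andP[h1 h2].
by apply: le_lt_trans (H h h1) _; rewrite expr1; have := normc_ge0 h; nra.
Qed.

Lemma jet_cont E k e : jet E k -> 0 < e ->
  exists2 d : R, 0 < d & forall h, nC h < d -> 0 <= Im (k + h) -> `|Im (E (k + h)) - Im (E k)| < e.
Proof.
move=> /jet_lip H e0; have [d d0 Hd] := bigO1_small e0 H; exists d => // h hd _.
by apply: le_lt_trans (Hd h hd); apply: le_trans (normc_Im _); rewrite !reim.
Qed.

Lemma normc_inv_lt (z : R[i]) (c : R) : 0 < c -> c <= nC z -> nC z^-1 <= c^-1.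
Proof. by move=> c0 cz; rewrite normcV lef_pV2 ?posrE //; lra. Qed.

Lemma mulcJ (z : R[i]) : z * z^*%C = (nC z ^+ 2)%:C%C.
Proof. by apply: ceq; rewrite ?normc_sq !reim; ring. Qed.

Lemma Im_div (z w : R[i]) : w != 0 -> Im (z / w) = - Im (z^*%C * w) / nC w ^+ 2.
Proof.
move=> w0; set v := z / w; have -> : z = v * w by rewrite /v divfK.
have W : nC w ^+ 2 != 0 by rewrite expf_neq0 // normc_eq0.
have -> : Im ((v * w)^*%C * w) = - Im v * nC w ^+ 2.
  by rewrite normc_sq !reim; ring.
by rewrite [- Im v * _]mulNr opprK mulfK.
Qed.

Lemma ReV (w : R[i]) : Re w^-1 = Re w / nC w ^+ 2.
Proof. by rewrite normc_sq; case: w. Qed.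

End RealLine.

(** * Boundary values of a half line problem *)

Section Weyl.
Context {R : realType}.
Implicit Types (F Y : R[i] -> R[i]) (k h : R[i]) (s t : R).

(* [F k] and [Fder F Y k] are the value and the derivative at [0] of the Jost solution of a half
   line problem; [Y] will be the Laplace transform of an integrable function. *)
Definition Fder F Y k := 'i%C * k * F k - Y k.

(** All that the complex analysis uses of a half line problem with a real potential. [weyl_pos] is
    the positivity of the flux Im (conj f f') at 0 for Re k > 0; [weyl_real] is its conservation for
    real k, evaluated where f is e^{ikx}. *)
Record weyl F Y : Prop := Weyl {
  weyl_jetF : forall k, jet F k;
  weyl_jetY : forall k, jet Y k;
  weyl_symF : forall k, F (- k^*%C) = (F k)^*%C;
  weyl_symY : forall k, Y (- k^*%C) = (Y k)^*%C;
  weyl_bdF : exists C : R, forall k, 0 <= Im k -> nC k * nC (F k - 1) <= C;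
  weyl_bdY : exists C : R, forall k, 0 <= Im k -> nC (Y k) <= C;
  weyl_decY : forall e : R, 0 < e -> exists K : R, forall x, K < x -> nC (Y (0 +i* x)%C) < e;
  weyl_pos : forall k, 0 <= Im k -> 0 < Re k -> 0 < Im ((F k)^*%C * Fder F Y k);
  weyl_real : forall s, 0 < s -> Im ((F s%:C%C)^*%C * Fder F Y s%:C%C) = s }.

Lemma Fder_sym F Y k : weyl F Y -> Fder F Y (- k^*%C) = (Fder F Y k)^*%C.
Proof.
by move=> w; rewrite /Fder (weyl_symF w) (weyl_symY w); apply: ceq; rewrite !reim; ring.
Qed.

Lemma jet_Fder F Y k : weyl F Y -> jet (Fder F Y) k.
Proof.
move=> w; apply: jetB; last exact: weyl_jetY w k.
by apply: jetM; [apply: jetM; [exact: jet_cst | exact: jet_id] | exact: (weyl_jetF w)].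
Qed.

(** The flux would vanish with F; reflection in the imaginary axis treats Re k < 0. On the axis
    itself nothing is said yet: zeros there can be excluded only for a pair of half lines without
    negative eigenvalue. *)
Lemma weyl_ne0 F Y k : weyl F Y -> 0 <= Im k -> Re k != 0 -> F k != 0.
Proof.
move=> w k0; rewrite neq_lt => /orP[s0|s0].
  have := @weyl_pos F Y w (- k^*%C); rewrite ImN ImJ opprK ReN ReJ oppr_gt0 => /(_ k0 s0).
  rewrite (weyl_symF w); apply: contraTneq => ->; by rewrite !reim !(mul0r, oppr0, addr0) ltxx.
by have := weyl_pos w k0 s0; apply: contraTneq => ->; rewrite !reim !(mul0r, oppr0, addr0) ltxx.
Qed.

Lemma weyl_far F Y : weyl F Y -> exists r : R, [/\ 0 < r & forall k, 0 <= Im k -> r <= nC k ->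
  2^-1 <= nC (F k)].
Proof.
move=> w; have [C HC] := weyl_bdF w.
have HC0 : 0 <= C by have := HC 0; rewrite normc0 mul0r; apply; rewrite Im0.
exists (2 * C + 1); split; first lra.
move=> k k0 kr; have := HC k k0 => H; have n := normc2 (1 : R[i]) (1 - F k).
rewrite normc1 (_ : 1 - (1 - F k) = F k) in n; last by ring.
have e : nC (1 - F k) = nC (F k - 1) by rewrite -normcN opprB.
have := normc_ge0 (F k - 1); rewrite e in n => n0.
have : nC (F k - 1) <= 1 / 2; last lra.
have : (2 * C + 1) * nC (F k - 1) <= C by nra.
nra.
Qed.

End Weyl.

(** * Wronskian and Green function of two half lines *)

Section Pair.
Context {R : realType}.
Variables (Fa Ya Fb Yb : R[i] -> R[i]).
Hypotheses (wa : weyl Fa Ya) (wb : weyl Fb Yb).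
Implicit Types (k h : R[i]) (s t : R).

(* With the two half lines parametrized away from the source, the Wronskian is minus the sum of
   the outward derivatives, and [green] is the value at the source of the outgoing solution. *)
Definition Wr k := - (Fder Fa Ya k * Fb k + Fa k * Fder Fb Yb k).
Definition green k := Fa k * Fb k / Wr k.

Hypothesis nz : forall x : R, 0 < x -> Wr (0 +i* x)%C != 0.

Lemma jet_Wr k : jet Wr k.
Proof.
apply: jetN; apply: jetD; apply: jetM; try exact: jet_Fder.
  exact: weyl_jetF wb k.
exact: weyl_jetF wa k.
Qed.

Lemma Wr_sym k : Wr (- k^*%C) = (Wr k)^*%C.
Proof.
rewrite /Wr !Fder_sym // (weyl_symF wa) (weyl_symF wb).
by apply: ceq; rewrite !reim; ring.
Qed.

Lemma green_sym k : green (- k^*%C) = (green k)^*%C.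
Proof.
by rewrite /green Wr_sym (weyl_symF wa) (weyl_symF wb) !rmorphM /= conjc_inv.
Qed.

(** An identity valid for every [k], in which the flux of each side is weighted by the squared
    modulus at the other side. The sign of [Im green] and its value on the real axis both come from
    it. *)
Lemma Wr_Im k : - Im ((Fa k * Fb k)^*%C * Wr k) =
  nC (Fb k) ^+ 2 * Im ((Fa k)^*%C * Fder Fa Ya k) + nC (Fa k) ^+ 2 * Im ((Fb k)^*%C * Fder Fb Yb k).
Proof. by rewrite !normc_sq /Wr !reim; ring. Qed.

Lemma Wr_Im_pos k : 0 <= Im k -> 0 < Re k -> 0 < - Im ((Fa k * Fb k)^*%C * Wr k).
Proof.
move=> k0 s0; rewrite Wr_Im; apply: addr_gt0; apply: mulr_gt0; try exact: weyl_pos.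
  by rewrite exprn_gt0 // normc_gt0 (weyl_ne0 wb) // lt0r_neq0.
by rewrite exprn_gt0 // normc_gt0 (weyl_ne0 wa) // lt0r_neq0.
Qed.

(** Off the imaginary axis the flux decides; on it this is the hypothesis [nz]. At 0 the Wronskian
    can vanish, as it does for zero potentials, where it is - 2 i k. *)
Lemma Wr_ne0 k : 0 <= Im k -> k != 0 -> Wr k != 0.
Proof.
move=> k0 kn; case: (ltrgtP 0 (Re k)) => s0.
- have := Wr_Im_pos k0 s0; apply: contraTneq => ->.
  by rewrite mulr0 oppr0 ltxx.
- have : 0 < - Im ((Fa (- k^*%C) * Fb (- k^*%C))^*%C * Wr (- k^*%C)).
    by apply: Wr_Im_pos; rewrite ?ImN ?ImJ ?opprK ?ReN ?ReJ ?oppr_gt0.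
  apply: contraTneq; rewrite Wr_sym => ->.
  by rewrite conjc0 mulr0 oppr0 ltxx.
have -> : k = (0 +i* Im k)%C by rewrite s0; case: (k).
apply: nz; rewrite lt_neqAle k0 andbT; apply/eqP => e.
by move/eqP: kn; apply; apply: ceq; rewrite -?s0 -?e.
Qed.

Lemma jet_green k : 0 <= Im k -> k != 0 -> jet green k.
Proof.
move=> k0 kn; apply: jetM.
  by apply: jetM; [exact: weyl_jetF wa k | exact: weyl_jetF wb k].
by apply: jetV; [exact: Wr_ne0 | exact: jet_Wr].
Qed.

Lemma green_Im_pos k : 0 <= Im k -> 0 < Re k -> 0 < Im (green k).
Proof.
move=> k0 s0; have kn : k != 0 by apply: contraTneq s0 => ->; rewrite Re0 ltxx.
have W0 := Wr_ne0 k0 kn; rewrite Im_div // divr_gt0 ?Wr_Im_pos //.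
by rewrite exprn_gt0 // normc_gt0.
Qed.

Lemma green_Im_real s : 0 < s ->
  Im (green s%:C%C) = s * (nC (Fb s%:C%C / Wr s%:C%C) ^+ 2 + nC (Fa s%:C%C / Wr s%:C%C) ^+ 2).
Proof.
move=> s0.
have W0 : Wr s%:C%C != 0.
  by apply: Wr_ne0; rewrite ?ImC //; apply: contraTneq s0 => /(congr1 (@Re R)) /= ->; rewrite ltxx.
rewrite Im_div // Wr_Im !weyl_real // !normcM !normcV.
by field; rewrite normc_eq0.
Qed.

(** With A = |Fa| and B = |Fb|, [Wr_Im] gives s (A^2 + B^2) <= A B |Wr|, and A^2 + B^2 >= 2 A B. *)
Lemma Wr_real_ge s : 0 < s -> 2 * s <= nC (Wr s%:C%C).
Proof.
move=> s0; have s1 : Re (s%:C%C : R[i]) != 0 by rewrite ReC lt0r_neq0.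
have i0 : 0 <= Im (s%:C%C : R[i]) by rewrite ImC.
have a0 := weyl_ne0 wa i0 s1; have b0 := weyl_ne0 wb i0 s1.
have := Wr_Im s%:C%C; rewrite !weyl_real // => H.
have := normc_Im ((Fa s%:C%C * Fb s%:C%C)^*%C * Wr s%:C%C).
rewrite -normrN H normcM normcJ normcM => /(le_trans (ler_norm _)).
move: a0 b0; rewrite -!normc_gt0; set A := nC (Fa _); set B := nC (Fb _) => A0 B0 H2.
have AB : 0 < A * B by rewrite mulr_gt0.
rewrite -(ler_pM2l AB); apply: le_trans H2.
have := sqr_ge0 (A - B); nra.
Qed.

(** Either [Wr] is nonzero at 0, or its zero there is simple, because [Wr_real_ge] forbids a
    quadratic one. *)
Lemma Wr_near0 : exists c d : R, [/\ 0 < c, 0 < d & forall h, nC h < d -> c * nC h <= nC (Wr h)].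
Proof.
have jW := jet_Wr 0.
have [e|W0] := eqVneq (Wr 0) 0; last first.
  have [C [d [d0 C0 Hd]]] := jet_lip jW.
  have w0 : 0 < nC (Wr 0) by rewrite normc_gt0.
  exists (nC (Wr 0) / 2), (Num.min 1 (Num.min d (nC (Wr 0) / 2 / (C + 1)))).
  have C1 : 0 < C + 1 by lra.
  split; rewrite ?lt_min ?ltr01 ?d0 ?divr_gt0 // => h.
  rewrite !lt_min ltr_pdivlMr // => /andP[h1 /andP[h2 h3]].
  have := Hd h h2; rewrite add0r expr1 => h4.
  have := normc2 (Wr 0) (Wr 0 - Wr h).
  rewrite (_ : Wr 0 - (Wr 0 - Wr h) = Wr h); last ring.
  rewrite (_ : nC (Wr 0 - Wr h) = nC (Wr h - Wr 0)); last by rewrite -normcN opprB.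
  have := normc_ge0 h; nra.
have [a [C [d [d0 C0 Hd]]]] := jet_tangent jW.
have {}Hd h : nC h < d -> nC (Wr h - a * h) <= C * nC h ^+ 2.
  by move=> hd; have := Hd h hd; rewrite e !add0r.
have a0 : a != 0.
  apply/negP => /eqP a0.
  (* If the tangent vanished, 2 t <= |Wr t| <= C t^2 for small t > 0. *)
  have : (2 : R) = 0; last by lra.
  apply: (@linear_quad0 _ _ C d) => // t t0 td.
  have nt : nC (t%:C%C) = t by rewrite normcC gtr0_norm.
  have := Hd (t%:C%C); rewrite nt a0 mul0r subr0 => /(_ td); apply: le_trans.
  by rewrite normrM !gtr0_norm // Wr_real_ge.
have aa : 0 < nC a by rewrite normc_gt0.
have C1 : 0 < C + 1 by lra.
exists (nC a / 2), (Num.min d (nC a / 2 / (C + 1))).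
split; rewrite ?lt_min ?d0 ?divr_gt0 // => h.
rewrite lt_min ltr_pdivlMr // => /andP[h2 h3].
have h4 := Hd h h2; have := normc2 (a * h) (a * h - Wr h).
rewrite (_ : a * h - (a * h - Wr h) = Wr h); last ring.
rewrite (_ : nC (a * h - Wr h) = nC (Wr h - a * h)); last by rewrite -normcN opprB.
have n0 := normc_ge0 h; rewrite normcM.
have : nC h * (C * nC h) <= nC h * (nC a / 2) by apply: ler_wpM2l => //; nra.
nra.
Qed.

(** [green] grows at most like 1 / |k| at 0, so one factor k would give boundedness only; the second
    one gives the limit 0. *)
Lemma kkgreen_small e : 0 < e -> exists2 d : R, 0 < d &
  forall h, nC h < d -> nC (h ^+ 2 * green h) < e.
Proof.
move=> e0; have [c [d [c0 d0 Hd]]] := Wr_near0.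
have [C [d' [d'0 C0 Hd']]] := jet_bounded (jetM (weyl_jetF wa 0) (weyl_jetF wb 0)).
have C1 : 0 < C + 1 by lra.
exists (Num.min (Num.min d d') (e * c / (C + 1))); first by rewrite !lt_min d0 d'0 divr_gt0 // mulr_gt0.
move=> h; rewrite !lt_min ltr_pdivlMr // => /andP[/andP[h1 h2] h3].
have [->|hn] := eqVneq h 0; first by rewrite expr0n mul0r normc0.
have := Hd h h1; have := Hd' h h2; rewrite add0r expr0 mulr1 => b1 b2.
rewrite -normc_gt0 in hn.
have W0 : 0 < nC (Wr h) by apply: lt_le_trans b2; rewrite mulr_gt0.
rewrite /green normcM [nC (_ / _)]normcM normcX normcV mulrA ltr_pdivrMr //.
apply: (@lt_le_trans _ _ (e * (c * nC h))); last by rewrite ler_pM2l.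
rewrite expr2; have : nC h * (nC h * (C + 1)) < nC h * (e * c) by rewrite ltr_pM2l.
have := normc_ge0 (Fa h * Fb h); nra.
Qed.

(** [green] is minus the inverse of the sum of the logarithmic derivatives Fder / F = i k - Y / F.
    The witness y is Ya / Fa + Yb / Fb, controlled by |F| >= 1/2 far out. *)
Lemma green_far : exists r : R, 0 < r /\ forall k, 0 <= Im k -> r <= nC k -> exists y : R[i],
  [/\ green k = - (2 * 'i%C * k - y)^-1, nC k <= nC (2 * 'i%C * k - y), 2 * nC y <= nC k &
     nC y <= 2 * (nC (Ya k) + nC (Yb k))].
Proof.
have [ra [ra0 Ha]] := weyl_far wa; have [rb [rb0 Hb]] := weyl_far wb.
have [Ca HCa] := weyl_bdY wa; have [Cb HCb] := weyl_bdY wb.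
have Ca0 : 0 <= Ca by apply: le_trans (HCa 0 _); rewrite ?normc_ge0 ?Im0.
have Cb0 : 0 <= Cb by apply: le_trans (HCb 0 _); rewrite ?normc_ge0 ?Im0.
exists (Num.max ra rb + 4 * (Ca + Cb)); split; first by have := le_max ra ra rb; rewrite lexx /=; lra.
move=> k k0 kr.
have m1 : ra <= Num.max ra rb by rewrite le_max lexx.
have m2 : rb <= Num.max ra rb by rewrite le_max lexx orbT.
have A := Ha k k0 (le_trans (ltac:(lra) : ra <= Num.max ra rb + 4 * (Ca + Cb)) kr).
have B := Hb k k0 (le_trans (ltac:(lra) : rb <= Num.max ra rb + 4 * (Ca + Cb)) kr).
have A0 : Fa k != 0 by rewrite -normc_gt0; lra.
have B0 : Fb k != 0 by rewrite -normc_gt0; lra.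
have ya := HCa k k0; have yb := HCb k k0.
pose y := Ya k / Fa k + Yb k / Fb k.
have ny : nC y <= 2 * (nC (Ya k) + nC (Yb k)).
  apply: le_trans (normcD _ _) _; rewrite mulrDr !normcM (mulrC 2) (mulrC 2 (nC (Yb k))).
  by apply: lerD; apply: ler_wpM2l; rewrite ?normc_ge0 // -[leRHS]invrK; apply: normc_inv_lt.
have n2 : nC (2 * 'i%C * k) = 2 * nC k.
  by rewrite !normcM normci mulr1 (_ : (2 : R[i]) = (2 : R)%:C%C) ?normcC ?gtr0_norm // rmorph_nat.
have n3 := normc2 (2 * 'i%C * k) y.
have n4 : nC k <= nC (2 * 'i%C * k - y) by rewrite n2 in n3; lra.
exists y; split => //; last by lra.
have D0 : 2 * 'i%C * k - y != 0 by rewrite -normc_gt0; lra.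
rewrite /green; have -> : Wr k = - (Fa k * Fb k * (2 * 'i%C * k - y)).
  by rewrite /Wr /Fder /y; field; rewrite A0 B0.
by field; rewrite A0 B0 D0.
Qed.

(** On the axis [green] is real by symmetry, and far up it equals 1 / (2 x + y) with y small. The
    Cauchy-Riemann equations turn the positivity of [Im green] to the right of the axis into
    monotonicity along it. *)
Lemma green_imag_pos (x : R) : 0 < x -> 0 < Re (green (0 +i* x)%C).
Proof.
move=> x0; have [r [r0 Hr]] := green_far.
have far z : r <= z -> 0 < Re (green (0 +i* z)%C).
  move=> rz; have z0 : 0 < z by lra.
  have nz' : nC (0 +i* z)%C = z by rewrite /Normc.normc /= expr0n add0r sqrtr_sqr gtr0_norm.
  have [||y [-> n1 n2 _]] := Hr (0 +i* z)%C; rewrite ?nz' //=; first exact: ltW.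
  rewrite nz' in n1 n2.
  have D0 : 0 < nC (2 * 'i%C * (0 +i* z)%C - y) by lra.
  rewrite ReN ReV; set w := 2 * _ * _ - y in D0 *.
  rewrite oppr_gt0 pmulr_llt0 ?invr_gt0 ?exprn_gt0 //.
  by have := normc_Re y; rewrite ler_norml /w !reim => /andP[? ?]; lra.
apply: lt_le_trans (far (Num.max x r) _) _; first by rewrite le_max lexx orbT.
apply: (@nonincreasing_quad _ (fun t => Re (green (0 +i* t)%C)) 0) => //; last by rewrite le_max lexx.
move=> t t0; have i0 : 0 <= Im (0 +i* t)%C by exact: ltW.
have t1 : (0 +i* t)%C != 0 :> R[i].
  by apply: contraTneq t0 => /(congr1 (@Im R)) /= ->; rewrite ltxx.
have [e1 [C [d [d0 C0 Hd]]]] := jet_tangent (jet_green i0 t1).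
have gI : Im (green (0 +i* t)%C) = 0.
  have := green_sym (0 +i* t)%C.
  have -> : - ((0 +i* t)%C : R[i])^*%C = (0 +i* t)%C by apply: ceq; rewrite !reim; ring.
  move=> /(congr1 (@Im R)); rewrite ImJ; lra.
(* The slope upwards is - Im e1, and Im e1 is the slope of [Im green] to the right, which is
   nonnegative because [Im green] starts from 0 and is positive there. *)
exists (- Im e1), C, d; split=> //.
  rewrite oppr_le0; apply: (@linear_quad_ge0 _ _ C d) => // s s0 sd.
  have ns : nC (s%:C%C) = s by rewrite normcC gtr0_norm.
  have := Hd (s%:C%C); rewrite ns => /(_ sd) /(le_trans (normc_Im _)).
  rewrite (_ : Im _ = Im (green ((0 +i* t)%C + s%:C%C)) - Im e1 * s); last first.
    by rewrite !(ImD, ImN) gI [Im (e1 * _)]ImM ReC ImC; ring.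
  have : 0 < Im (green ((0 +i* t)%C + s%:C%C)).
    by apply: green_Im_pos; rewrite !reim ?addr0 ?add0r // ltW.
  by rewrite ler_norml => ? /andP[_ ?]; lra.
move=> h hd; have nh : nC ('i%C * h%:C%C) = `|h| by rewrite normcM normci mul1r normcC.
have := Hd ('i%C * h%:C%C); rewrite nh => /(_ hd) /(le_trans (normc_Re _)).
have -> : (0 +i* t)%C + 'i%C * h%:C%C = (0 +i* (t + h))%C :> R[i].
  by apply: ceq; rewrite !reim; ring.
rewrite real_normK ?num_real // !(ReD, ReN); congr (_ <= _); congr `|_|.
by rewrite !reim; ring.
Qed.

Lemma weyl_imag_ne0 (x : R) : 0 < x -> Fa (0 +i* x)%C != 0 /\ Fb (0 +i* x)%C != 0.
Proof.
move=> /green_imag_pos g0; split; apply: contraTneq g0; rewrite /green => ->.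
  by rewrite !mul0r ltxx.
by rewrite mulr0 mul0r ltxx.
Qed.

End Pair.


(** * The data determine the Jost solutions at the source *)

Section Conjugation.
Context {R : realType}.
Implicit Types z w : R[i].

Lemma conjcM z w : (z * w)^*%C = z^*%C * w^*%C.
Proof. by apply: ceq; rewrite !reim; ring. Qed.

Lemma conjcB z w : (z - w)^*%C = z^*%C - w^*%C.
Proof. by apply: ceq; rewrite !reim; ring. Qed.

End Conjugation.

Section Core.
Context {R : realType}.
Variables (Fa Ya Fb Yb Ga Za Gb Zb : R[i] -> R[i]).
Hypotheses (wa : weyl Fa Ya) (wb : weyl Fb Yb) (va : weyl Ga Za) (vb : weyl Gb Zb).
Hypothesis nzF : forall x : R, 0 < x -> Wr Fa Ya Fb Yb (0 +i* x)%C != 0.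
Hypothesis nzG : forall x : R, 0 < x -> Wr Ga Za Gb Zb (0 +i* x)%C != 0.
Hypothesis dataB : forall s : R, 0 < s ->
  Fb s%:C%C / Wr Fa Ya Fb Yb s%:C%C = Gb s%:C%C / Wr Ga Za Gb Zb s%:C%C.
Hypothesis dataA : forall s : R, 0 < s ->
  Fa s%:C%C / Wr Fa Ya Fb Yb s%:C%C = Ga s%:C%C / Wr Ga Za Gb Zb s%:C%C.
Implicit Types (k h : R[i]) (s t : R).

Let g1 := green Fa Ya Fb Yb.
Let g2 := green Ga Za Gb Zb.

Let real_ne0 s : 0 < s -> (s%:C%C : R[i]) != 0.
Proof. by apply: contraTneq => /(congr1 (@Re R)) /= ->; rewrite ltxx. Qed.

(* On the real axis [Im green] is [s (|Fa / Wr|^2 + |Fb / Wr|^2)], hence known. *)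
Lemma green_diff0 k : 0 < Im k -> k ^+ 2 * (g1 k - g2 k) = 0.
Proof.
have [r1 [r10 H1]] := green_far wa wb; have [r2 [r20 H2]] := green_far va vb.
have [Ca HCa] := weyl_bdY wa; have [Cb HCb] := weyl_bdY wb.
have [Da HDa] := weyl_bdY va; have [Db HDb] := weyl_bdY vb.
have far z : 0 <= Im z -> Num.max r1 r2 <= nC z -> nC (z ^+ 2 * (g1 z - g2 z)) <=
    2 * (nC (Ya z) + nC (Yb z)) + 2 * (nC (Za z) + nC (Zb z)).
  rewrite ge_max => z0 /andP[zr1 zr2].
  have [y1 [e1 n1 m1 b1]] := H1 z z0 zr1; have [y2 [e2 n2 m2 b2]] := H2 z z0 zr2.
  have zp : 0 < nC z by lra.
  have D1 : 2 * 'i%C * z - y1 != 0 by rewrite -normc_gt0; lra.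
  have D2 : 2 * 'i%C * z - y2 != 0 by rewrite -normc_gt0; lra.
  rewrite /g1 /g2 e1 e2.
  (* The leading terms cancel and the difference is of order z^-2 times y2 - y1, which the factor
     z^2 compensates exactly. *)
  have -> : z ^+ 2 * (- (2 * 'i%C * z - y1)^-1 - - (2 * 'i%C * z - y2)^-1) =
     z / (2 * 'i%C * z - y1) * (z / (2 * 'i%C * z - y2)) * (y2 - y1).
    by field; rewrite D1 D2.
  have q (y : R[i]) : nC z <= nC (2 * 'i%C * z - y) -> nC (z / (2 * 'i%C * z - y)) <= 1.
    by move=> n; rewrite normcM normcV ler_pdivrMr; lra.
  rewrite normcM; apply: (@le_trans _ _ (nC (y2 - y1))).
    rewrite -[leRHS]mul1r; apply: ler_wpM2r; first exact: normc_ge0.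
    rewrite normcM -[leRHS]mul1r; apply: ler_pM; rewrite ?normc_ge0 //; exact: q.
  by apply: le_trans (normcB _ _) _; lra.
have sym z : (- z^*%C) ^+ 2 * (g1 (- z^*%C) - g2 (- z^*%C)) = (z ^+ 2 * (g1 z - g2 z))^*%C.
  rewrite /g1 /g2 !green_sym //.
  by rewrite (conjcM (z ^+ 2)) conjcB !expr2 (conjcM z z) mulrNN.
have realp s : 0 < s -> Im ((s%:C%C) ^+ 2 * (g1 s%:C%C - g2 s%:C%C)) = 0.
  move=> s0; rewrite ImM ImD ImN /g1 /g2 !green_Im_real // dataA // dataB // subrr mulr0 add0r.
  by rewrite expr2 ImM ImC mulr0 mul0r addr0 mul0r.
apply: (@halfplane_zero R (fun k => k ^+ 2 * (g1 k - g2 k)) (2 * (Ca + Cb) + 2 * (Da + Db)) (Num.max r1 r2)).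
- move=> z z0; have zn : z != 0 by apply: contraTneq z0 => ->; rewrite Im0 ltxx.
  apply: jetM; first by apply: (@eq_jet _ (fun z => z * z)) => //; apply: jetM; exact: jet_id.
  by apply: jetB; apply: jet_green => //; exact: ltW.
- move=> z z0 e e0; have [->|zn] := eqVneq z 0; last first.
    have jz : jet (fun k => k ^+ 2 * (g1 k - g2 k)) z.
      apply: jetM; first by apply: (@eq_jet _ (fun z => z * z)) => //; apply: jetM; exact: jet_id.
      by apply: jetB; apply: jet_green.
    exact: (jet_cont jz e0).
  have e2 : 0 < e / 2 by lra.
  have [d1 d10 S1] := kkgreen_small wa wb e2; have [d2 d20 S2] := kkgreen_small va vb e2.
  exists (Num.min d1 d2); first by rewrite lt_min d10.
  move=> h; rewrite lt_min => /andP[h1 h2] _; rewrite add0r (expr2 0) !mul0r Im0 subr0.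
  apply: le_lt_trans (normc_Im _) _; rewrite mulrBr; apply: le_lt_trans (normcB _ _) _.
  by have := S1 h h1; have := S2 h h2; rewrite -/g1 -/g2; lra.
- move=> s; case: (ltrgtP 0 s) => [s0|s0|<-]; first exact: realp.
    have := realp (- s); rewrite oppr_gt0 => /(_ s0).
    have -> : (- s)%:C%C = - ((s%:C%C : R[i])^*%C) by apply: ceq; rewrite !reim; ring.
    by rewrite sym ImJ; lra.
  by rewrite expr2 !mul0r.
- move=> z z0 zr; apply: le_trans (far z z0 zr) _.
  by have := HCa z z0; have := HCb z z0; have := HDa z z0; have := HDb z z0; lra.
- move=> e e0; have e8 : 0 < e / 8 by lra.
  have [K1 D1] := weyl_decY wa e8; have [K2 D2] := weyl_decY wb e8.
  have [K3 D3] := weyl_decY va e8; have [K4 D4] := weyl_decY vb e8.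
  exists (Num.max (Num.max r1 r2) (Num.max (Num.max K1 K2) (Num.max K3 K4))).
  move=> x; rewrite !gt_max => /andP[/andP[x1 x2] /andP[/andP[x3 x4] /andP[x5 x6]]].
  have x0 : 0 < x by lra.
  have nx : nC (0 +i* x)%C = x by rewrite /Normc.normc expr0n add0r sqrtr_sqr gtr0_norm.
  apply: le_lt_trans (far _ _ _) _; rewrite ?nx ?ge_max ?ltW //.
  have := D1 x x3; have := D2 x x4; have := D3 x x5; have := D4 x x6; lra.
Qed.

(** The product of the two data is Fa Fb / Wr^2 and [green] is Fa Fb / Wr. Both are known, hence so
    is [Wr], and then Fa from its datum. *)
Lemma F_eq_real s : 0 < s -> Fa s%:C%C = Ga s%:C%C.
Proof.
move=> s0; have sn := real_ne0 s0; have i0 : 0 <= Im (s%:C%C : R[i]) by rewrite ImC.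
have s1 : Re (s%:C%C : R[i]) != 0 by rewrite ReC lt0r_neq0.
have E0 : (s%:C%C) ^+ 2 * (g1 s%:C%C - g2 s%:C%C) = 0.
  apply: (@jet_limit0 _ (fun k => k ^+ 2 * (g1 k - g2 k))) => //; last exact: green_diff0.
  apply: jetM; first by apply: (@eq_jet _ (fun z => z * z)) => //; apply: jetM; exact: jet_id.
  by apply: jetB; apply: jet_green.
have W1 := Wr_ne0 wa wb nzF i0 sn; have W2 := Wr_ne0 va vb nzG i0 sn.
have a0 := weyl_ne0 wa i0 s1; have b0 := weyl_ne0 wb i0 s1.
move/eqP: E0; rewrite mulf_eq0 expf_eq0 (negbTE sn) /= subr_eq0 /g1 /g2 /green => /eqP E0.
have A := dataA s0; have B := dataB s0.
set W := Wr _ _ _ _ _ in W1 E0 A B; set V := Wr _ _ _ _ _ in W2 E0 A B.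
suff WV : W = V by move: A; rewrite WV => /(mulIf (invr_neq0 W2)).
have AB0 : (Fa s%:C%C / W) * (Fb s%:C%C / W) != 0 by rewrite !mulf_neq0 // invr_neq0.
apply: (mulfI AB0); rewrite [in RHS]A [in RHS]B.
transitivity (Fa s%:C%C * Fb s%:C%C / W); first by rewrite -[LHS]mulrA divfK // mulrAC.
by rewrite E0 -[RHS]mulrA [in RHS]divfK // mulrAC.
Qed.

(** Symmetry extends the equality to s < 0 and makes the difference real at 0. As F - 1 is O(1 / k),
    [halfplane_zero] applies; the boundary is reached by continuity. *)
Lemma F_eq k : 0 <= Im k -> Fa k = Ga k.
Proof.
have [Ca HCa] := weyl_bdF wa; have [Cb HCb] := weyl_bdF va.
have jD z : jet (fun k => Fa k - Ga k) z.
  by apply: jetB; [exact: (weyl_jetF wa) | exact: (weyl_jetF va)].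
have bd z : 0 <= Im z -> nC z * nC (Fa z - Ga z) <= Ca + Cb.
  move=> z0; have -> : Fa z - Ga z = (Fa z - 1) - (Ga z - 1) by ring.
  apply: (@le_trans _ _ (nC z * (nC (Fa z - 1) + nC (Ga z - 1)))).
    by apply: ler_wpM2l; [exact: normc_ge0 | exact: normcB].
  by rewrite mulrDr lerD ?HCa ?HCb.
have C0 : 0 <= Ca + Cb by have := bd 0; rewrite normc0 mul0r Im0; apply.
have rl s : s != 0 -> Fa s%:C%C - Ga s%:C%C = 0.
  rewrite neq_lt => /orP[s0|s0]; last by rewrite F_eq_real // subrr.
  have -> : s%:C%C = - (((- s)%:C%C : R[i])^*%C) by apply: ceq; rewrite !reim; ring.
  by rewrite (weyl_symF wa) (weyl_symF va) F_eq_real ?subrr // oppr_gt0.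
have H z : 0 < Im z -> Fa z - Ga z = 0.
  apply: (@halfplane_zero R (fun k => Fa k - Ga k) (Ca + Cb) 1) => //.
  - by move=> y y0 e e0; exact: (jet_cont (jD y) e0).
  - move=> s; have [->|s0] := eqVneq s 0; last by rewrite rl.
    apply: (@linear_quad0 _ _ (0 : R) 1) => // t t0 t1.
    have S : Fa (- (0 : R[i])^*%C) - Ga (- (0 : R[i])^*%C) = (Fa 0 - Ga 0)^*%C.
      by rewrite (weyl_symF wa) (weyl_symF va) rmorphB.
    have e0 : - (0 : R[i])^*%C = 0 by rewrite conjc0 oppr0.
    move: S; rewrite e0 => /(congr1 (@Im R)); rewrite ImJ => S.
    have -> : Im (Fa 0%:C%C - Ga 0%:C%C) = 0 by lra.
    by rewrite !mul0r normr0.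
  - move=> y y0 y1; have := bd y y0; have := normc_ge0 (Fa y - Ga y); nra.
  - move=> e e0; exists ((Ca + Cb) / e) => x; rewrite ltr_pdivrMr // => xe.
    have x0 : 0 < x by have := mulr_ge0 C0 (ltW e0); nra.
    have nx : nC (0 +i* x)%C = x by rewrite /Normc.normc expr0n add0r sqrtr_sqr gtr0_norm.
    have := bd (0 +i* x)%C (ltW x0); rewrite nx; nra.
by move=> k0; apply/eqP; rewrite -subr_eq0; apply/eqP; apply: (jet_limit0 (jD k) k0 H).
Qed.

(* [Fder Ga Za - Fder Fa Ya], which is real relative to [Fa] on the real axis. *)
Let D k := Ya k - Za k.

Let jD k : jet D k.
Proof. by apply: jetB; [exact: (weyl_jetY wa) | exact: (weyl_jetY va)]. Qed.

Let Dsym k : D (- k^*%C) = (D k)^*%C.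
Proof. by rewrite /D (weyl_symY wa) (weyl_symY va) rmorphB. Qed.

Let DF_Im s : 0 < s -> Im ((Fa s%:C%C)^*%C * D s%:C%C) = 0.
Proof.
move=> s0; have i0 : 0 <= Im (s%:C%C : R[i]) by rewrite ImC.
have -> : D s%:C%C = Fder Ga Za s%:C%C - Fder Fa Ya s%:C%C.
  by rewrite /Fder F_eq // /D; ring.
rewrite mulrBr ImD ImN [X in _ - X](weyl_real wa) // F_eq // (weyl_real va) //; exact: subrr.
Qed.

Let quot_Im s : Im (D s%:C%C / Fa s%:C%C) = 0.
Proof.
have pos t : 0 < t -> Im (D t%:C%C / Fa t%:C%C) = 0.
  move=> t0; have F0 : Fa t%:C%C != 0 by apply: (weyl_ne0 wa); rewrite ?ImC // ReC lt0r_neq0.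
  rewrite Im_div //; have := DF_Im t0; rewrite !ImM !ReJ !ImJ => H.
  by apply/eqP; rewrite mulf_eq0; apply/orP; left; apply/eqP; lra.
case: (ltrgtP 0 s) => [|s0|<-]; first exact: pos.
  have := pos (- s); rewrite oppr_gt0 => /(_ s0).
  have -> : (- s)%:C%C = - ((s%:C%C : R[i])^*%C) by apply: ceq; rewrite !reim; ring.
  by rewrite Dsym (weyl_symF wa) -conjc_inv -rmorphM ImJ; lra.
have e0 : - (0 : R[i])^*%C = 0 by rewrite conjc0 oppr0.
have /(congr1 (@Im R)) := Dsym 0; have /(congr1 (@Im R)) := weyl_symF wa 0.
rewrite e0 !ImJ => h1 h2.
have F0 : Im (Fa 0) = 0 by lra.
have D0 : Im (D 0) = 0 by lra.
rewrite [Fa _]complexE [D _]complexE F0 D0 !mulr0 !addr0 -fmorphV -rmorphM ImC //.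
Qed.

(** The only possible zero of [Fa] in the closed half plane is 0. There Fa = a h + O(h^2) with a
    nonzero and purely imaginary, D = b h + O(h^2), and the quotient tends to b / a, which is
    real. *)
Lemma quot_cont : Im_continuous_closed (fun k => D k / Fa k).
Proof.
have jq z : Fa z != 0 -> jet (fun k => D k / Fa k) z.
  by move=> F0; apply: jetM; [exact: jD | apply: jetV => //; exact: (weyl_jetF wa)].
move=> z z0 e e0; have [F0|F0] := eqVneq (Fa z) 0; last exact: (jet_cont (jq _ F0) e0).
have [zE|zn] := eqVneq z 0; last first.
  exfalso; have [s0|s0] := eqVneq (Re z) 0; last by have := weyl_ne0 wa z0 s0; rewrite F0 eqxx.
  have zi : 0 < Im z.
    rewrite lt_neqAle z0 andbT; apply/eqP => i0; move/eqP: zn; apply.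
    by apply: ceq; rewrite -?i0 ?s0.
  have [] := weyl_imag_ne0 wa wb nzF zi.
  have -> : (0 +i* Im z)%C = z by rewrite -s0; case: (z).
  by rewrite F0 eqxx.
rewrite {z z0}zE in F0 *.
have [a Ha] := jet_tangent (weyl_jetF wa 0).
have [b Hb] := jet_tangent (jD 0).
have {}Ha : bigO 2 (fun h => Fa h - a * h) by apply: eq_bigO Ha => h; rewrite F0 !add0r.
have lD : bigO 1 (fun h => D h - D 0) by apply: eq_bigO (jet_lip (jD 0)) => h; rewrite add0r.
have bFd : bigO 0 (fun h => Fder Fa Ya h).
  by apply: eq_bigO (jet_bounded (jet_Fder 0 wa)) => h; rewrite add0r.
have bD : bigO 0 (fun h => D h) by apply: eq_bigO (jet_bounded (jD 0)) => h; rewrite add0r.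
(* A double zero would make the flux O(t^2), while it equals t on the real axis. *)
have a0 : a != 0.
  apply/negP => /eqP a0.
  have : (1 : R) = 0; last by lra.
  apply: (@bigO2_slope _ _ _ (bigOM Ha bFd)); exists 1 => // t t0 _.
  rewrite mul1r -[in X in X <= _](weyl_real wa t0) a0 mul0r subr0.
  by apply: le_trans (normc_Im _) _; rewrite !normcM normcJ.
have e0' : - (0 : R[i])^*%C = 0 by rewrite conjc0 oppr0.
have ImD0 : Im (D 0) = 0 by have /(congr1 (@Im R)) := Dsym 0; rewrite e0' ImJ; lra.
(* The symmetry of Fa read at first order says a = - conj a. *)
have Rea : Re a = 0.
  suff : 2 * Re a = 0 by lra.
  have cj : bigO 2 (fun h => (Fa (- h^*%C))^*%C - (a * - h^*%C)^*%C).
    case: Ha => C [d [d0 C0 H]]; exists C, d; split=> // h hd.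
    by have := H (- h^*%C); rewrite normcN normcJ -rmorphB normcJ; apply.
  apply: (@bigO2_slope _ _ _ (bigOB Ha cj)); exists 1 => // t t0 _.
  rewrite (weyl_symF wa); apply: le_trans (normc_Re _).
  rewrite !(ReD, ReN, ReJ) !ReM !ReN !ReJ !ImN !ImJ ReC ImC.
  by rewrite le_eqVlt; apply/orP; left; apply/eqP; rewrite -normrN; congr `|_|; ring.
(* Im (conj Fa D) vanishes for t > 0 and is t Im (conj a D 0) at first order; a is imaginary and D 0
   is real. *)
have D0 : D 0 = 0.
  have : Im (a^*%C * D 0) = 0.
    have cj : bigO 2 (fun h => (Fa h - a * h)^*%C).
      by case: Ha => C [d [d0 C0 H]]; exists C, d; split=> // h hd; rewrite normcJ H.
    have la : bigO 1 (fun h => (a * h)^*%C).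
      by case: (bigOh 1 a) => C [d [d0 C0 H]]; exists C, d; split=> // h hd; rewrite normcJ; apply: H.
    apply: (@bigO2_slope _ _ _ (bigOD (bigOM cj bD) (bigOM la lD))); exists 1 => // t t0 _.
    apply: le_trans (normc_Im _).
    have -> : (Fa t%:C%C - a * t%:C%C)^*%C * D t%:C%C + (a * t%:C%C)^*%C * (D t%:C%C - D 0) =
      (Fa t%:C%C)^*%C * D t%:C%C - t%:C%C * (a^*%C * D 0).
      by rewrite conjcB !conjcM conjc_real; ring.
    rewrite ImD ImN DF_Im // add0r normrN [Im (_%:C%C * _)]ImM ReC ImC mul0r addr0.
    by rewrite mulrC.
  rewrite ImM ReJ Rea ImJ mul0r add0r mulNr => /eqP; rewrite oppr_eq0 mulf_eq0 => /orP[/eqP i0|/eqP r0].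
    by exfalso; move/eqP: a0; apply; apply: ceq.
  by apply: ceq.
have {}Hb : bigO 2 (fun h => D h - b * h) by apply: eq_bigO Hb => h; rewrite D0 !add0r.
have Fnear : exists c d : R, [/\ 0 < c, 0 < d & forall h, nC h < d -> c * nC h <= nC (Fa h)].
  case: Ha => C [d [d0 C0 H]]; have aa : 0 < nC a by rewrite normc_gt0.
  have C1 : 0 < C + 1 by lra.
  exists (nC a / 2), (Num.min d (nC a / 2 / (C + 1))).
  split; rewrite ?lt_min ?d0 ?divr_gt0 // => h.
  rewrite lt_min ltr_pdivlMr // => /andP[h2 h3].
  have h4 := H h h2; have := normc2 (a * h) (a * h - Fa h).
  rewrite (_ : a * h - (a * h - Fa h) = Fa h); last ring.
  rewrite (_ : nC (a * h - Fa h) = nC (Fa h - a * h)); last by rewrite -normcN opprB.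
  have n0 := normc_ge0 h; rewrite normcM.
  have : nC h * (C * nC h) <= nC h * (nC a / 2) by apply: ler_wpM2l => //; nra.
  nra.
have [c [d [c0 d0 Fn]]] := Fnear.
have Q : bigO 2 (fun h => (D h - b * h) * a - b * (Fa h - a * h)).
  have H1 := bigOM Hb (bigOcst a); have H2 := bigOM (bigOcst b) Ha.
  by apply: bigOB; [move: H1; rewrite addn0 | ].
case: Q => C [d' [d'0 C0 HQ]].
have quot h : nC h < d -> nC h < d' -> h != 0 -> nC (D h / Fa h - b / a) <= C / (c * nC a) * nC h.
  move=> h1 h2 hn; have nh : 0 < nC h by rewrite normc_gt0.
  have f1 := Fn h h1; have aa : 0 < nC a by rewrite normc_gt0.
  have fh : 0 < nC (Fa h) by apply: lt_le_trans f1; rewrite mulr_gt0.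
  have fn : Fa h != 0 by rewrite -normc_gt0.
  have -> : D h / Fa h - b / a = ((D h - b * h) * a - b * (Fa h - a * h)) / (Fa h * a).
    by field; rewrite fn a0.
  have := HQ h h2; rewrite [nC (_ / (_ * _))]normcM normcV normcM => q.
  rewrite ler_pdivrMr ?mulr_gt0 //; apply: le_trans q _.
  have -> : C / (c * nC a) * nC h * (nC (Fa h) * nC a) = C * nC h * (nC (Fa h) / c).
    by field; rewrite !lt0r_neq0.
  rewrite expr2 mulrA; apply: ler_wpM2l; first by rewrite mulr_ge0 // ltW.
  by rewrite ler_pdivlMr // mulrC.
(* b / a is the limit of quotients that are real on the real axis. *)
have ba : Im (b / a) = 0.
  apply: (@linear_quad0 _ _ (C / (c * nC a)) (Num.min d d')); first by rewrite lt_min d0.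
  move=> t t0; rewrite lt_min => /andP[t1 t2].
  have nt : nC (t%:C%C) = t by rewrite normcC gtr0_norm.
  have := quot t%:C%C; rewrite nt => /(_ t1 t2 (real_ne0 t0)) /(le_trans (normc_Im _)).
  rewrite ImD ImN quot_Im sub0r normrN normrM (gtr0_norm t0) expr2 mulrA => H.
  by rewrite ler_pM2r.
have Cq : 0 < C / (c * nC a) + 1.
  by rewrite ltr_wpDl // divr_ge0 // mulr_ge0 ?normc_ge0 // ltW.
exists (Num.min (Num.min d d') (e / (C / (c * nC a) + 1))).
  by rewrite !lt_min d0 d'0 divr_gt0.
move=> h; rewrite !lt_min ltr_pdivlMr // => /andP[/andP[h1 h2] h3] _; rewrite add0r.
rewrite F0 invr0 mulr0 Im0 subr0.
have [->|hn] := eqVneq h 0; first by rewrite F0 invr0 mulr0 Im0 normr0.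
have := quot h h1 h2 hn => /(le_trans (normc_Im _)); rewrite ImD ImN ba subr0 => /le_lt_trans; apply.
by have := normc_ge0 h; nra.
Qed.

Theorem weyl_core (x : R) : 0 < x ->
  Fa (0 +i* x)%C = Ga (0 +i* x)%C /\ Fder Fa Ya (0 +i* x)%C = Fder Ga Za (0 +i* x)%C.
Proof.
move=> x0; have ix : 0 < Im (0 +i* x)%C by [].
have FG : Fa (0 +i* x)%C = Ga (0 +i* x)%C by apply: F_eq; exact: ltW.
split=> //; rewrite /Fder FG; congr (_ - _); apply/eqP; rewrite -subr_eq0; apply/eqP.
have Fn z : 0 < Im z -> Fa z != 0.
  move=> z0; have [s0|s0] := eqVneq (Re z) 0; last by apply: (weyl_ne0 wa) => //; exact: ltW.
  have [] := weyl_imag_ne0 wa wb nzF z0.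
  by have -> : (0 +i* Im z)%C = z by rewrite -s0; case: (z).
have [Ca HCa] := weyl_bdY wa; have [Cb HCb] := weyl_bdY va.
have [r [r0 Hr]] := weyl_far wa.
have far z : 0 <= Im z -> r <= nC z -> nC (D z / Fa z) <= 2 * (nC (Ya z) + nC (Za z)).
  move=> z0 zr; have f2 := Hr z z0 zr.
  rewrite normcM mulrC; apply: ler_pM; rewrite ?normc_ge0 //; last exact: normcB.
  by rewrite -[leRHS]invrK; apply: normc_inv_lt.
have : D (0 +i* x)%C / Fa (0 +i* x)%C = 0.
  apply: (@halfplane_zero R (fun k => D k / Fa k) (2 * (Ca + Cb)) r) => //.
  - move=> z z0; apply: jetM; first exact: jD.
    by apply: jetV; [exact: Fn | exact: (weyl_jetF wa)].
  - exact: quot_cont.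
  - by move=> z z0 zr; apply: le_trans (far z z0 zr) _; have := HCa z z0; have := HCb z z0; lra.
  - move=> e e0; have e8 : 0 < e / 4 by lra.
    have [K1 D1] := weyl_decY wa e8; have [K2 D2] := weyl_decY va e8.
    exists (Num.max r (Num.max K1 K2)) => y; rewrite !gt_max => /andP[y1 /andP[y2 y3]].
    have y0 : 0 < y by lra.
    have ny : nC (0 +i* y)%C = y by rewrite /Normc.normc expr0n add0r sqrtr_sqr gtr0_norm.
    apply: le_lt_trans (far _ _ _) _; rewrite ?ny ?ltW //.
    by have := D1 y y2; have := D2 y y3; lra.
by move/eqP; rewrite mulf_eq0 invr_eq0 (negbTE (Fn _ ix)) orbF => /eqP.
Qed.

End Core.


(** * Lebesgue integrals on the line *)

Section Integral.
Context {R : realType}.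
Local Notation mu := (@lebesgue_measure R).
Implicit Types (f g : R -> R) (a b c : R).

Definition L1 f := mu.-integrable setT (EFin \o f).
Definition I f : R := \int[mu]_x f x.

Lemma L1_meas f : L1 f -> measurable_fun setT f.
Proof. by move=> /integrableP[/measurable_EFinP]. Qed.

Lemma eq_I f g : f =1 g -> I f = I g.
Proof. by move=> /funext ->. Qed.

Lemma eq_L1 f g : f =1 g -> L1 f -> L1 g.
Proof. by move=> /funext ->. Qed.

Lemma L1_le f g : measurable_fun setT f -> (forall x, `|f x| <= g x) -> L1 g -> L1 f.
Proof.
move=> mf fg Lg; apply: (le_integrable measurableT _ _ Lg); first exact/measurable_EFinP.
by move=> x _; rewrite /= lee_fin; apply: le_trans (fg x) _; exact: ler_norm.
Qed.

Lemma L1D f g : L1 f -> L1 g -> L1 (fun x => f x + g x).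
Proof. by move=> hf hg; exact: (integrableD measurableT hf hg). Qed.

Lemma L1Z c f : L1 f -> L1 (fun x => c * f x).
Proof. by move=> hf; exact: (integrableZl measurableT c hf). Qed.

Lemma L1N f : L1 f -> L1 (fun x => - f x).
Proof. by move=> hf; apply: eq_L1 (L1Z (-1) hf) => x; rewrite mulN1r. Qed.

Lemma L1B f g : L1 f -> L1 g -> L1 (fun x => f x - g x).
Proof. by move=> hf hg; apply: L1D => //; exact: L1N. Qed.

Lemma L1norm f : L1 f -> L1 (fun x => `|f x|).
Proof. by move=> hf; exact: (integrable_abse hf). Qed.

Lemma L1_0 : L1 (fun _ => 0).
Proof. exact: (@integrable0 _ _ _ mu setT). Qed.

Lemma ID f g : L1 f -> L1 g -> I (fun x => f x + g x) = I f + I g.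
Proof. by move=> hf hg; exact: (RintegralD measurableT hf hg). Qed.

Lemma IB f g : L1 f -> L1 g -> I (fun x => f x - g x) = I f - I g.
Proof. by move=> hf hg; exact: (RintegralB measurableT hf hg). Qed.

Lemma IZ c f : L1 f -> I (fun x => c * f x) = c * I f.
Proof. by move=> hf; exact: RintegralZl. Qed.

Lemma IN f : L1 f -> I (fun x => - f x) = - I f.
Proof.
move=> hf; rewrite -mulN1r -IZ //; apply: eq_I => x; by rewrite mulN1r.
Qed.

Lemma I0 : I (fun _ => 0) = 0.
Proof. by rewrite /I /Rintegral integral0. Qed.

Lemma I_ge0 f : (forall x, 0 <= f x) -> 0 <= I f.
Proof. by move=> f0; apply: Rintegral_ge0. Qed.

Lemma I_le f g : L1 f -> L1 g -> (forall x, f x <= g x) -> I f <= I g.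
Proof. by move=> hf hg fg; apply: le_Rintegral. Qed.

Lemma I_abs f : L1 f -> `|I f| <= I (fun x => `|f x|).
Proof. by move=> hf; exact: (le_normr_Rintegral measurableT hf). Qed.

Lemma I_abs_le f g : L1 f -> L1 g -> (forall x, `|f x| <= g x) -> `|I f| <= I g.
Proof.
by move=> hf hg fg; apply: le_trans (I_abs hf) _; apply: I_le => //; exact: L1norm.
Qed.

Lemma L1M f g M : L1 f -> measurable_fun setT g -> (forall x, `|g x| <= M) -> L1 (fun x => f x * g x).
Proof.
move=> hf mg gM; apply: (@L1_le _ (fun x => M * `|f x|)).
- by apply: measurable_funM => //; exact: L1_meas.
- by move=> x; rewrite normrM mulrC ler_wpM2r.
- by apply: L1Z; exact: L1norm.
Qed.

(** The Heaviside function, with value 0 at 0. Cutoffs are factors of this kind, so that all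
    integrals run over the whole line. *)
Definition hv (x : R) : R := (0 < x)%R%:R.

Lemma hv_pos x : 0 < x -> hv x = 1. Proof. by rewrite /hv => ->. Qed.
Lemma hv_neg x : x <= 0 -> hv x = 0. Proof. by rewrite /hv leNgt => /negbTE ->. Qed.
Lemma hv_ge0 x : 0 <= hv x. Proof. by rewrite /hv. Qed.
Lemma hv_le1 x : hv x <= 1. Proof. by rewrite /hv; case: (0 < x). Qed.
Lemma hv_norm x : `|hv x| <= 1. Proof. by rewrite ger0_norm ?hv_ge0 // hv_le1. Qed.

Lemma measurable_hv d (T : measurableType d) (D : set T) (h : T -> R) : measurable D -> measurable_fun D h ->
  measurable_fun D (fun x => hv (h x)).
Proof.
move=> mD mh; rewrite [X in measurable_fun _ X](_ : _ = \1_[set y : R | 0 < y] \o h).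
  apply: measurableT_comp => //; apply: measurable_indic.
  have -> : [set y : R | 0 < y] = `]0, +oo[%classic.
    by apply/seteqP; split=> x /=; rewrite in_itv /= andbT.
  exact: measurable_itv.
by apply/funext => x /=; rewrite indicE /hv mem_setE.
Qed.

Lemma L1_itv a b : L1 (fun x => hv (x - a) * hv (b - x)).
Proof.
have mab : measurable (`]a, b[%classic : set R) by [].
apply: (@eq_L1 (\1_(`]a, b[%classic))); last first.
  exact: (integrable_indic_itv a b false true).
move=> x; rewrite indicE /hv !subr_gt0 -natrM mulnb; congr (_%:R).
by rewrite mem_setE /= in_itv.
Qed.

Lemma I_itv a b : a <= b -> I (fun x => hv (x - a) * hv (b - x)) = b - a.
Proof.
move=> ab; have mab : measurable (`]a, b[%classic : set R) by [].
rewrite (@eq_I _ (\1_(`]a, b[%classic))); last first.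
  move=> x; rewrite indicE /hv !subr_gt0 -natrM mulnb; congr (_%:R).
  by rewrite mem_setE /= in_itv.
rewrite /I /Rintegral integral_indic // setIT.
have e := @lebesgue_measure_itv R `]a, b[.
rewrite [X in fine X](_ : _ = (b - a)%:E) //; apply: etrans e _; rewrite /= lte_fin.
by rewrite lt_neqAle ab andbT; case: eqVneq => [->|_]; rewrite -?EFinB //= subrr.
Qed.

Lemma L1_bounded f a b M : measurable_fun setT f -> (forall x, `|f x| <= M) ->
  (forall x, (x <= a) || (b <= x) -> f x = 0) -> L1 f.
Proof.
move=> mf fM f0; apply: (@L1_le _ (fun x => M * (hv (x - a) * hv (b - x)))) => //.
  move=> x; have [xa|xa] := lerP x a.
    by rewrite f0 ?xa // normr0 hv_neg ?mul0r ?mulr0 // subr_le0.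
  have [bx|bx] := lerP b x.
    by rewrite f0 ?bx ?orbT // normr0 [hv (b - x)]hv_neg ?mulr0 // subr_le0.
  by rewrite !hv_pos ?subr_gt0 // !mulr1.
by apply: L1Z; exact: L1_itv.
Qed.

Lemma I_pushforward (s : measurableTypeR R -> measurableTypeR R) :
  measurable_fun setT s ->
  (forall A, measurable A -> mu A = pushforward mu s A) ->
  forall f, L1 f -> L1 (f \o s) /\ I (f \o s) = I f.
Proof.
move=> ms es f hf; have mf := L1_meas hf.
have e0 A : measurable A -> A `<=` setT -> mu A = pushforward mu s A by move=> mA _; exact: es.
have Lfs : mu.-integrable (s @^-1` setT) (EFin \o f \o s).
  apply/integrableP; split.
    by rewrite preimage_setT; apply/measurable_EFinP; exact: measurableT_comp.
  move: hf => /integrableP[_]; apply: le_lt_trans.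
  rewrite [leRHS](@eq_measure_integral _ _ _ setT (pushforward mu s) mu) //.
  by rewrite ge0_integral_pushforward //; apply: measurableT_comp => //; exact/measurable_EFinP.
split; first by rewrite preimage_setT in Lfs.
rewrite /I /Rintegral; congr fine.
rewrite [RHS](@eq_measure_integral _ _ _ setT (pushforward mu s) mu) //.
have mEf : measurable_fun [set: measurableTypeR R] (EFin \o f) by exact/measurable_EFinP.
by have := integral_pushforward ms mEf Lfs measurableT; rewrite preimage_setT => ->.
Qed.

Lemma I_shift c f : L1 f -> L1 (fun x => f (x + c)) /\ I (fun x => f (x + c)) = I f.
Proof.
move=> hf; have ms : measurable_fun setT (fun x : measurableTypeR R => (x + c : measurableTypeR R)).
  exact: measurable_funD.
apply: (I_pushforward ms) => // A mA.
apply: (@lebesgue_measure_unique R (pushforward mu (fun x : measurableTypeR R => (x + c : measurableTypeR R)))) => //.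
move=> _ [[a b] _ <-] /=; rewrite /pushforward /=.
rewrite [X in _ = mu X](_ : _ = `](a - c), (b - c)]%classic).
  rewrite !lebesgue_measure_itv /= !lte_fin ltrD2r; case: ifP => // _.
  by rewrite -!EFinB; congr EFin; ring.
by apply/seteqP; split=> x /=; rewrite !in_itv /= ltrBlDr lerBrDr.
Qed.

Lemma I_reflect f : L1 f -> L1 (fun x => f (- x)) /\ I (fun x => f (- x)) = I f.
Proof.
move=> hf; apply: (@I_pushforward (fun x : measurableTypeR R => (- x : measurableTypeR R))) => //.
  exact: oppr_measurable.
by move=> A mA; exact/esym/lebesgue_measureN.
Qed.

End Integral.

(** * Parametric integrals and exchange of integrations *)

Section Fubini.
Context {R : realType}.
Local Notation mu := (@lebesgue_measure R).

(** No integrability is assumed: positive and negative parts are treated separately, and [fine] maps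
    infinite values to 0. *)
Lemma measurable_I d (T : measurableType d) (K : T * R -> R) : measurable_fun setT K ->
  measurable_fun setT (fun z => I (fun y => K (z, y))).
Proof.
move=> mK; move/measurable_EFinP : (mK) => mK'.
have m1 := @measurable_fun_fubini_tonelli_F _ _ T _ R mu _ (measurable_funepos mK') (fun z => funepos_ge0 (EFin \o K) z).
have m2 := @measurable_fun_fubini_tonelli_F _ _ T _ R mu _ (measurable_funeneg mK') (fun z => funeneg_ge0 (EFin \o K) z).
have := measurableT_comp (@fine_measurable R setT measurableT) (emeasurable_funB m1 m2).
apply: eq_measurable_fun => z _ /=; rewrite /I /Rintegral integralE; congr fine.
by rewrite /fubini_F; congr (_ - _)%E; apply: eq_integral => y _; rewrite ?funeposE ?funenegE.
Qed.

(** Sections at fixed x are integrable for every x, those at fixed y only almost everywhere; on the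
    exceptional null set the inner [I] has whatever value its definition gives. *)
Lemma fubini (H : R * R -> R) (g : R -> R) : measurable_fun setT H -> L1 g ->
  (forall x, L1 (fun y => H (x, y))) -> (forall x, I (fun y => `|H (x, y)|) <= g x) ->
  [/\ I (fun x => I (fun y => H (x, y))) = I (fun y => I (fun x => H (x, y))),
      L1 (fun x => I (fun y => H (x, y))), L1 (fun y => I (fun x => H (x, y))) &
      {ae mu, forall y, L1 (fun x => H (x, y))}].
Proof.
move=> mH hg hH Hg.
move/measurable_EFinP : (mH) => mH'.
have fin x : (\int[mu]_y (EFin \o H) (x, y))%E = (I (fun y => H (x, y)))%:E.
  by rewrite /I /Rintegral fineK //; exact: integrable_fin_num (hH x).
have fin' x : (\int[mu]_y `|(EFin \o H) (x, y)|)%E = (I (fun y => `|H (x, y)|))%:E.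
  rewrite /I /Rintegral fineK //; exact: integrable_fin_num (L1norm (hH x)).
have iH : (mu \x mu)%E.-integrable setT (EFin \o H).
  apply/integrable12ltyP => //; under eq_integral do rewrite fin'.
  move: hg => /integrableP[mg]; apply: le_lt_trans; apply: ge0_le_integral => //.
  - by move=> x _; rewrite lee_fin; exact: I_ge0.
  - apply/measurable_EFinP; apply: (@measurable_I _ R (fun z => `|H z|)).
    exact: measurableT_comp.
  - exact: measurableT_comp.
  - by move=> x _; rewrite lee_fin /=; apply: le_trans (Hg x) (ler_norm _).
have FE := Fubini iH; have iF := integrable_fubini_F iH.
have ms : measurable_fun [set: R * R] (fun z : R * R => (H (z.2, z.1))%:E).
  by apply: (measurableT_comp mH'); exact: measurable_swap.
have iHs : (mu \x mu)%E.-integrable setT (fun z : R * R => (H (z.2, z.1))%:E).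
  apply/integrable12ltyP => //.
  have fy : (\int[mu]_y \int[mu]_x `|(EFin \o H) (x, y)| < +oo)%E.
    by move/integrable21ltyP : iH; apply.
  exact: fy.
have iG : mu.-integrable setT (fubini_G mu (EFin \o H)) := integrable_fubini_F iHs.
have eG : (EFin \o (fun y => I (fun x => H (x, y)))) = fubini_G mu (EFin \o H) %[ae mu].
  by have := ae_integrable2 iH; apply: filterS => y iy _; rewrite /= /I /Rintegral fineK //; exact: integrable_fin_num iy.
have mIG : measurable_fun setT (EFin \o (fun y => I (fun x => H (x, y)))).
  apply/measurable_EFinP; apply: (@measurable_I _ R (fun z => H (z.2, z.1))).
  by apply: measurableT_comp => //; exact: measurable_swap.
split.
- rewrite /I /Rintegral; congr fine.
  apply: (@etrans _ _ (\int[mu]_x \int[mu]_y (EFin \o H) (x, y))%E).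
    by apply: eq_integral => x _; rewrite fin.
  apply: etrans FE _; apply: ae_eq_integral => //.
    exact: measurable_int iG.
  exact: ae_eq_sym eG.
- rewrite /L1 (_ : EFin \o _ = fubini_F mu (EFin \o H)); first exact: iF.
  by apply/funext => x /=; rewrite -fin.
- move/integrableP: iG => [m1 i1]; apply/integrableP; split=> //; move: i1.
  apply: le_lt_trans; rewrite le_eqVlt; apply/orP; left; apply/eqP.
  apply: ae_eq_integral => //; first [exact: measurableT_comp | exact: (ae_eq_abse eG)].
- exact: ae_integrable2 iH.
Qed.

End Fubini.


(** * Absolutely continuous functions *)

Section AbsolutelyContinuous.
Context {R : realType}.
Local Notation mu := (@lebesgue_measure R).
Implicit Types (f g h k : R -> R) (A x t : R).

(** The indicator of the open interval from 0 to x, identically 0 when x <= 0. *)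
Definition win x t : R := hv t * hv (x - t).

(* Absolute continuity on [0, A] with derivative [g]; only the values of [g] on ]0, A[ matter. *)
Definition ac A f g := L1 (fun t => g t * win A t) /\
  forall x, 0 <= x <= A -> f x = f 0 + I (fun t => g t * win x t).

Lemma win_ge0 x t : 0 <= win x t. Proof. by rewrite mulr_ge0 ?hv_ge0. Qed.
Lemma win_le1 x t : win x t <= 1.
Proof. by rewrite -[1]mulr1 ler_pM ?hv_ge0 ?hv_le1. Qed.
Lemma win_norm x t : `|win x t| <= 1.
Proof. by rewrite ger0_norm ?win_ge0 ?win_le1. Qed.
Lemma win_in x t : 0 < t -> t < x -> win x t = 1.
Proof. by move=> t0 tx; rewrite /win !hv_pos ?mulr1 // subr_gt0. Qed.
Lemma win_out x t : ~~ ((0 < t) && (t < x)) -> win x t = 0.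
Proof.
rewrite negb_and -!leNgt /win => /orP[t0|xt]; first by rewrite hv_neg ?mul0r.
by rewrite [hv (x - t)]hv_neg ?mulr0 // subr_le0.
Qed.

Lemma winM A x t : x <= A -> win A t * hv (x - t) = win x t.
Proof.
move=> xA; have [t1|t1] := boolP ((0 < t) && (t < x)).
  move/andP: (t1) => [t0 tx]; rewrite !win_in ?hv_pos ?mulr1 ?subr_gt0 //.
  exact: lt_le_trans xA.
rewrite (win_out t1); move: t1; rewrite negb_and -!leNgt => /orP[t0|xt].
  by rewrite win_out ?mul0r // negb_and -!leNgt t0.
by rewrite hv_neg ?mulr0 // subr_le0.
Qed.

Lemma measurable_hvB x : measurable_fun setT (fun t => hv (x - t)).
Proof. by apply: measurable_hv => //; exact: measurable_funB. Qed.

Lemma measurable_win x : measurable_fun setT (win x).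
Proof.
by apply: measurable_funM; [apply: measurable_hv => // | exact: measurable_hvB].
Qed.

Lemma L1_win x : L1 (win x).
Proof. by apply: eq_L1 (L1_itv 0 x) => t; rewrite subr0. Qed.

Lemma L1_hvB g x : L1 g -> L1 (fun t => g t * hv (x - t)).
Proof. by move=> hg; apply: (L1M (M := 1)) => //; [exact: measurable_hvB | move=> t; exact: hv_norm]. Qed.

Lemma eq_ac A f g f' g' : (forall x, 0 <= x <= A -> f x = f' x) ->
  (forall x, 0 < x < A -> g x = g' x) -> 0 <= A -> ac A f g -> ac A f' g'.
Proof.
move=> ff gg A0 [Lg H].
have e x t : x <= A -> g t * win x t = g' t * win x t.
  move=> xA; have [/andP[t0 tx]|t1] := boolP ((0 < t) && (t < x)); last by rewrite win_out ?mulr0.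
  by rewrite gg // t0 (lt_le_trans tx xA).
split; first by apply: eq_L1 Lg => t; rewrite e.
move=> x x1; have /andP[x0 xA] := x1.
by rewrite -ff // H // -ff ?lexx //; congr (_ + _); apply: eq_I => t; rewrite e.
Qed.

Lemma ac_le A A' f g : A' <= A -> ac A f g -> ac A' f g.
Proof.
move=> AA [Lg H]; split.
  by apply: eq_L1 (L1_hvB A' Lg) => t; rewrite -mulrA winM.
by move=> x /andP[x0 xA]; rewrite H // x0 (le_trans xA).
Qed.

Lemma acE A f g : (forall x, 0 <= x <= A -> f x = f 0 + I (fun t => (g t * win A t) * hv (x - t))) ->
  L1 (fun t => g t * win A t) -> ac A f g.
Proof.
move=> H Lg; split=> // x x1; rewrite H //; congr (_ + _); apply: eq_I => t.
by rewrite -mulrA winM //; case/andP: x1.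
Qed.

Lemma acP A f g : ac A f g -> forall x, 0 <= x <= A -> f x = f 0 + I (fun t => (g t * win A t) * hv (x - t)).
Proof.
move=> [Lg H] x x1; rewrite H //; congr (_ + _); apply: eq_I => t.
by rewrite -mulrA winM //; case/andP: x1.
Qed.

Lemma acD A f g f' g' : ac A f g -> ac A f' g' -> ac A (fun x => f x + f' x) (fun x => g x + g' x).
Proof.
move=> H H'; have [L _] := H; have [L' _] := H'; apply: acE.
  move=> x x1; rewrite (acP H) // (acP H') // addrACA -ID; try exact: L1_hvB.
  by congr (_ + _); apply: eq_I => t; rewrite !mulrDl.
by apply: eq_L1 (L1D L L') => t; rewrite mulrDl.
Qed.

Lemma acZ A c f g : ac A f g -> ac A (fun x => c * f x) (fun x => c * g x).
Proof.
move=> H; have [L _] := H; apply: acE.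
  move=> x x1; rewrite (acP H) // mulrDr -IZ; last exact: L1_hvB.
  by congr (_ + _); apply: eq_I => t; rewrite !mulrA.
by apply: eq_L1 (L1Z c L) => t; rewrite mulrA.
Qed.

Lemma acN A f g : ac A f g -> ac A (fun x => - f x) (fun x => - g x).
Proof.
move=> /(acZ (-1)) [L H]; split; first by apply: eq_L1 L => t; rewrite mulN1r.
move=> x x1; rewrite -[LHS]mulN1r H // mulN1r; congr (_ + _).
by apply: eq_I => t; rewrite mulN1r.
Qed.

Lemma ac_cst A c : ac A (fun _ => c) (fun _ => 0).
Proof.
split; first by apply: eq_L1 L1_0 => t; rewrite mul0r.
move=> x _; rewrite (@eq_I _ _ (fun _ => 0)) ?I0 ?addr0 // => t.
by rewrite mul0r.
Qed.

Lemma I_singleton f x : (forall t, t != x -> f t = 0) -> I f = 0.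
Proof.
move=> f0; rewrite /I (_ : f = f \_ [set x]).
  by rewrite -Rintegral_mkcond Rintegral_set1.
apply/funext => t; rewrite patchE; case: ifPn => //.
by rewrite notin_setE /= => /eqP/f0 ->.
Qed.

(** Integration by parts through Fubini: the product of the two integrals is an integral over a
    square, which the diagonal cuts into two triangles. *)
Lemma ac_mul A f g h k : ac A f g -> ac A h k ->
  ac A (fun x => f x * h x) (fun x => g x * h x + f x * k x).
Proof.
move=> Hf Hh; have [LG _] := Hf; have [LK _] := Hh.
set G := (fun t => g t * win A t) in LG; set K := (fun t => k t * win A t) in LK.
(* Nothing is known of f and h outside [0, A]; [F] and [H] agree with them there and are measurable
   and bounded on the whole line. *)
pose F x := f 0 + I (fun t => G t * hv (x - t)).
pose H x := h 0 + I (fun t => K t * hv (x - t)).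
have fF x : 0 <= x <= A -> f x = F x by move=> x1; rewrite (acP Hf).
have hH x : 0 <= x <= A -> h x = H x by move=> x1; rewrite (acP Hh).
have mm g' : L1 g' -> measurable_fun setT (fun x => I (fun t => g' t * hv (x - t))).
  move=> Lg'; have mk : measurable_fun [set: R * R] (fun z : R * R => g' z.2 * hv (z.1 - z.2)).
    apply: measurable_funM; first by apply: measurableT_comp => //; exact: L1_meas.
    by apply: measurable_hv => //; apply: measurable_funB.
  exact: (measurable_I mk).
have bb g' x : L1 g' -> `|I (fun t => g' t * hv (x - t))| <= I (fun t => `|g' t|).
  move=> Lg'; apply: I_abs_le; [exact: L1_hvB | exact: L1norm |].
  by move=> t; rewrite normrM ler_piMr // hv_norm.
have LGH : L1 (fun t => G t * H t).
  apply: (L1M (M := `|h 0| + I (fun t => `|K t|))) => //.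
    by apply: measurable_funD => //; exact: mm.
  by move=> x; apply: le_trans (ler_normD _ _) _; rewrite lerD2l bb.
have LKF : L1 (fun t => K t * F t).
  apply: (L1M (M := `|f 0| + I (fun t => `|G t|))) => //.
    by apply: measurable_funD => //; exact: mm.
  by move=> x; apply: le_trans (ler_normD _ _) _; rewrite lerD2l bb.
have eGK t : (g t * h t + f t * k t) * win A t = G t * H t + K t * F t.
  have [/andP[t0 tx]|t1] := boolP ((0 < t) && (t < A)); last by rewrite /G /K win_out // !mulr0 !mul0r addr0.
  by rewrite /G /K win_in // !mulr1 fF ?hH ?ltW // [k t * _]mulrC.
apply: acE; last by apply: eq_L1 (L1D LGH LKF) => t; rewrite eGK.
move=> x x1; rewrite fF // hH //.
have A0 : 0 <= A by case/andP: x1 => ? ?; apply: le_trans; eassumption.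
rewrite (@eq_I _ _ (fun t => G t * H t * hv (x - t) + K t * F t * hv (x - t))); last first.
  by move=> t; rewrite eGK mulrDl.
rewrite ID; try exact: L1_hvB.
pose P t s := G t * hv (x - t) * (K s * hv (x - s)).
have LGx := L1_hvB x LG; have LKx := L1_hvB x LK.
have LP1 t : L1 (fun s => P t s * hv (t - s)) by apply: L1_hvB; exact: L1Z.
have LP2 t : L1 (fun s => P t s * hv (s - t)).
  apply: (L1M (M := 1)); [exact: L1Z | | move=> s; exact: hv_norm].
  by apply: measurable_hv => //; exact: measurable_funB.
have E1 : I (fun t => G t * H t * hv (x - t)) =
    h 0 * I (fun t => G t * hv (x - t)) + I (fun t => I (fun s => P t s * hv (t - s))).
  rewrite -(IZ (h 0) LGx) -ID; last 2 first.
  - exact: L1Z.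
  - apply: (eq_L1 _ (L1_hvB x (L1B LGH (L1Z (h 0) LG)))) => t.
    rewrite /H mulrDr [h 0 * _]mulrC [X in X * hv _]addrAC subrr add0r -IZ; last exact: L1_hvB.
    rewrite mulrC -IZ; last by apply: L1Z; exact: L1_hvB.
    apply: eq_I => s; rewrite /P /hv !subr_gt0; case: (ltP t x) => tx; rewrite ?mulr0 ?mul0r // !mul1r !mulr1.
    by case: (ltP s t) => st; rewrite ?mulr0 // (lt_trans st tx) !mulr1.
  apply: eq_I => t; rewrite /H mulrDr mulrDl; congr (_ + _); first by ring.
  rewrite -mulrA [X in _ * X]mulrC mulrA -IZ; last exact: L1_hvB.
  apply: eq_I => s; rewrite /P /hv !subr_gt0; case: (ltP t x) => tx; rewrite ?mulr0 ?mul0r // !mulr1.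
  by case: (ltP s t) => st; rewrite ?mulr0 // (lt_trans st tx) !mulr1.
have E2 : I (fun t => K t * F t * hv (x - t)) =
    f 0 * I (fun t => K t * hv (x - t)) + I (fun t => I (fun s => P t s * hv (s - t))).
  have -> : I (fun t => I (fun s => P t s * hv (s - t))) = I (fun s => I (fun t => P t s * hv (s - t))).
    have [||||-> //] := @fubini R (fun z => P z.1 z.2 * hv (z.2 - z.1)) (fun t => `|G t * hv (x - t)| * I (fun s => `|K s * hv (x - s)|)).
    - apply: measurable_funM; last by apply: measurable_hv => //; exact: measurable_funB.
      by apply: measurable_funM; [have := L1_meas LGx | have := L1_meas LKx] => m; apply: (measurableT_comp m).
    - by apply: eq_L1 (L1Z (I (fun s => `|K s * hv (x - s)|)) (L1norm LGx)) => t; rewrite mulrC.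
    - by move=> t; exact: LP2.
    - move=> t /=; rewrite -IZ; last exact: L1norm.
      apply: I_le; [by apply: L1norm; exact: LP2 | by apply: L1Z; exact: L1norm |].
      by move=> s; rewrite -[leRHS]normrM [leLHS]normrM ler_piMr // hv_norm.
  rewrite -(IZ (f 0) LKx) -ID; last 2 first.
  - exact: L1Z.
  - apply: (eq_L1 _ (L1_hvB x (L1B LKF (L1Z (f 0) LK)))) => s.
    rewrite /F mulrDr [f 0 * _]mulrC [X in X * hv _]addrAC subrr add0r -IZ; last exact: L1_hvB.
    rewrite mulrC -IZ; last by apply: L1Z; exact: L1_hvB.
    apply: eq_I => t; rewrite /P /hv !subr_gt0; case: (ltP s x) => sx; rewrite ?mulr0 ?mul0r // !mul1r !mulr1.
    by case: (ltP t s) => ts; rewrite ?mulr0 // (lt_trans ts sx) !mulr1 mulrC.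
  apply: eq_I => s; rewrite /F mulrDr mulrDl; congr (_ + _); first by ring.
  rewrite -mulrA [X in _ * X]mulrC mulrA -IZ; last exact: L1_hvB.
  apply: eq_I => t; rewrite /P /hv !subr_gt0; case: (ltP s x) => sx; rewrite ?mulr0 ?mul0r // !mulr1.
  by case: (ltP t s) => ts; rewrite ?mulr0 // (lt_trans ts sx) !mulr1 mulrC.
rewrite E1 E2.
set a := I (fun t => G t * hv (x - t)); set b := I (fun t => K t * hv (x - t)).
have E3 : I (fun t => I (fun s => P t s * hv (t - s))) + I (fun t => I (fun s => P t s * hv (s - t))) = a * b.
  have mP : measurable_fun setT (fun z : R * R => P z.1 z.2).
    by apply: measurable_funM; [have := L1_meas LGx | have := L1_meas LKx] => m; apply: (measurableT_comp m).
  have bnd (c : R -> R -> R) : measurable_fun setT (fun z : R * R => c z.1 z.2) -> (forall t s, `|c t s| <= 1) ->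
      (forall t, L1 (fun s => P t s * c t s)) -> L1 (fun t => I (fun s => P t s * c t s)).
    move=> mc c1 Lc.
    have [||||_ -> //] := @fubini R (fun z => P z.1 z.2 * c z.1 z.2) (fun t => `|G t * hv (x - t)| * I (fun s => `|K s * hv (x - s)|)).
    - exact: measurable_funM.
    - by apply: eq_L1 (L1Z (I (fun s => `|K s * hv (x - s)|)) (L1norm LGx)) => t; rewrite mulrC.
    - by move=> t; exact: Lc.
    - move=> t /=; rewrite -IZ; last exact: L1norm.
      apply: I_le; [by apply: L1norm; exact: Lc | by apply: L1Z; exact: L1norm |].
      by move=> s; rewrite -[leRHS]normrM [leLHS]normrM ler_piMr.
  rewrite -ID; last 2 first.
  - apply: (bnd (fun t s => hv (t - s))) => //; last by move=> *; exact: hv_norm.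
    by apply: measurable_hv => //; exact: measurable_funB.
  - apply: (bnd (fun t s => hv (s - t))) => //; last by move=> *; exact: hv_norm.
    by apply: measurable_hv => //; exact: measurable_funB.
  rewrite /a mulrC -IZ //; apply: eq_I => t; rewrite mulrC /b -IZ // -ID //.
  (* For fixed t the two triangles miss only the point s = t of the square. *)
  apply/eqP; rewrite -subr_eq0 -IB; [|by apply: L1D|exact: L1Z].
  apply/eqP; apply: (@I_singleton _ t) => s st; rewrite /P /hv !subr_gt0.
  by case: (ltgtP s t) st => [_ _|_ _|->]; rewrite ?eqxx // !(mulr1, mulr0) ?addr0 ?add0r subrr.
have -> : F x * H x = f 0 * h 0 + (h 0 * a + f 0 * b + a * b) by rewrite /F /H -/a -/b; ring.
by rewrite -E3 [X in _ + X]addrACA.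
Qed.

Lemma I_win_itv g x : mu.-integrable `[0, x] (EFin \o g) -> 0 <= x ->
  L1 (fun t => g t * win x t) /\ I (fun t => g t * win x t) = \int[mu]_(t in `[0, x]) g t.
Proof.
move=> ig x0.
have e : (fun t => g t * win x t) = g \_ `]0, x[.
  apply/funext => t; rewrite patchE mem_setE /= in_itv /=.
  case: ifPn => [/andP[t0 tx]|t1]; first by rewrite win_in // mulr1.
  by rewrite win_out // mulr0.
have ig' : mu.-integrable `]0, x[ (EFin \o g).
  by apply: integrableS ig => //; exact: subset_itv_oo_cc.
rewrite e; split.
  rewrite /L1 (_ : EFin \o _ = (EFin \o g) \_ `]0, x[); last by rewrite restrict_EFin.
  have mI : measurable (`]0, x[%classic : set (measurableTypeR R)) by exact: measurable_itv.
  by have [h _] := @integrable_mkcond _ _ R mu _ (EFin \o g) mI; exact: h.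
rewrite /I -Rintegral_mkcond.
rewrite (@Rintegral_itv_bndo_bndc _ (BRight 0) x g ig').
apply: Rintegral_itv_obnd_cbnd.
by apply: integrableS ig => //; exact: subset_itv_oc_cc.
Qed.

Lemma ac_C1 A f g : 0 <= A -> (forall x, is_derive x (1 : R) f (g x)) -> continuous g -> ac A f g.
Proof.
move=> A0 df cg.
have ig x : 0 <= x -> mu.-integrable `[0, x] (EFin \o g).
  move=> x0; apply: continuous_compact_integrable; first exact: segment_compact.
  exact: continuous_subspaceT.
have cf : continuous f.
  by move=> x; apply/differentiable_continuous/derivable1_diffP; have [] := df x.
split; first by have [] := I_win_itv (ig _ A0) A0.
move=> x /andP[x0 xA]; have [_ ->] := I_win_itv (ig _ x0) x0.
move: x0; rewrite le_eqVlt => /predU1P[<-|x0]; first by rewrite set_itv1 Rintegral_set1 addr0.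
suff -> : \int[mu]_(t in `[0, x]) g t = f x - f 0 by rewrite addrC subrK.
rewrite /Rintegral (@continuous_FTC2 R g f 0 x) //.
- exact: continuous_subspaceT.
- split; first by move=> y _; have [] := df y.
  + by apply: cvg_at_right_filter; exact: cf.
  + by apply: cvg_at_left_filter; exact: cf.
- by move=> y _; rewrite derive1E; apply: derive_val; exact: df.
Qed.

End AbsolutelyContinuous.


(** * Complex valued integrals *)

Section ComplexIntegral.
Context {R : realType}.
Local Notation mu := (@lebesgue_measure R).
Implicit Types (f g h : R -> R[i]) (z w : R[i]) (A : R).

Definition cL1 f := L1 (fun x => Re (f x)) /\ L1 (fun x => Im (f x)).
Definition cI f : R[i] := (I (fun x => Re (f x)) +i* I (fun x => Im (f x)))%C.

Lemma eq_cI f g : f =1 g -> cI f = cI g. Proof. by move=> /funext ->. Qed.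
Lemma eq_cL1 f g : f =1 g -> cL1 f -> cL1 g. Proof. by move=> /funext ->. Qed.

Lemma cL1D f g : cL1 f -> cL1 g -> cL1 (fun x => f x + g x).
Proof.
move=> [a b] [c d]; split.
  by apply: eq_L1 (L1D a c) => x; rewrite ReD.
by apply: eq_L1 (L1D b d) => x; rewrite ImD.
Qed.

Lemma cL1Z z f : cL1 f -> cL1 (fun x => z * f x).
Proof.
move=> [a b]; split.
  by apply: eq_L1 (L1B (L1Z (Re z) a) (L1Z (Im z) b)) => x; rewrite ReM.
by apply: eq_L1 (L1D (L1Z (Re z) b) (L1Z (Im z) a)) => x; rewrite ImM.
Qed.

Lemma cL1N f : cL1 f -> cL1 (fun x => - f x).
Proof. by move=> Lf; apply: eq_cL1 (cL1Z (-1) Lf) => x; rewrite mulN1r. Qed.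

Lemma cL1B f g : cL1 f -> cL1 g -> cL1 (fun x => f x - g x).
Proof. by move=> Lf Lg; apply: cL1D => //; exact: cL1N. Qed.

Lemma cI0 : cI (fun _ => 0) = 0. Proof. by rewrite /cI !I0. Qed.

Lemma cID f g : cL1 f -> cL1 g -> cI (fun x => f x + g x) = cI f + cI g.
Proof.
move=> [a b] [c d]; apply: ceq; rewrite ?ReD ?ImD /= -ID //; apply: eq_I => x.
  exact: ReD.
exact: ImD.
Qed.

Lemma cIZ z f : cL1 f -> cI (fun x => z * f x) = z * cI f.
Proof.
move=> [a b]; apply: ceq; rewrite ?ReM ?ImM /=.
  by rewrite -!IZ // -IB; [apply: eq_I => x; rewrite ReM | exact: L1Z | exact: L1Z].
by rewrite -!IZ // -ID; [apply: eq_I => x; rewrite ImM | exact: L1Z | exact: L1Z].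
Qed.

Lemma cIN f : cL1 f -> cI (fun x => - f x) = - cI f.
Proof.
by move=> Lf; rewrite -mulN1r -cIZ //; apply: eq_cI => x; rewrite mulN1r.
Qed.

Lemma cIB f g : cL1 f -> cL1 g -> cI (fun x => f x - g x) = cI f - cI g.
Proof. by move=> Lf Lg; rewrite cID ?cIN //; exact: cL1N. Qed.

(** Multiplication by the conjugate of the integral reduces the bound to a real integral, with no
    loss of a constant. *)
Lemma cI_le f (g : R -> R) : cL1 f -> L1 g -> (forall x, nC (f x) <= g x) -> nC (cI f) <= I g.
Proof.
move=> Lf Lg fg; set w := cI f.
have g0 x : 0 <= g x by apply: le_trans (fg x); exact: normc_ge0.
have [->|w0] := eqVneq w 0; first by rewrite normc0 I_ge0.
rewrite -normc_gt0 in w0; rewrite -(ler_pM2l w0) -expr2.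
have -> : nC w ^+ 2 = Re (w^*%C * w) by rewrite mulrC mulcJ.
rewrite -cIZ // -IZ //; apply: le_trans (ler_norm _) _.
apply: (@I_abs_le _ (fun x => Re (w^*%C * f x))).
- by have [] := cL1Z w^*%C Lf.
- exact: L1Z.
by move=> x; apply: le_trans (normc_Re _) _; rewrite normcM normcJ ler_wpM2l // normc_ge0.
Qed.

Definition cmeas d (T : measurableType d) (f : T -> R[i]) :=
  measurable_fun setT (fun x => Re (f x)) /\ measurable_fun setT (fun x => Im (f x)).

Lemma cmeas_comp d (T : measurableType d) d' (T' : measurableType d') (f : T -> R[i]) (p : T' -> T) :
  cmeas f -> measurable_fun setT p -> cmeas (fun x => f (p x)).
Proof. by move=> [a b] mp; split; [exact: (measurableT_comp a) | exact: (measurableT_comp b)]. Qed.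

Lemma cmeasM d (T : measurableType d) (f g : T -> R[i]) : cmeas f -> cmeas g -> cmeas (fun x => f x * g x).
Proof.
move=> [a b] [c e]; split.
  rewrite (_ : (fun x => _) = (fun x => Re (f x) * Re (g x) - Im (f x) * Im (g x))).
    by apply: measurable_funB; exact: measurable_funM.
  by apply/funext => x; rewrite ReM.
rewrite (_ : (fun x => _) = (fun x => Re (f x) * Im (g x) + Im (f x) * Re (g x))).
  by apply: measurable_funD; exact: measurable_funM.
by apply/funext => x; rewrite ImM.
Qed.

Lemma cmeasD d (T : measurableType d) (f g : T -> R[i]) : cmeas f -> cmeas g -> cmeas (fun x => f x + g x).
Proof.
move=> [a b] [c e]; split.
  rewrite (_ : (fun x => _) = (fun x => Re (f x) + Re (g x))); last by apply/funext => x; rewrite ReD.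
  exact: measurable_funD.
rewrite (_ : (fun x => _) = (fun x => Im (f x) + Im (g x))); last by apply/funext => x; rewrite ImD.
exact: measurable_funD.
Qed.

Lemma cmeas_real d (T : measurableType d) (f : T -> R) : measurable_fun setT f -> cmeas (fun x => (f x)%:C%C).
Proof. by move=> mf; split => //; exact: measurable_cst. Qed.

Lemma cmeas_cst d (T : measurableType d) z : cmeas (fun _ : T => z).
Proof. by split; exact: measurable_cst. Qed.

Lemma cmeas_cI d (T : measurableType d) (K : T * R -> R[i]) : cmeas K -> cmeas (fun p => cI (fun y => K (p, y))).
Proof. by move=> [a b]; split; [exact: (measurable_I a) | exact: (measurable_I b)]. Qed.

Lemma cL1_le f (g : R -> R) : cmeas f -> (forall x, nC (f x) <= g x) -> L1 g -> cL1 f.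
Proof.
move=> [a b] fg Lg; split; apply: L1_le Lg => // x.
  exact: le_trans (normc_Re _) (fg x).
exact: le_trans (normc_Im _) (fg x).
Qed.

Lemma cL1_real (f : R -> R) : L1 f -> cL1 (fun x => (f x)%:C%C).
Proof. by move=> Lf; split=> //; exact: L1_0. Qed.

Lemma cI_real (f : R -> R) : cI (fun x => (f x)%:C%C) = (I f)%:C%C.
Proof. by apply: ceq => //=; exact: I0. Qed.

Lemma cL1M (a : R -> R) f M : L1 a -> cmeas f -> (forall x, nC (f x) <= M) -> cL1 (fun x => (a x)%:C%C * f x).
Proof.
move=> La mf fM; apply: (@cL1_le _ (fun x => M * `|a x|)).
- by apply: cmeasM => //; apply: cmeas_real; exact: L1_meas.
- by move=> x; rewrite normcM normcC mulrC ler_wpM2r.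
- by apply: L1Z; exact: L1norm.
Qed.

Lemma cfubini (H : R * R -> R[i]) (h : R -> R -> R) (g : R -> R) : cmeas H ->
  (forall x y, nC (H (x, y)) <= h x y) -> (forall x, L1 (h x)) -> (forall x, I (h x) <= g x) -> L1 g ->
  [/\ cI (fun x => cI (fun y => H (x, y))) = cI (fun y => cI (fun x => H (x, y))),
      cL1 (fun x => cI (fun y => H (x, y))) & cL1 (fun y => cI (fun x => H (x, y)))].
Proof.
move=> [mR mI] Hh Lh hg Lg.
have h0 x y : 0 <= h x y by apply: le_trans (Hh x y); exact: normc_ge0.
have LH x : cL1 (fun y => H (x, y)).
  apply: (@cL1_le _ (h x)) => //; split.
    by apply: (measurableT_comp mR); exact: measurable_pair1.
  by apply: (measurableT_comp mI); exact: measurable_pair1.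
have LR x : L1 (fun y => Re (H (x, y))) by have [] := LH x.
have LI x : L1 (fun y => Im (H (x, y))) by have [] := LH x.
have bR x : I (fun y => `|Re (H (x, y))|) <= g x.
  apply: le_trans (hg x); apply: I_le; [exact: L1norm | exact: Lh | move=> y].
  exact: le_trans (normc_Re _) (Hh x y).
have bI x : I (fun y => `|Im (H (x, y))|) <= g x.
  apply: le_trans (hg x); apply: I_le; [exact: L1norm | exact: Lh | move=> y].
  exact: le_trans (normc_Im _) (Hh x y).
have [a b c _] := fubini mR Lg LR bR; have [a' b' c' _] := fubini mI Lg LI bI.
split; [apply: ceq; [exact: a | exact: a'] | split; [exact: b | exact: b'] | split; [exact: c | exact: c']].
Qed.

Definition cac A f g := ac A (fun x => Re (f x)) (fun x => Re (g x)) /\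
  ac A (fun x => Im (f x)) (fun x => Im (g x)).

Lemma eq_cac A f g f' g' : (forall x, 0 <= x <= A -> f x = f' x) ->
  (forall x, 0 < x < A -> g x = g' x) -> 0 <= A -> cac A f g -> cac A f' g'.
Proof.
move=> ff gg A0 [a b]; split.
  by apply: eq_ac a => // x x1; rewrite ?ff ?gg.
by apply: eq_ac b => // x x1; rewrite ?ff ?gg.
Qed.

Lemma cac_le A A' f g : A' <= A -> cac A f g -> cac A' f g.
Proof. by move=> AA [a b]; split; apply: ac_le; eassumption. Qed.

Lemma cac_real A (f g : R -> R) : ac A f g -> cac A (fun x => (f x)%:C%C) (fun x => (g x)%:C%C).
Proof. by move=> H; split=> //; exact: ac_cst. Qed.

Lemma cac_cst A z : cac A (fun _ => z) (fun _ => 0).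
Proof. by split; exact: ac_cst. Qed.

Lemma cacD A f g f' g' : cac A f g -> cac A f' g' -> cac A (fun x => f x + f' x) (fun x => g x + g' x).
Proof.
move=> [a b] [c d]; split.
  have [L H] := acD a c; split; first by apply: eq_L1 L => t; rewrite ReD.
  by move=> x x1; rewrite !ReD H //; congr (_ + _); apply: eq_I => t; rewrite ReD.
have [L H] := acD b d; split; first by apply: eq_L1 L => t; rewrite ImD.
by move=> x x1; rewrite !ImD H //; congr (_ + _); apply: eq_I => t; rewrite ImD.
Qed.

Lemma ac_ext A (f f' g g' : R -> R) : f =1 f' -> g =1 g' -> ac A f g -> ac A f' g'.
Proof. by move=> /funext -> /funext ->. Qed.

Lemma cac_ext A f f' g g' : f =1 f' -> g =1 g' -> cac A f g -> cac A f' g'.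
Proof. by move=> /funext -> /funext ->. Qed.

Lemma cac_mul A f g h k : cac A f g -> cac A h k ->
  cac A (fun x => f x * h x) (fun x => g x * h x + f x * k x).
Proof.
move=> [a b] [c d]; split.
  apply: ac_ext (acD (ac_mul a c) (acN (ac_mul b d))) => x; rewrite ?ReM //.
  by rewrite !reim; ring.
apply: ac_ext (acD (ac_mul a d) (ac_mul b c)) => x; rewrite ?ImM //.
by rewrite !reim; ring.
Qed.

Lemma cacZ A z f g : cac A f g -> cac A (fun x => z * f x) (fun x => z * g x).
Proof.
by move=> H; apply: cac_ext (cac_mul (cac_cst A z) H) => x //; rewrite mul0r add0r.
Qed.

Lemma cacN A f g : cac A f g -> cac A (fun x => - f x) (fun x => - g x).
Proof.
by move=> H; apply: cac_ext (cacZ (-1) H) => x; rewrite mulN1r.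
Qed.

Lemma cacJ A f g : cac A f g -> cac A (fun x => (f x)^*%C) (fun x => (g x)^*%C).
Proof.
move=> [a b]; split.
  by apply: ac_ext a => x; rewrite ReJ.
by apply: ac_ext (acN b) => x; rewrite ImJ.
Qed.

Lemma cacE A f g : cac A f g -> forall x, 0 <= x <= A -> f x = f 0 + cI (fun t => (win x t)%:C%C * g t).
Proof.
move=> [[La Ha] [Lb Hb]] x x1; apply: ceq; rewrite ?ReD ?ImD /=.
  by rewrite Ha //; congr (_ + _); apply: eq_I => t; rewrite !reim mul0r subr0 mulrC.
by rewrite Hb //; congr (_ + _); apply: eq_I => t; rewrite !reim mul0r addr0 mulrC.
Qed.

Lemma cac_L1 A f g : cac A f g -> cL1 (fun t => (win A t)%:C%C * g t).
Proof.
move=> [[La _] [Lb _]]; split.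
  by apply: eq_L1 La => t; rewrite !reim mul0r subr0 mulrC.
by apply: eq_L1 Lb => t; rewrite !reim mul0r addr0 mulrC.
Qed.

Lemma cac_bound A f g M : cac A f g -> (forall x, 0 < x < A -> nC (g x) <= M) ->
  forall x, 0 <= x <= A -> nC (f x - f 0) <= M * x.
Proof.
move=> Hf gM x x1; have /andP[x0 xA] := x1; rewrite (cacE Hf x1) addrC addKr.
have -> : M * x = I (fun t => M * win x t).
  rewrite IZ; last exact: L1_win.
  rewrite (@eq_I _ _ (fun t => hv (t - 0) * hv (x - t))); last by move=> t; rewrite subr0.
  by rewrite I_itv // subr0.
apply: cI_le; [exact: cac_L1 (cac_le xA Hf) | by apply: L1Z; exact: L1_win |].
move=> t; have [/andP[t0 tx]|t1] := boolP ((0 < t) && (t < x)).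
  by rewrite win_in // mulr1 mul1r; apply: gM; rewrite t0 (lt_le_trans tx).
by rewrite win_out // mulr0 mul0r normc0.
Qed.

Lemma cac_const A f g : cac A f g -> (forall x, 0 < x < A -> g x = 0) ->
  forall x, 0 <= x <= A -> f x = f 0.
Proof.
move=> Hf g0 x x1; apply/eqP; rewrite -subr_eq0 -normc_eq0 eq_le normc_ge0 andbT.
have := @cac_bound A f g 0 Hf _ x x1; rewrite mul0r; apply=> y y1.
by rewrite g0 // normc0.
Qed.

End ComplexIntegral.


(** * Exponentials and Laplace transforms *)

Section ComplexExponential.
Context {R : realType}.
Implicit Types (z w : R[i]) (A s t x : R).

Definition cexp z : R[i] := ((expR (Re z) * cos (Im z)) +i* (expR (Re z) * sin (Im z)))%C.

Lemma cexpD z w : cexp (z + w) = cexp z * cexp w.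
Proof.
by rewrite /cexp ReD ImD expRD cosD sinD; apply: ceq; rewrite !reim; ring.
Qed.

Lemma cexp0 : cexp 0 = 1.
Proof. by rewrite /cexp Re0 Im0 expR0 cos0 sin0 mul1r mul1r. Qed.

Lemma normc_cexp z : nC (cexp z) = expR (Re z).
Proof.
rewrite /Normc.normc /cexp !exprMn -mulrDr cos2Dsin2 mulr1 sqrtr_sqr.
by rewrite ger0_norm // expR_ge0.
Qed.

Lemma cexp_ne0 z : cexp z != 0.
Proof. by rewrite -normc_gt0 normc_cexp expR_gt0. Qed.

Lemma cexpN z : cexp (- z) = (cexp z)^-1.
Proof.
by apply: (mulfI (cexp_ne0 z)); rewrite -cexpD subrr cexp0 divff // cexp_ne0.
Qed.

Lemma cexpJ z : cexp z^*%C = (cexp z)^*%C.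
Proof. by rewrite /cexp ReJ ImJ cosN sinN; apply: ceq; rewrite !reim //; ring. Qed.

Let dM (f g : R -> R) x (a b : R) : is_derive x (1 : R) f a -> is_derive x (1 : R) g b ->
  is_derive x (1 : R) (fun y => f y * g y) (f x * b + g x * a).
Proof. by move=> df dg; exact: is_deriveM. Qed.

Let dlin (a x : R) : is_derive x (1 : R) (fun t => a * t) a.
Proof.
apply: is_derive_quad; exists 0, 1; split=> // h _.
by rewrite mul0r (_ : _ - _ - _ = 0) ?normr0 //; ring.
Qed.

Let dexp (a x : R) : is_derive x (1 : R) (fun t => expR (a * t)) (a * expR (a * x)).
Proof. by rewrite mulrC; apply: (is_derive1_comp (g := fun t => a * t)). Qed.

Let dcos (a x : R) : is_derive x (1 : R) (fun t => cos (a * t)) (- (a * sin (a * x))).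
Proof. by rewrite mulrC -mulNr; apply: (is_derive1_comp (g := fun t => a * t)). Qed.

Let dsin (a x : R) : is_derive x (1 : R) (fun t => sin (a * t)) (a * cos (a * x)).
Proof. by rewrite mulrC; apply: (is_derive1_comp (g := fun t => a * t)). Qed.

Let der_cont (f f' : R -> R) : (forall x, is_derive x (1 : R) f (f' x)) -> continuous f.
Proof. by move=> df x; apply/differentiable_continuous/derivable1_diffP; have [] := df x. Qed.

Lemma cexp_Re_derive z x : is_derive x (1 : R) (fun t => Re (cexp (z * t%:C%C))) (Re (z * cexp (z * x%:C%C))).
Proof.
have e t : Re (z * t%:C%C) = Re z * t /\ Im (z * t%:C%C) = Im z * t by rewrite !reim; split; ring.
rewrite (_ : (fun t => _) = (fun t => expR (Re z * t) * cos (Im z * t))); last first.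
  by apply/funext => t; rewrite /cexp; have [-> ->] := e t.
apply: (is_derive_eq (dM (dexp _ _) (dcos _ _))).
by rewrite /cexp; have [-> ->] := e x; rewrite ReM !ReP !ImP; ring.
Qed.

Lemma cexp_Im_derive z x : is_derive x (1 : R) (fun t => Im (cexp (z * t%:C%C))) (Im (z * cexp (z * x%:C%C))).
Proof.
have e t : Re (z * t%:C%C) = Re z * t /\ Im (z * t%:C%C) = Im z * t by rewrite !reim; split; ring.
rewrite (_ : (fun t => _) = (fun t => expR (Re z * t) * sin (Im z * t))); last first.
  by apply/funext => t; rewrite /cexp; have [-> ->] := e t.
apply: (is_derive_eq (dM (dexp _ _) (dsin _ _))).
by rewrite /cexp; have [-> ->] := e x; rewrite ImM !ReP !ImP; ring.
Qed.

Lemma cexp_continuous z : ccontinuous (fun t => cexp (z * t%:C%C)).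
Proof. by split; apply: der_cont => x; [exact: cexp_Re_derive | exact: cexp_Im_derive]. Qed.

Lemma cac_cexp A z : 0 <= A -> cac A (fun t => cexp (z * t%:C%C)) (fun t => z * cexp (z * t%:C%C)).
Proof.
move=> A0; have [cr ci] := cexp_continuous z.
split; apply: ac_C1 => //.
- by move=> x; exact: cexp_Re_derive.
- rewrite (_ : (fun t => _) = (fun t => Re z * Re (cexp (z * t%:C%C)) - Im z * Im (cexp (z * t%:C%C)))).
    by move=> x; apply: (@cvgB _ R^o); apply: (@cvgM R); [exact: cvg_cst | exact: cr | exact: cvg_cst | exact: ci].
  by apply/funext => t; rewrite ReM.
- by move=> x; exact: cexp_Im_derive.
- rewrite (_ : (fun t => _) = (fun t => Re z * Im (cexp (z * t%:C%C)) + Im z * Re (cexp (z * t%:C%C)))).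
    by move=> x; apply: (@cvgD _ R^o); apply: (@cvgM R); [exact: cvg_cst | exact: ci | exact: cvg_cst | exact: cr].
  by apply/funext => t; rewrite ImM.
Qed.

Lemma cmeas_continuous (f : R -> R[i]) : ccontinuous f -> cmeas f.
Proof. by move=> [a b]; split; exact: continuous_measurable_fun. Qed.

Lemma cmeas_cexp z : cmeas (fun t => cexp (z * t%:C%C)).
Proof. by apply: cmeas_continuous; exact: cexp_continuous. Qed.

Lemma ac_id A : 0 <= A -> ac A (fun t => t) (fun _ => 1).
Proof.
by move=> A0; apply: ac_C1 => // x; first [exact: is_derive_id | exact: cvg_cst].
Qed.

(** Each remainder is the primitive of z times the previous one, and the first derivative is
    controlled by |exp (z s)| <= e^2. *)
Lemma cexp_taylor z : nC z <= 2 -> forall t, 0 <= t <= 1 ->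
  nC (cexp (z * t%:C%C) - 1 - z * t%:C%C - z ^+ 2 / 2 * (t ^+ 2)%:C%C) <= expR 2 * nC z ^+ 3.
Proof.
move=> z2.
have id1 := cac_real (@ac_id 1 ler01).
have sq1 : cac 1 (fun t : R => (t ^+ 2)%:C%C) (fun t : R => (2 * t)%:C%C).
  apply: cac_ext (cac_real (ac_mul (@ac_id 1 ler01) (@ac_id 1 ler01))) => t.
    by rewrite expr2.
  by congr (_%:C%C); ring.
have E0 := cac_cexp z (@ler01 R).
pose R0 t := cexp (z * t%:C%C) - 1.
have H0 : cac 1 R0 (fun t => z * cexp (z * t%:C%C)).
  by apply: cac_ext (cacD E0 (cac_cst 1 (-1))) => t //; rewrite addr0.
have H1 : cac 1 (fun t => R0 t - z * t%:C%C) (fun t => z * R0 t).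
  apply: cac_ext (cacD H0 (cacN (cacZ z id1))) => t //.
  by rewrite /R0; ring.
have H2 : cac 1 (fun t => R0 t - z * t%:C%C - z ^+ 2 / 2 * (t ^+ 2)%:C%C) (fun t => z * (R0 t - z * t%:C%C)).
  apply: cac_ext (cacD H1 (cacN (cacZ (z ^+ 2 / 2) sq1))) => t //.
  have -> : (2 * t)%:C%C = 2 * t%:C%C :> R[i] by rewrite rmorphM rmorph_nat.
  by field.
have z0 := normc_ge0 z; have e0 := expR_gt0 (2 : R).
have R00 : R0 0 = 0 by rewrite /R0 mulr0 cexp0 subrr.
have B0 t : 0 <= t <= 1 -> nC (R0 t) <= expR 2 * nC z.
  move=> t1; have := @cac_bound R _ _ _ (nC z * expR 2) H0 _ t t1; rewrite R00 subr0 => B.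
  apply: (@le_trans _ _ (nC z * expR 2 * t)); last first.
    by have := mulr_ge0 z0 (ltW e0); case/andP: t1; nra.
  apply: B => s /andP[s0 s1]; rewrite normcM normc_cexp; apply: ler_wpM2l => //.
  rewrite ler_expR !reim; have := normc_Re z; rewrite ler_norml => /andP[_ ?].
  by rewrite mulr0 subr0; nra.
have B1 t : 0 <= t <= 1 -> nC (R0 t - z * t%:C%C) <= expR 2 * nC z ^+ 2.
  move=> t1; have := @cac_bound R _ _ _ (expR 2 * nC z ^+ 2) H1 _ t t1.
  rewrite R00 mulr0 !subr0 => B; apply: (@le_trans _ _ (expR 2 * nC z ^+ 2 * t)); last first.
    by case/andP: t1 => ? ?; rewrite ler_piMr // mulr_ge0 ?exprn_ge0 // ltW.
  apply: B => s /andP[s0 s1]; rewrite normcM.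
  have := B0 s; rewrite (ltW s0) (ltW s1) => /(_ isT) b.
  rewrite (_ : expR 2 * nC z ^+ 2 = nC z * (expR 2 * nC z)); last ring.
  exact: ler_wpM2l.
move=> t t1; have := @cac_bound R _ _ _ (expR 2 * nC z ^+ 3) H2 _ t t1.
rewrite R00 expr0n !mulr0 !subr0 => B; apply: (@le_trans _ _ (expR 2 * nC z ^+ 3 * t)).
  apply: B => s /andP[s0 s1]; rewrite normcM.
  have := B1 s; rewrite (ltW s0) (ltW s1) => /(_ isT) b.
  rewrite (_ : expR 2 * nC z ^+ 3 = nC z * (expR 2 * nC z ^+ 2)); last ring.
  exact: ler_wpM2l.
by case/andP: t1 => ? ?; rewrite ler_piMr // mulr_ge0 ?exprn_ge0 // ltW.
Qed.

End ComplexExponential.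

(** * Laplace transforms of functions carried by the unit interval *)

Section Laplace.
Context {R : realType}.
Implicit Types (b c : R -> R) (k h : R[i]) (t x : R).

Definition ek k t : R[i] := cexp (2 * 'i%C * k * t%:C%C).

Definition Lap b k : R[i] := cI (fun t => (b t)%:C%C * ek k t).

(** Bounded support makes [Lap b] regular at every k, and support in t > 0 makes it bounded in the
    closed upper half plane. *)
Definition nice b := L1 b /\ forall t, ~~ (0 < t <= 1) -> b t = 0.

Lemma ekD k s t : ek k (s + t) = ek k s * ek k t.
Proof. by rewrite /ek rmorphD mulrDr cexpD. Qed.

Lemma ek_norm k t : nC (ek k t) = expR (- (2 * Im k * t)).
Proof. by rewrite /ek normc_cexp; congr expR; rewrite !reim; ring. Qed.

Lemma ek_le1 k t : 0 <= Im k -> 0 <= t -> nC (ek k t) <= 1.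
Proof.
move=> k0 t0; rewrite ek_norm -expR0 ler_expR oppr_le0 mulr_ge0 // mulr_ge0 //.
Qed.

Lemma ek_conj k t : ek (- k^*%C) t = (ek k t)^*%C.
Proof. by rewrite /ek -cexpJ; congr cexp; apply: ceq; rewrite !reim; ring. Qed.

Lemma cmeas_ek k : cmeas (ek k).
Proof. exact: cmeas_cexp. Qed.

Lemma ek_bound k t : 0 < t <= 1 -> nC (ek k t) <= expR (2 * nC k).
Proof.
move=> /andP[t0 t1]; rewrite ek_norm ler_expR.
have := normc_Im k; rewrite ler_norml => /andP[a _]; have := normc_ge0 k; nra.
Qed.

Lemma cL1_nice b (g : R -> R[i]) M : nice b -> cmeas g -> (forall t, 0 < t <= 1 -> nC (g t) <= M) ->
  cL1 (fun t => (b t)%:C%C * g t).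
Proof.
move=> [Lb sb] mg gM; apply: (@cL1_le _ _ (fun t => `|M| * `|b t|)).
- by apply: cmeasM => //; apply: cmeas_real; exact: L1_meas.
- move=> t; rewrite normcM normcC mulrC.
  have [t1|t1] := boolP (0 < t <= 1); last by rewrite sb // normr0 !mulr0.
  by apply: ler_wpM2r => //; apply: le_trans (gM t t1) (ler_norm _).
- by apply: L1Z; exact: L1norm.
Qed.

Lemma cL1_Lap b k : nice b -> cL1 (fun t => (b t)%:C%C * ek k t).
Proof. by move=> nb; apply: (cL1_nice nb (cmeas_ek k)) => t; exact: ek_bound. Qed.

Lemma Lap_le b k : nice b -> 0 <= Im k -> nC (Lap b k) <= I (fun t => `|b t|).
Proof.
move=> nb k0; have [Lb sb] := nb; apply: cI_le; [exact: cL1_Lap | exact: L1norm |].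
move=> t; have [t1|t1] := boolP (0 < t <= 1); last by rewrite sb // mul0r normc0 normr0.
by rewrite normcM normcC ler_piMr // ek_le1 //; case/andP: t1 => /ltW.
Qed.

Lemma cI_conj (f : R -> R[i]) : cL1 f -> cI (fun t => (f t)^*%C) = (cI f)^*%C.
Proof.
move=> [a b]; apply: ceq.
  by rewrite ReJ; apply: eq_I => t; rewrite ReJ.
by rewrite ImJ -IN //; apply: eq_I => t; rewrite ImJ.
Qed.

Lemma Lap_conj b k : nice b -> Lap b (- k^*%C) = (Lap b k)^*%C.
Proof.
move=> nb; rewrite /Lap -cI_conj; last exact: cL1_Lap.
by apply: eq_cI => t; rewrite ek_conj conjcM conjc_real.
Qed.

Lemma Lap_jet b k : nice b -> jet (Lap b) k.
Proof.
move=> nb; have [Lb sb] := nb.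
pose w (t : R) : R[i] := 2 * 'i%C * t%:C%C.
have mw : cmeas w.
  by apply: cmeasM; [exact: cmeas_cst | apply: cmeas_real].
have nw t : 0 < t <= 1 -> nC (w t) <= 2.
  move=> /andP[t0 t1]; rewrite /w !normcM normci normcC gtr0_norm // mulr1.
  rewrite (_ : (2 : R[i]) = (2 : R)%:C%C) ?normcC ?gtr0_norm //; last by rewrite rmorph_nat.
  by lra.
have Lw (g : R -> R[i]) M : cmeas g -> (forall t, 0 < t <= 1 -> nC (g t) <= M) ->
    cL1 (fun t => (b t)%:C%C * (ek k t * g t)).
  move=> mg gM; apply: (cL1_nice (M := expR (2 * nC k) * M)) => //.
    by apply: cmeasM => //; exact: cmeas_ek.
  by move=> t t1; rewrite normcM; apply: ler_pM; rewrite ?normc_ge0 ?ek_bound ?gM.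
have L_1 := Lw w 2 mw nw.
have mw2 : cmeas (fun t => w t * w t) by exact: cmeasM.
have L_2 : cL1 (fun t => (b t)%:C%C * (ek k t * (w t * w t))).
  apply: (Lw _ 4) => // t t1; rewrite normcM; have := nw t t1; have := normc_ge0 (w t); nra.
exists (cI (fun t => (b t)%:C%C * (ek k t * w t))), (2^-1 * cI (fun t => (b t)%:C%C * (ek k t * (w t * w t)))).
(* The Taylor bound is used at 2 i h t, whence the condition |h| < 1 and the factor 8 = 2^3;
   [expR (2 * nC k)] bounds e^{2ikt} on the support. *)
exists (8 * expR (2 * nC k) * expR 2 * I (fun t => `|b t|)), 1; split=> //.
  by rewrite !mulr_ge0 ?expR_ge0 // I_ge0.
move=> h h1.
have Lk := cL1_Lap k nb; have Lkh := cL1_Lap (k + h) nb.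
have -> : Lap b (k + h) - (Lap b k + cI (fun t => (b t)%:C%C * (ek k t * w t)) * h +
   2^-1 * cI (fun t => (b t)%:C%C * (ek k t * (w t * w t))) * h ^+ 2) =
  cI (fun t => (b t)%:C%C * ek (k + h) t - ((b t)%:C%C * ek k t + h * ((b t)%:C%C * (ek k t * w t)) +
    (h ^+ 2 / 2) * ((b t)%:C%C * (ek k t * (w t * w t))))).
  rewrite cIB //; last by apply: cL1D; [apply: cL1D => //; exact: cL1Z | exact: cL1Z].
  rewrite cID; [|by apply: cL1D => //; exact: cL1Z|exact: cL1Z].
  rewrite cID //; last exact: cL1Z.
  rewrite !cIZ //; congr (_ - (_ + _ + _)); first by rewrite mulrC.
  by rewrite mulrC mulrA.
set c := 8 * _ * _; apply: (@le_trans _ _ (I (fun t => (c * nC h ^+ 3) * `|b t|))); last first.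
  by rewrite IZ; [rewrite mulrAC | exact: L1norm].
apply: cI_le.
- by apply: cL1B => //; apply: cL1D; [apply: cL1D => //; exact: cL1Z | exact: cL1Z].
- by apply: L1Z; exact: L1norm.
move=> t; have [t1|t1] := boolP (0 < t <= 1); last first.
  by rewrite sb // [0%:C%C]rmorph0 !mul0r !mulr0 !addr0 subr0 normc0 normr0 mulr0.
have := @cexp_taylor R (2 * 'i%C * h).
have n2 : nC (2 * 'i%C * h) = 2 * nC h.
  by rewrite !normcM normci mulr1 (_ : (2 : R[i]) = (2 : R)%:C%C) ?normcC ?gtr0_norm // rmorph_nat.
rewrite n2 => /(_ _ t); rewrite (_ : 2 * nC h <= 2); last by have := h1; lra.
case/andP: (t1) => t0 t2; rewrite (ltW t0) t2 => /(_ isT isT) T.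
have -> : (b t)%:C%C * ek (k + h) t - ((b t)%:C%C * ek k t + h * ((b t)%:C%C * (ek k t * w t)) +
    (h ^+ 2 / 2) * ((b t)%:C%C * (ek k t * (w t * w t)))) =
  (b t)%:C%C * ek k t * (cexp (2 * 'i%C * h * t%:C%C) - 1 - 2 * 'i%C * h * t%:C%C -
     (2 * 'i%C * h) ^+ 2 / 2 * (t ^+ 2)%:C%C).
  have -> : ek (k + h) t = ek k t * cexp (2 * 'i%C * h * t%:C%C).
    by rewrite /ek -cexpD; congr cexp; ring.
  have -> : (t ^+ 2)%:C%C = t%:C%C * t%:C%C :> R[i] by rewrite expr2 rmorphM.
  by rewrite /w; field.
rewrite 2!normcM normcC [leRHS]mulrC -mulrA; apply: ler_wpM2l => //.
have := ek_bound k t1; have := expR_ge0 (2 * nC k); have := normc_ge0 (ek k t).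
move: T; set X := nC (_ - _); move=> T a1 a2 a3.
apply: (@le_trans _ _ (expR (2 * nC k) * (expR 2 * (2 * nC h) ^+ 3))).
  by apply: ler_pM => //; exact: normc_ge0.
by rewrite /c le_eqVlt; apply/orP; left; apply/eqP; ring.
Qed.

End Laplace.


(** * The kernel of the transformation operator *)

Section GeometricLimit.
Context {R : realType}.

(** With w n = 2 c / 2^n the tail of the geometric series, u - w increases and u + w decreases; the
    limit is the supremum of u - w. *)
Lemma geometric_limit (u : nat -> R) (c : R) : 0 <= c ->
  (forall n, `|u n.+1 - u n| <= c * 2^-1 ^+ n) ->
  exists l, forall n, `|l - u n| <= 2 * c * 2^-1 ^+ n.
Proof.
move=> c0 H; pose w n := 2 * c * 2^-1 ^+ n : R.
have w0 n : 0 <= w n by rewrite !mulr_ge0 // exprn_ge0.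
have ws n : w n.+1 = c * 2^-1 ^+ n by rewrite /w exprS; field.
have ws2 n : w n = 2 * w n.+1 by rewrite ws /w; ring.
have lo m n : (m <= n)%N -> u m - w m <= u n - w n.
  elim: n => [|n IH]; first by rewrite leqn0 => /eqP ->.
  rewrite leq_eqVlt => /predU1P[->//|mn]; apply: le_trans (IH mn) _.
  by have := H n; rewrite -ws ler_norml => /andP[]; have := ws2 n; lra.
have up m n : (m <= n)%N -> u n + w n <= u m + w m.
  elim: n => [|n IH]; first by rewrite leqn0 => /eqP ->.
  rewrite leq_eqVlt => /predU1P[->//|mn]; apply: le_trans _ (IH mn).
  by have := H n; rewrite -ws ler_norml => /andP[]; have := ws2 n; lra.
have lu m n : u m - w m <= u n + w n.
  have [mn|nm] := leqP m n; first by apply: le_trans (lo _ _ mn) _; have := w0 n; lra.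
  by apply: le_trans _ (up _ _ (ltnW nm)); have := w0 m; lra.
pose S := range (fun n => u n - w n).
have hS : has_sup S.
  by split; [exists (u 0%N - w 0%N), 0%N | exists (u 0%N + w 0%N) => _ [n _ <-]; exact: lu].
exists (sup S) => n; rewrite -/(w n) ler_distl; apply/andP; split.
  by apply: ub_le_sup; [case: hS | exists n].
by apply: ge_sup; [case: hS | move=> _ [m _ <-]; exact: lu].
Qed.

Lemma geometric_small (c e : R) : 0 < e -> exists N, forall n, (N <= n)%N -> c * 2^-1 ^+ n <= e.
Proof.
move=> e0; have h : `|2^-1 : R| < 1 by rewrite ger0_norm // invf_lt1 // ltr1n.
have := @cvg_geometric R c 2^-1 h => /cvgrPdist_le/(_ e e0)[N _ HN]; exists N => n Nn.
have := HN n Nn; rewrite /= /geometric sub0r normrN; exact: le_trans (ler_norm _).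
Qed.

Lemma le_geometric0 (a c : R) : (forall n, a <= c * 2^-1 ^+ n) -> a <= 0.
Proof.
move=> H; apply/ler_addgt0Pr => e e0; rewrite add0r.
by have [N HN] := geometric_small c e0; apply: le_trans (H N) (HN N _).
Qed.

End GeometricLimit.

(** * The fixed point equation of the kernel *)

Section Kernel.
Context {R : realType}.
Variable Q : R -> R.
Hypothesis nQ : nice Q.
Implicit Types (B D : R * R -> R) (x y s t M m : R).

Let LQ : L1 Q. Proof. by case: nQ. Qed.
Let Qn := I (fun y => `|Q y|).
(** In the norm with weight e^{lam s} the inner integral gains a factor 1 / lam, so the map
    contracts by Qn / lam <= 1/2. *)
Let lam := 2 * Qn + 2.
Let Qn0 : 0 <= Qn. Proof. exact: I_ge0. Qed.
Let lam0 : 0 < lam. Proof. by rewrite /lam; have := Qn0; lra. Qed.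

(** Put v = 1 + int B(x, t) e^{2ikt} dt into the Volterra equation v(x) = 1 + int_{y > x} Q(y)
    (e^{2ik(y - x)} - 1) / (2ik) v(y) dy and write the quotient as the integral of e^{2iks} over 0 <
    s < y - x. Comparing densities in t gives B = [kmap B], and [kinner] is the convolution produced
    by the product of transforms. *)
Definition kinner B x y t := I (fun s => B (y, s) * win (y - x) (t - s)).
Definition kmap B (p : R * R) := I (fun y => Q y * (win (y - p.1) p.2 + kinner B p.1 y p.2)).

(** Invariant of the iteration: a bound in the weighted norm, and the support that the kernel
    inherits from the vanishing of Q beyond 1. *)
Let inv B M := [/\ measurable_fun setT B, 0 <= M, (forall y s, `|B (y, s)| <= M * expR (lam * s)) &
  (forall y s, ~~ ((0 < s) && (y + s < 1)) -> B (y, s) = 0)].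

Let I_exp t : 0 <= t -> I (fun s => expR (lam * s) * win t s) <= expR (lam * t) / lam.
Proof.
move=> t0.
have d x : is_derive x (1 : R) (fun s => lam^-1 * expR (lam * s)) (expR (lam * x)).
  have dl : is_derive x (1 : R) (fun t => lam * t) lam.
    apply: is_derive_quad; exists 0, 1; split=> // h _.
    by rewrite mul0r (_ : _ - _ - _ = 0) ?normr0 //; ring.
  have E : lam^-1 *: (expR (lam * x) * lam) = expR (lam * x).
    by rewrite /GRing.scale /=; field; rewrite lt0r_neq0.
  have := @is_deriveZ _ _ _ _ lam^-1 x 1 _ (is_derive1_comp (is_derive_expR (lam * x)) dl).
  by rewrite E.
have c : continuous (fun s => expR (lam * s)).
  move=> x; apply: (@continuous_comp _ _ _ (fun s => lam * s) (@expR R)); last exact: continuous_expR.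
  by apply: (@cvgM R); [exact: cvg_cst | exact: cvg_id].
have [_ H] := ac_C1 t0 d c.
have := H t; rewrite t0 lexx => /(_ isT); rewrite mulr0 expR0 mulr1 => E.
have : 0 < lam^-1 by rewrite invr_gt0.
by rewrite [_ / lam]mulrC E; lra.
Qed.

Let L1_exp t : L1 (fun s => expR (lam * s) * win t s).
Proof.
apply: (@L1_bounded _ _ 0 t (expR (lam * `|t|))).
- apply: measurable_funM; last exact: measurable_win.
  apply: continuous_measurable_fun => x; apply: (@continuous_comp _ _ _ (fun s => lam * s) (@expR R)); last exact: continuous_expR.
  by apply: (@cvgM R); [exact: cvg_cst | exact: cvg_id].
- move=> s; have [/andP[s0 st]|st] := boolP ((0 < s) && (s < t)); last by rewrite win_out // mulr0 normr0 expR_ge0.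
  rewrite win_in // mulr1 ger0_norm ?expR_ge0 // ler_expR ler_pM2l //.
  by have := ler_norm t; lra.
- by move=> s H; rewrite win_out ?mulr0 // negb_and -!leNgt.
Qed.

Let L1_inner B M x y t : inv B M -> L1 (fun s => B (y, s) * win (y - x) (t - s)).
Proof.
move=> [mB M0 bB sB].
apply: (@L1_bounded _ _ 0 (1 - y) (M * expR (lam * `|1 - y|))).
- apply: measurable_funM; first by apply: (measurableT_comp mB); exact: measurable_pair1.
  by apply: (measurableT_comp (measurable_win _)); exact: measurable_funB.
- move=> s; have [/andP[s0 st]|st] := boolP ((0 < s) && (y + s < 1)); last first.
    by rewrite sB // mul0r normr0 mulr_ge0 // expR_ge0.
  rewrite normrM; apply: (@le_trans _ _ (`|B (y, s)|)); first by rewrite ler_piMr // win_norm.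
  apply: le_trans (bB y s) _; apply: ler_wpM2l => //; rewrite ler_expR ler_pM2l //.
  by have := ler_norm (1 - y); lra.
- move=> s H; rewrite sB ?mul0r // negb_and -!leNgt; case/orP: H => [->//|?].
  by apply/orP; right; lra.
Qed.

Let inner_bound B M x y t : inv B M -> `|kinner B x y t| <= M / lam * expR (lam * t).
Proof.
move=> iB; have [mB M0 bB sB] := iB.
have [t0|t0] := lerP t 0.
  rewrite /kinner (@eq_I _ _ (fun _ => 0)) ?I0 ?normr0.
    by apply: mulr_ge0; [apply: divr_ge0 => //; exact: ltW | exact: expR_ge0].
  move=> s; have [s0|s0] := lerP s 0; first by rewrite sB ?mul0r // negb_and -leNgt s0.
  by rewrite win_out ?mulr0 // negb_and -!leNgt; apply/orP; left; lra.
apply: (@le_trans _ _ (I (fun s => M * (expR (lam * s) * win t s)))).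
  apply: I_abs_le; [exact: (L1_inner x y t iB) | by apply: L1Z; exact: L1_exp |].
  move=> s; have [s1|s1] := boolP ((0 < s) && (s < t)).
    case/andP: s1 => s0 st; rewrite (win_in s0 st) mulr1 normrM.
    by apply: le_trans (bB y s); rewrite ler_piMr // win_norm.
  rewrite (win_out s1) !mulr0 normr_le0; move: s1; rewrite negb_and -!leNgt => /orP[s0|ts].
    by rewrite sB ?mul0r // negb_and -leNgt s0.
  by rewrite win_out ?mulr0 // negb_and -!leNgt; apply/orP; left; lra.
rewrite IZ; last exact: L1_exp.
by rewrite mulrAC -mulrA; apply: ler_wpM2l => //; apply: I_exp; exact: ltW.
Qed.

Let measurable_inner B M : inv B M ->
  measurable_fun setT (fun p : (R * R) * R => kinner B p.1.1 p.2 p.1.2).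
Proof.
move=> [mB M0 bB sB].
have m : measurable_fun setT (fun z : ((R * R) * R) * R => B (z.1.2, z.2) * win (z.1.2 - z.1.1.1) (z.1.1.2 - z.2)).
  have p1 : measurable_fun setT (fun z : ((R * R) * R) * R => z.1.2) by apply: measurableT_comp.
  have p2 : measurable_fun setT (fun z : ((R * R) * R) * R => z.2) by exact: measurable_snd.
  have p3 : measurable_fun setT (fun z : ((R * R) * R) * R => z.1.1.1) by do 2 apply: measurableT_comp => //.
  have p4 : measurable_fun setT (fun z : ((R * R) * R) * R => z.1.1.2) by do 2 apply: measurableT_comp => //.
  apply: measurable_funM.
    by apply: (measurableT_comp mB); exact/measurable_fun_pair.
  apply: measurable_funM; apply: measurable_hv => //; first exact: measurable_funB.
  by apply: measurable_funB; exact: measurable_funB.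
exact: (measurable_I m).
Qed.

Let measurable_integrand B M : inv B M ->
  measurable_fun setT (fun z : (R * R) * R => Q z.2 * (win (z.2 - z.1.1) z.1.2 + kinner B z.1.1 z.2 z.1.2)).
Proof.
move=> iB; have p1 : measurable_fun setT (fun z : (R * R) * R => z.1.1) by apply: measurableT_comp.
have p2 : measurable_fun setT (fun z : (R * R) * R => z.1.2) by apply: measurableT_comp.
apply: measurable_funM; first by apply: (measurableT_comp (L1_meas LQ)).
apply: measurable_funD; last exact: measurable_inner iB.
apply: measurable_funM; apply: measurable_hv => //.
by apply: measurable_funB => //; exact: measurable_funB.
Qed.

Let L1_Qinner B M x t : inv B M -> L1 (fun y => Q y * kinner B x y t).
Proof.
move=> iB; apply: (L1M (M := M / lam * expR (lam * t))) => //; last by move=> y; exact: inner_bound.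
have := measurable_inner iB => m.
by apply: (measurableT_comp (f := fun p : (R * R) * R => kinner B p.1.1 p.2 p.1.2) (g := fun y => ((x, t), y)) m); exact: measurable_pair1.
Qed.

Let L1_Qwin x t : L1 (fun y => Q y * win (y - x) t).
Proof.
apply: (L1M (M := 1)) => //; last by move=> y; exact: win_norm.
apply: measurable_funM; apply: measurable_hv => //.
by apply: measurable_funB => //; exact: measurable_funB.
Qed.

Let kmapE B M p : inv B M -> kmap B p = I (fun y => Q y * win (y - p.1) p.2) + I (fun y => Q y * kinner B p.1 y p.2).
Proof.
move=> iB; rewrite -ID; [|exact: L1_Qwin | exact: L1_Qinner iB].
by apply: eq_I => y; rewrite mulrDr.
Qed.

Let I_Q_bound (f : R -> R) m : L1 (fun y => Q y * f y) -> (forall y, `|f y| <= m) -> `|I (fun y => Q y * f y)| <= Qn * m.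
Proof.
move=> Lf fm; rewrite mulrC /Qn -IZ; last exact: L1norm.
apply: I_abs_le => //; first by apply: L1Z; exact: L1norm.
by move=> y; rewrite normrM mulrC ler_wpM2r.
Qed.

Let kmap_inv B M : inv B M -> inv (kmap B) (Qn * (1 + M / lam)).
Proof.
move=> iB; have [mB M0 bB sB] := iB.
have Ml : 0 <= M / lam by rewrite divr_ge0 // ltW.
split.
- exact: (measurable_I (measurable_integrand iB)).
- by rewrite mulr_ge0 // addr_ge0.
- move=> x t; have [t0|t0] := lerP t 0.
    rewrite /kmap (@eq_I _ _ (fun _ => 0)) ?I0 ?normr0; first by rewrite !mulr_ge0 ?expR_ge0 // addr_ge0.
    move=> y /=; rewrite win_out ?add0r; last by rewrite negb_and -leNgt t0.
    rewrite /kinner (@eq_I _ _ (fun _ => 0)) ?I0 ?mulr0 // => s.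
    have [s0|s0] := lerP s 0; first by rewrite sB ?mul0r // negb_and -leNgt s0.
    by rewrite win_out ?mulr0 // negb_and -!leNgt; apply/orP; left; lra.
  rewrite -mulrA; apply: I_Q_bound.
    by apply: (eq_L1 _ (L1D (L1_Qwin x t) (L1_Qinner x t iB))) => y; rewrite mulrDr.
  move=> y; apply: le_trans (ler_normD _ _) _; rewrite mulrDl mul1r; apply: lerD.
    apply: le_trans (win_norm _ _) _; rewrite -expR0 ler_expR mulr_ge0 // ltW //.
  exact: inner_bound.
move=> x t st; rewrite /kmap (@eq_I _ _ (fun _ => 0)) ?I0 // => y /=.
have [y1|y1] := boolP (0 < y <= 1); last by case: nQ => _ ->; rewrite ?mul0r.
case/andP: y1 => y0 y1; rewrite win_out ?add0r; last first.
  by move: st; rewrite !negb_and -!leNgt => /orP[->//|?]; apply/orP; right; lra.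
rewrite /kinner (@eq_I _ _ (fun _ => 0)) ?I0 ?mulr0 // => s.
have [/andP[s0 s1]|s1] := boolP ((0 < s) && (y + s < 1)); last by rewrite sB ?mul0r.
rewrite win_out ?mulr0 // negb_and -!leNgt.
by move: st; rewrite negb_and -!leNgt => /orP[?|?]; apply/orP; [left | right]; lra.
Qed.

Let kmap_diff B M D m B' M' : inv B M -> inv B' M' -> (forall y s, `|B (y, s) - B' (y, s)| <= m * expR (lam * s)) ->
  0 <= m -> forall x t, `|kmap B (x, t) - kmap B' (x, t)| <= m / 2 * expR (lam * t).
Proof.
move=> iB iB' bd m0 x t; have [mB M0 bB sB] := iB; have [mB' M0' bB' sB'] := iB'.
have iD : inv (fun p => B p - B' p) m.
  split=> //; first exact: measurable_funB.
  by move=> y s H; rewrite sB // sB' // subrr.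
rewrite (kmapE _ iB) (kmapE _ iB') /= opprD addrACA subrr add0r.
rewrite -IB; [|exact: L1_Qinner iB|exact: L1_Qinner iB'].
rewrite (@eq_I _ _ (fun y => Q y * kinner (fun p => B p - B' p) x y t)); last first.
  move=> y; rewrite -mulrBr /kinner -IB; [|exact: L1_inner iB|exact: L1_inner iB'].
  by congr (_ * _); apply: eq_I => s; rewrite mulrBl.
apply: le_trans (I_Q_bound (L1_Qinner x t iD) (fun y => inner_bound x y t iD)) _.
rewrite mulrA; apply: ler_wpM2r; first exact: expR_ge0.
rewrite mulrCA; apply: ler_wpM2l => //.
by rewrite ler_pdivrMr // /lam; have := Qn0; lra.
Qed.

Let Bn n := iter n kmap (fun _ => 0).

Let inv_Bn n : exists M, inv (Bn n) M.
Proof.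
elim: n => [|n [M iM]]; last by eexists; exact: kmap_inv iM.
exists 0; split; [exact: measurable_cst | exact: lexx | by move=> y' s'; rewrite /Bn /= normr0 mul0r | by []].
Qed.

Let Bn_diff n y s : `|Bn n.+1 (y, s) - Bn n (y, s)| <= Qn * expR (lam * s) * 2^-1 ^+ n.
Proof.
elim: n y s => [|n IH] y s.
  have i0 : inv (Bn 0) 0.
    split; [exact: measurable_cst | exact: lexx | by move=> y' s'; rewrite /Bn /= normr0 mul0r | by []].
  by have [_ _ + _] := kmap_inv i0; rewrite /= mul0r addr0 mulr1 => H; rewrite subr0 expr0 mulr1.
have [M iM] := inv_Bn n; have [M' iM'] := inv_Bn n.+1.
have := @kmap_diff _ _ (fun _ => 0) (Qn * 2^-1 ^+ n) _ _ iM' iM _ _ y s.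
rewrite exprS (_ : Qn * expR (lam * s) * (2^-1 * 2^-1 ^+ n) = Qn * 2^-1 ^+ n / 2 * expR (lam * s)); last by field.
apply; last by rewrite mulr_ge0 // exprn_ge0.
by move=> y' s'; rewrite mulrAC; exact: IH.
Qed.

(* The Jost solution will be [e^{ikx} (1 + \int B (x, t) e^{2ikt} dt)]. *)
Definition is_kernel B := [/\ measurable_fun setT B,
  exists M, forall x t, 0 <= x -> `|B (x, t)| <= M,
  forall x t, ~~ ((0 < t) && (x + t < 1)) -> B (x, t) = 0 &
  forall x t, B (x, t) = kmap B (x, t)].

(** Picard iterates from 0 converge pointwise at the rate 1 / 2^n, with constants depending on s
    only. Measurability, bound and support pass to the limit, and B - [kmap B] is below every term
    of a geometric sequence. *)
Theorem kernel_exists : exists B, is_kernel B.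
Proof.
have L p : exists l, forall n, `|l - Bn n p| <= 2 * (Qn * expR (lam * p.2)) * 2^-1 ^+ n.
  apply: geometric_limit; first by rewrite mulr_ge0 // expR_ge0.
  by case: p => y s n; exact: Bn_diff.
have /choice[B HB] := L.
have sB y s : ~~ ((0 < s) && (y + s < 1)) -> B (y, s) = 0.
  move=> st; have := HB (y, s) 0%N; have b n : Bn n (y, s) = 0 by have [M [_ _ _ ->]] := inv_Bn n.
  move=> _; apply/eqP; rewrite -normr_le0; apply: (@le_geometric0 _ _ (2 * (Qn * expR (lam * s)))) => n.
  by have := HB (y, s) n; rewrite b subr0.
have bB y s : `|B (y, s)| <= 2 * Qn * expR (lam * s).
  by have := HB (y, s) 0%N; rewrite /= subr0 expr0 mulr1 mulrA.
have mB : measurable_fun setT B.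
  apply: (@measurable_fun_cvg _ _ _ setT (fun n => Bn n)) => [n|p _].
    by have [M []] := inv_Bn n.
  apply/cvgrPdist_le => e e0.
  have [N HN] := geometric_small (2 * (Qn * expR (lam * p.2))) e0.
  by exists N => // n Nn; apply: le_trans (HB p n) (HN n Nn).
have iB : inv B (2 * Qn) by split=> //; rewrite mulr_ge0.
exists B; split=> //.
  exists (2 * Qn * expR lam) => x t x0.
  have [/andP[t0 t1]|t1] := boolP ((0 < t) && (x + t < 1)); last by rewrite sB // normr0 !mulr_ge0 ?expR_ge0.
  apply: le_trans (bB x t) _; apply: ler_wpM2l; first by rewrite mulr_ge0.
  by rewrite ler_expR ler_piMr ?ltW //; lra.
move=> x t; apply/eqP; rewrite -subr_eq0 -normr_le0.
apply: (@le_geometric0 _ _ (2 * (Qn * expR (lam * t)))) => n.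
have [M iM] := inv_Bn n.
have d1 := HB (x, t) n.+1.
have m0 : 0 <= 2 * Qn * 2^-1 ^+ n by rewrite !mulr_ge0 // exprn_ge0.
have := @kmap_diff _ _ (fun _ => 0) (2 * Qn * 2^-1 ^+ n) _ _ iB iM _ m0 x t.
have Hd y s : `|B (y, s) - Bn n (y, s)| <= 2 * Qn * 2^-1 ^+ n * expR (lam * s).
  by have := HB (y, s) n; rewrite /= (_ : 2 * (Qn * _) * _ = 2 * Qn * 2^-1 ^+ n * expR (lam * s)) //; ring.
move=> /(_ Hd); rewrite -[kmap (Bn n) _]/(Bn n.+1 (x, t)) => d2.
have -> : B (x, t) - kmap B (x, t) = (B (x, t) - Bn n.+1 (x, t)) - (kmap B (x, t) - Bn n.+1 (x, t)) by ring.
apply: le_trans (ler_normB _ _) _; apply: le_trans (lerD d1 d2) _.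
by rewrite /= exprS le_eqVlt; apply/orP; left; apply/eqP; field.
Qed.

End Kernel.


(** * The integral equation of the Jost solution *)

Section IntegralMore.
Context {R : realType}.
Implicit Types (f g : R -> R) (h : R -> R[i]) (c x r : R).

Lemma measurable_win2 d (T : measurableType d) (a b : T -> R) :
  measurable_fun setT a -> measurable_fun setT b -> measurable_fun setT (fun p => win (a p) (b p)).
Proof.
move=> ma mb; apply: measurable_funM; first exact: measurable_hv.
by apply: measurable_hv => //; exact: measurable_funB.
Qed.

Lemma cI_shift c h : cL1 h -> cL1 (fun x => h (x + c)) /\ cI (fun x => h (x + c)) = cI h.
Proof.
move=> [a b]; have [La Ia] := I_shift c a; have [Lb Ib] := I_shift c b.
by split; [split; [exact: La | exact: Lb] | apply: ceq; [exact: Ia | exact: Ib]].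
Qed.

Lemma I_hv_split g x : L1 g -> 0 <= x ->
  I (fun y => g y * hv y) = I (fun y => g y * win x y) + I (fun y => g y * hv (y - x)).
Proof.
move=> Lg x0.
have m0 : measurable_fun setT (@hv R) by exact: measurable_hv.
have m1 : measurable_fun setT (fun y : R => hv (y - x)) by apply: measurable_hv => //; exact: measurable_funB.
have L0 : L1 (fun y => g y * hv y) by apply: (L1M (M := 1)) => // y; exact: hv_norm.
have L1' : L1 (fun y => g y * win x y) by apply: (L1M (M := 1)) => //; [exact: measurable_win | move=> y; exact: win_norm].
have L2 : L1 (fun y => g y * hv (y - x)) by apply: (L1M (M := 1)) => // y; exact: hv_norm.
apply/eqP; rewrite -subr_eq0 -ID // -IB //; last exact: L1D.
apply/eqP; apply: (@I_singleton _ _ x) => y yx; rewrite /win /hv !subr_gt0.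
move: yx; rewrite neq_lt => /orP[yx|xy].
  by rewrite yx (ltNge x) (ltW yx) mulr1 mulr0 addr0 subrr.
by rewrite (le_lt_trans x0 xy) xy (ltNge y) (ltW xy) !mulr1 !mulr0 add0r subrr.
Qed.

Lemma cI_hv_split h x : cL1 h -> 0 <= x ->
  cI (fun y => (hv y)%:C%C * h y) = cI (fun y => (win x y)%:C%C * h y) + cI (fun y => (hv (y - x))%:C%C * h y).
Proof.
move=> [a b] x0.
have e (s : R -> R) : cI (fun y => (s y)%:C%C * h y) = (I (fun y => Re (h y) * s y) +i* I (fun y => Im (h y) * s y))%C.
  by apply: ceq; rewrite /=; apply: eq_I => y; rewrite !reim ?mul0r ?subr0 ?addr0 mulrC.
by rewrite !e; apply: ceq; rewrite ?ReD ?ImD /=; exact: I_hv_split.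
Qed.

Lemma cL1_hv h (s : R -> R) : cL1 h -> measurable_fun setT s -> (forall x, `|s x| <= 1) ->
  cL1 (fun y => (s y)%:C%C * h y).
Proof.
move=> [a b] ms s1; split.
  by apply: eq_L1 (L1M a ms s1) => y; rewrite !reim mul0r subr0 mulrC.
by apply: eq_L1 (L1M b ms s1) => y; rewrite !reim mul0r addr0 mulrC.
Qed.

Lemma cac_tail h A : cL1 h -> 0 <= A -> cac A (fun x => cI (fun y => (hv (y - x))%:C%C * h y)) (fun y => - h y).
Proof.
move=> Lh A0; have [Lr Li] := Lh.
have mw x : measurable_fun setT (win x) by exact: measurable_win.
have key x : 0 <= x <= A -> cI (fun y => (hv (y - x))%:C%C * h y) =
    cI (fun y => (hv (y - 0))%:C%C * h y) + cI (fun t => (win x t)%:C%C * - h t).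
  move=> /andP[x0 xA]; have := cI_hv_split Lh x0.
  rewrite (_ : cI (fun y => (hv y)%:C%C * h y) = cI (fun y => (hv (y - 0))%:C%C * h y)); last first.
    by apply: eq_cI => y; rewrite subr0.
  move=> ->; rewrite (_ : (fun t => (win x t)%:C%C * - h t) = (fun t => - ((win x t)%:C%C * h t))).
    rewrite cIN; first by ring.
    by apply: cL1_hv => // t; exact: win_norm.
  by apply/funext => t; rewrite mulrN.
split; split.
- by apply: eq_L1 (L1N (L1M Lr (mw A) (win_norm A))) => t; rewrite ReN mulNr.
- move=> x /key ->; rewrite ReD; congr (_ + _).
  by rewrite /=; apply: eq_I => t; rewrite !reim mul0r subr0 mulrC.
- by apply: eq_L1 (L1N (L1M Li (mw A) (win_norm A))) => t; rewrite ImN mulNr.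
- move=> x /key ->; rewrite ImD; congr (_ + _).
  by rewrite /=; apply: eq_I => t; rewrite !reim mul0r addr0 mulrC.
Qed.

Lemma rC0 : (0 : R)%:C%C = 0 :> R[i]. Proof. by []. Qed.

Lemma rC1 : (1 : R)%:C%C = 1 :> R[i]. Proof. by []. Qed.
Lemma rCM x r : (x * r)%:C%C = x%:C%C * r%:C%C :> R[i]. Proof. exact: rmorphM. Qed.
Lemma rCD x r : (x + r)%:C%C = x%:C%C + r%:C%C :> R[i]. Proof. exact: rmorphD. Qed.

(** The Volterra kernel (e^{2ikr} - 1) / (2ik), written as an integral so that it makes sense at k =
    0. *)
Definition ee (k : R[i]) r : R[i] := cI (fun s => (win r s)%:C%C * ek k s).

Lemma cL1_win_ek k r : cL1 (fun s => (win r s)%:C%C * ek k s).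
Proof.
apply: (@cL1_le _ _ (fun s => expR (2 * nC k * `|r|) * win r s)).
- by apply: cmeasM; [apply: cmeas_real; exact: measurable_win | exact: cmeas_ek].
- move=> s; have [/andP[s0 sr]|s1] := boolP ((0 < s) && (s < r)); last by rewrite win_out // mul0r normc0 mulr0.
  rewrite win_in // mul1r mulr1 ek_norm ler_expR.
  have := normc_Im k; rewrite ler_norml => /andP[a _]; have := normc_ge0 k; have := ler_norm r; nra.
- by apply: L1Z; exact: L1_win.
Qed.

Lemma ee_neg k r : r <= 0 -> ee k r = 0.
Proof.
move=> r0; rewrite /ee (eq_cI (g := fun _ => 0)) ?cI0 // => s.
by rewrite win_out ?mul0r // negb_and -!leNgt; case: (lerP s 0) => //= s0; apply: le_trans r0 (ltW s0).
Qed.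

Lemma ee_pos k r : k != 0 -> 0 <= r -> ee k r = (ek k r - 1) / (2 * 'i%C * k).
Proof.
move=> k0 r0; have H := cac_cexp (2 * 'i%C * k) r0.
have := cacE H (x := r); rewrite r0 lexx => /(_ isT).
rewrite mulr0 cexp0 -/(ek k r) => ->; rewrite addrC addKr.
have i0 : ('i%C : R[i]) != 0 by rewrite -normc_gt0 normci.
have z0 : 2 * 'i%C * k != 0 by rewrite !mulf_neq0 // pnatr_eq0.
rewrite (_ : (fun t => (win r t)%:C%C * (2 * 'i%C * k * cexp (2 * 'i%C * k * t%:C%C))) =
   (fun t => (2 * 'i%C * k) * ((win r t)%:C%C * ek k t))).
  by rewrite cIZ; [rewrite mulrC mulKf | exact: cL1_win_ek].
by apply/funext => t; rewrite /ek mulrCA.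
Qed.

End IntegralMore.

Section Jost.
Context {R : realType}.
Variables (Q : R -> R) (B : R * R -> R).
Hypotheses (nQ : nice Q) (kB : is_kernel Q B).
Implicit Types (k : R[i]) (x y s t : R).

Let LQ : L1 Q. Proof. by case: nQ. Qed.
Let sQ y : ~~ (0 < y <= 1) -> Q y = 0. Proof. by case: nQ => _; exact. Qed.
Let mB : measurable_fun setT B. Proof. by case: kB. Qed.
Let sB x t : ~~ ((0 < t) && (x + t < 1)) -> B (x, t) = 0. Proof. by case: kB => _ _ + _; exact. Qed.

Lemma kernel_bound : exists2 M, 0 <= M & forall x t, 0 <= x -> `|B (x, t)| <= M * win 1 t.
Proof.
case: kB => _ [M HM] _ _; exists `|M| => // x t x0.
have [/andP[t0 t1]|t1] := boolP ((0 < t) && (x + t < 1)); last by rewrite sB // normr0 mulr_ge0 ?win_ge0.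
by rewrite win_in ?mulr1 //; [apply: le_trans (HM x t x0) (ler_norm _) | lra].
Qed.

Lemma nice_kernel x : 0 <= x -> nice (fun t => B (x, t)).
Proof.
move=> x0; have [M M0 HM] := kernel_bound; split.
  apply: (@L1_le _ _ (fun t => M * win 1 t)).
  - by apply: (measurableT_comp mB); exact: measurable_pair1.
  - by move=> t; exact: HM.
  - by apply: L1Z; exact: L1_win.
by move=> t t1; rewrite sB //; move: t1; rewrite !negb_and -!leNgt -ltNge => /orP[->//|?]; apply/orP; right; lra.
Qed.

Let sB' y s : 0 <= y -> ~~ ((0 < s) && (s < 1)) -> B (y, s) = 0.
Proof.
move=> y0 s1; apply: sB; apply: contra s1 => /andP[-> ?] /=; lra.
Qed.

(** The factor v = e^{-ikx} f of the Jost solution f. *)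
Definition jv x k : R[i] := 1 + Lap (fun t => B (x, t)) k.

(** [kinner] is a convolution in t, so its transform is a product; the exchange of integrals is over
    t and s with y fixed. *)
Lemma Lap_inner x y k : 0 <= x -> 0 < y <= 1 ->
  cL1 (fun t => (kinner B x y t)%:C%C * ek k t) /\
  cI (fun t => (kinner B x y t)%:C%C * ek k t) = Lap (fun s => B (y, s)) k * ee k (y - x).
Proof.
move=> x0 /andP[y0 y1]; have [M M0 HM] := kernel_bound; have yy := ltW y0.
set E := expR (2 * nC k); have E0 : 0 <= E by exact: expR_ge0.
pose H (p : R * R) : R[i] := ((B (y, p.2))%:C%C * ek k p.2) * ((win (y - x) (p.1 - p.2))%:C%C * ek k (p.1 - p.2)).
have HE t s : H (t, s) = ((B (y, s))%:C%C * ek k s) * ((win (y - x) (t - s))%:C%C * ek k (t - s)) by [].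
have mH : cmeas H.
  have p1 : measurable_fun setT (fun p : R * R => p.1 - p.2) by exact: measurable_funB.
  apply: cmeasM; apply: cmeasM.
  - apply: cmeas_real; apply: (measurableT_comp (f := fun s => B (y, s))); last exact: measurable_snd.
    by apply: (measurableT_comp mB); exact: measurable_pair1.
  - exact: (cmeas_comp (cmeas_ek k) (measurable_snd)).
  - by apply: cmeas_real; apply: (measurableT_comp (measurable_win _)).
  - exact: (cmeas_comp (cmeas_ek k) p1).
pose h t s := (M * E * E * win 2 t) * win 1 s.
have Hh t s : nC (H (t, s)) <= h t s.
  have h0 : 0 <= h t s by rewrite /h !mulr_ge0 ?win_ge0.
  have [/andP[s0 s1]|s1] := boolP ((0 < s) && (s < 1)); last first.
    by rewrite (_ : H (t, s) = 0) ?normc0 // HE sB' // rC0 !mul0r.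
  have [/andP[t0 t1]|t1] := boolP ((0 < t - s) && (t - s < y - x)); last first.
    by rewrite (_ : H (t, s) = 0) ?normc0 // HE (win_out t1) rC0 mul0r mulr0.
  rewrite HE /h (win_in t0 t1) mul1r (win_in s0 s1) mulr1 (@win_in _ 2 t) ?mulr1; try lra.
  rewrite !normcM normcC; apply: ler_pM; rewrite ?mulr_ge0 ?normc_ge0 //.
    apply: ler_pM; rewrite ?normc_ge0 //; first by have := HM y s yy; rewrite win_in // mulr1.
    by apply: ek_bound; rewrite s0 ltW.
  by apply: ek_bound; rewrite t0 /=; lra.
have hI t : I (h t) <= M * E * E * I (win 1) * win 2 t.
  by rewrite /h IZ; [rewrite mulrAC | exact: L1_win].
have [E1 L_1 _] := cfubini mH Hh (fun t => L1Z _ (L1_win 1)) hI (L1Z _ (L1_win 2)).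
have e1 t : cI (fun s => H (t, s)) = (kinner B x y t)%:C%C * ek k t.
  have L : L1 (fun s => B (y, s) * win (y - x) (t - s)).
    apply: (L1M (M := 1)); [by case: (nice_kernel yy) | | by move=> s; exact: win_norm].
    by apply: (measurableT_comp (measurable_win _)); exact: measurable_funB.
  rewrite (eq_cI (g := fun s => ek k t * (B (y, s) * win (y - x) (t - s))%:C%C)).
    by rewrite cIZ; [rewrite cI_real mulrC | exact: cL1_real].
  move=> s; have -> : ek k t = ek k s * ek k (t - s) by rewrite -ekD subrKC.
  rewrite HE rCM; move: (_%:C%C) (ek k s) (_%:C%C) (ek k (t - s)) => a b c e; ring.
have e2 s : cI (fun t => H (t, s)) = (B (y, s))%:C%C * ek k s * ee k (y - x).
  rewrite /H /= cIZ; last by have [] := cI_shift (- s) (cL1_win_ek k (y - x)).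
  by have [_ ->] := cI_shift (- s) (cL1_win_ek k (y - x)).
split; first by apply: eq_cL1 L_1 => t; rewrite e1.
rewrite -(eq_cI e1) E1 (eq_cI e2) mulrC /Lap -cIZ; last exact: cL1_Lap (nice_kernel yy).
by apply: eq_cI => s; rewrite mulrC.
Qed.

(** The Volterra equation is the transform of the fixed point equation of the kernel, after exchange
    of the integrals over t and y. *)
Lemma jv_eq x k : 0 <= x -> jv x k = 1 + cI (fun y => (Q y)%:C%C * (ee k (y - x) * jv y k)).
Proof.
move=> x0; have [M M0 HM] := kernel_bound; congr (1 + _).
set E := expR (2 * nC k); have E0 : 0 <= E by exact: expR_ge0.
have kin y t : 0 < y <= 1 -> ~~ ((0 < t) && (t < 1)) -> kinner B x y t = 0.
  move=> /andP[y0 y1] t1; rewrite /kinner (@eq_I _ _ (fun _ => 0)) ?I0 // => s.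
  have [/andP[s0 s1]|s1] := boolP ((0 < s) && (y + s < 1)); last by rewrite sB // mul0r.
  rewrite win_out ?mulr0 //; apply: contra t1 => /andP[? ?]; apply/andP; split; lra.
have kb y t : 0 < y <= 1 -> `|kinner B x y t| <= M.
  move=> /andP[y0 y1]; have yy := ltW y0.
  apply: (@le_trans _ _ (I (fun s => M * win 1 s))).
    apply: I_abs_le; [|by apply: L1Z; exact: L1_win|].
      apply: (L1M (M := 1)); [by case: (nice_kernel yy) | | by move=> s; exact: win_norm].
      by apply: (measurableT_comp (measurable_win _)); exact: measurable_funB.
    by move=> s; rewrite normrM; apply: le_trans (HM y s yy); rewrite ler_piMr // win_norm.
  rewrite IZ; last exact: L1_win.
  rewrite (@eq_I _ _ (fun s => hv (s - 0) * hv (1 - s))); last by move=> t'; rewrite subr0.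
  by rewrite I_itv // subr0 mulr1.
have win1 y t : 0 < y <= 1 -> win 1 t * win (y - x) t = win (y - x) t.
  move=> /andP[y0 y1]; have [/andP[t0 t1]|t1] := boolP ((0 < t) && (t < y - x)).
    by rewrite !win_in ?mulr1 //; lra.
  by rewrite (win_out t1) mulr0.
have kin1 y t : 0 < y <= 1 -> win 1 t * kinner B x y t = kinner B x y t.
  move=> yy; have [/andP[t0 t1]|t1] := boolP ((0 < t) && (t < 1)); first by rewrite win_in // mul1r.
  by rewrite kin // mulr0.
(* The factor [win 1] makes H integrable in t; it changes nothing, since for 0 <= x and y <= 1 both
   summands live in 0 < t < 1. *)
pose H (p : R * R) : R[i] := (Q p.2 * (win (p.2 - x) p.1 + kinner B x p.2 p.1))%:C%C * ((win 1 p.1)%:C%C * ek k p.1).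
have mk : measurable_fun setT (fun p : R * R => kinner B x p.2 p.1).
  have m : measurable_fun setT (fun z : (R * R) * R => B (z.1.2, z.2) * win (z.1.2 - x) (z.1.1 - z.2)).
    have p1 : measurable_fun setT (fun z : (R * R) * R => z.1.2) by apply: measurableT_comp.
    have p2 : measurable_fun setT (fun z : (R * R) * R => z.2) by exact: measurable_snd.
    have p3 : measurable_fun setT (fun z : (R * R) * R => z.1.1) by apply: measurableT_comp.
    apply: measurable_funM; first by apply: (measurableT_comp mB); exact/measurable_fun_pair.
    apply: measurable_funM; apply: measurable_hv => //; first exact: measurable_funB.
    by apply: measurable_funB; [exact: measurable_funB | exact: measurable_funB].
  exact: (measurable_I m).
have HE t y : H (t, y) = (Q y * (win (y - x) t + kinner B x y t))%:C%C * ((win 1 t)%:C%C * ek k t) by [].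
have mH : cmeas H.
  apply: cmeasM.
    apply: cmeas_real; apply: measurable_funM; first by apply: (measurableT_comp (L1_meas LQ)).
    apply: measurable_funD => //; apply: measurable_funM; apply: measurable_hv => //.
    by apply: measurable_funB => //; exact: measurable_funB.
  apply: cmeasM; last exact: (cmeas_comp (cmeas_ek k) (measurable_fst)).
  by apply: cmeas_real; apply: (measurableT_comp (measurable_win _)).
pose h t y := (E * win 1 t * (1 + M)) * `|Q y|.
have Hh t y : nC (H (t, y)) <= h t y.
  have [y1|y1] := boolP (0 < y <= 1); last first.
    by rewrite (_ : H (t, y) = 0) ?normc0 /h ?sQ ?normr0 ?mulr0 // HE sQ // mul0r rC0 mul0r.
  have [t1|t1] := boolP ((0 < t) && (t < 1)); last first.
    by rewrite (_ : H (t, y) = 0) ?normc0 /h ?(win_out t1) ?mulr0 ?mul0r // HE (win_out t1) rC0 mul0r mulr0.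
  have /andP[t0 t2] := t1.
  rewrite HE /h (win_in t0 t2) mulr1 mul1r normcM normcC normrM mulrC -mulrA; apply: ler_pM; rewrite ?normc_ge0 ?mulr_ge0 //.
    by apply: ek_bound; rewrite t0 ltW.
  rewrite mulrC; apply: ler_wpM2r => //; apply: le_trans (ler_normD _ _) _; apply: lerD; first exact: win_norm.
  exact: kb.
have hI t : I (h t) <= E * (1 + M) * I (fun y => `|Q y|) * win 1 t.
  by rewrite /h IZ; [rewrite le_eqVlt; apply/orP; left; apply/eqP; ring | exact: L1norm].
have LQk t : L1 (fun y => Q y * (win (y - x) t + kinner B x y t)).
  apply: (@L1_le _ _ (fun y => (1 + M) * `|Q y|)).
  - apply: measurable_funM; first exact: L1_meas.
    apply: measurable_funD.
      by apply: measurable_win2; [exact: measurable_funB | exact: measurable_cst].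
    by apply: (measurableT_comp (f := fun p : R * R => kinner B x p.2 p.1) (g := fun y => (t, y)) mk); exact: measurable_pair1.
  - move=> y; rewrite normrM mulrC; have [y1|y1] := boolP (0 < y <= 1); last first.
      have e : `|Q y| = 0 by rewrite (sQ y1) normr0.
      by rewrite e !mulr0.
    by apply: ler_wpM2r => //; apply: le_trans (ler_normD _ _) _; apply: lerD; [exact: win_norm | exact: kb].
  - by apply: L1Z; exact: L1norm.
have [E1 _ _] := cfubini mH Hh (fun t => L1Z _ (L1norm LQ)) hI (L1Z _ (L1_win 1)).
rewrite /Lap (eq_cI (g := fun t => cI (fun y => H (t, y)))); last first.
    move=> t; rewrite (eq_cI (g := fun y => ((win 1 t)%:C%C * ek k t) * (Q y * (win (y - x) t + kinner B x y t))%:C%C)).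
    rewrite cIZ; last exact: cL1_real.
    rewrite cI_real; have [_ _ _ kE] := kB; rewrite kE /kmap /=.
    have [t1|t1] := boolP ((0 < t) && (t < 1)).
      case/andP: t1 => t0 t1; rewrite (win_in t0 t1) rC1 mul1r; exact: mulrC.
    have z : I (fun y => Q y * (win (y - x) t + kinner B x y t)) = 0.
      by have := kE x t; rewrite /kmap /= (sB' x0 t1) => /esym.
    rewrite z rC0 mul0r mulr0; reflexivity.
  by move=> y; rewrite HE mulrC.
rewrite E1 {E1}; apply: eq_cI => y.
have [y1|y1] := boolP (0 < y <= 1); last first.
  have z t : H (t, y) = 0 by rewrite HE (sQ y1) mul0r rC0 mul0r.
  rewrite (eq_cI z) cI0 (sQ y1) rC0 mul0r; reflexivity.
have [Lk Ik] := Lap_inner k x0 y1.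
rewrite (eq_cI (g := fun t => (Q y)%:C%C * ((win (y - x) t)%:C%C * ek k t + (kinner B x y t)%:C%C * ek k t))); last first.
  move=> t; rewrite HE -[in RHS](win1 _ _ y1) -[in RHS](kin1 _ _ y1) (rCM (Q y)) rCD (rCM (win 1 t) (win (y - x) t)) (rCM (win 1 t) (kinner B x y t)).
  move: (Q y)%:C%C (win 1 t)%:C%C (ek k t) (win (y - x) t)%:C%C (kinner B x y t)%:C%C => a b c e f; ring.
rewrite cIZ; last by apply: cL1D; [exact: cL1_win_ek | exact: Lk].
rewrite cID; [|exact: cL1_win_ek | exact: Lk].
rewrite Ik /jv -[cI (fun t => (win (y - x) t)%:C%C * ek k t)]/(ee k (y - x)).
by move: (Q y)%:C%C (ee k (y - x)) (Lap _ k) => a b c; ring.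
Qed.

End Jost.


(** * Limits and convolutions *)

Section Convergence.
Context {R : realType}.
Local Notation mu := (@lebesgue_measure R).

Lemma I_dct (f_ : nat -> R -> R) (f g : R -> R) : (forall n, measurable_fun setT (f_ n)) ->
  measurable_fun setT f -> (forall x, f_ ^~ x @ \oo --> f x) -> L1 g ->
  (forall n x, `|f_ n x| <= g x) -> (fun n => I (f_ n)) @ \oo --> I f.
Proof.
move=> mf_ mf cf Lg fg.
have Lf_ n : L1 (f_ n) by apply: L1_le Lg => //; exact: mf_.
have [||||| Lf _ H] := @dominated_convergence _ _ R mu setT measurableT (fun n => EFin \o f_ n) (EFin \o f) (EFin \o g).
- by move=> n; apply/measurable_EFinP; exact: mf_.
- by apply/measurable_EFinP.
- by apply: aeW => x _; apply: cvg_EFin; [exact: nearW | exact: cf].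
- exact: Lg.
- by apply: aeW => x n _; rewrite /= lee_fin.
have e : (\int[mu]_x (EFin \o f) x)%E = (I f)%:E.
  by rewrite /I /Rintegral fineK //; exact: integrable_fin_num.
by move: H; rewrite e => /fine_cvgP[].
Qed.

Lemma expRN_le (z : R) : 0 <= z -> expR (- z) * (1 + z) <= 1.
Proof.
move=> z0; rewrite expRN mulrC ler_pdivrMr ?expR_gt0 // mul1r; exact: expR_ge1Dx.
Qed.

Lemma expRN_cvg0 (t : R) : 0 < t -> (fun n : nat => expR (- (2 * n%:R * t))) @ \oo --> (0 : R).
Proof.
move=> t0; apply/cvgrPdist_le => e e0.
pose N := (Num.truncn (e^-1 / (2 * t))).+1.
exists N => // n Nn; rewrite sub0r normrN ger0_norm ?expR_ge0 //.
have z0 : 0 <= 2 * n%:R * t by rewrite !mulr_ge0 // ltW.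
have := expRN_le z0; set E := expR _ => H.
have E0 : 0 <= E by exact: expR_ge0.
have nb : e^-1 / (2 * t) < n%:R.
  by apply: (@lt_le_trans _ _ N%:R); [exact: truncnS_gt | rewrite ler_nat].
have t2 : 0 < 2 * t by lra.
have H2 : e^-1 < 2 * n%:R * t.
  by move: nb; rewrite ltr_pdivrMr // => ?; rewrite (_ : 2 * n%:R * t = n%:R * (2 * t)) //; ring.
have H3 : 1 < e * (2 * n%:R * t) by rewrite -ltr_pdivrMl // mulr1.
have : E * (2 * n%:R * t) <= 1 by nra.
nra.
Qed.

Lemma Lap_decay (c : R -> R) : nice c -> forall e, 0 < e -> exists K : R,
  forall x, K < x -> nC (Lap c (0 +i* x)%C) < e.
Proof.
move=> nc e e0; have [Lc sc] := nc.
(* Dominated convergence is run along integers, and monotonicity in x covers the rest. The modulus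
   of t keeps the exponential bounded by 1 off the support as well. *)
have L_ (x : R) : 0 <= x -> L1 (fun t => `|c t| * expR (- (2 * x * `|t|))).
  move=> x0; apply: (L1M (M := 1)); first exact: L1norm.
    apply: continuous_measurable_fun => t; apply: (@continuous_comp _ _ _ (fun t : R => - (2 * x * `|t|)) (@expR R)); last exact: continuous_expR.
    apply: (@cvgN R R^o); apply: (@cvgM R); first exact: cvg_cst.
    exact: (@norm_continuous _ R^o).
  by move=> t; rewrite ger0_norm ?expR_ge0 // -[leRHS]expR0 ler_expR oppr_le0 !mulr_ge0.
have c1 t : (fun n : nat => `|c t| * expR (- (2 * n%:R * `|t|))) @ \oo --> (0 : R).
  have [t1|t1] := boolP (0 < t <= 1); last first.
    by rewrite sc // normr0; under eq_fun do rewrite mul0r; exact: cvg_cst.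
  rewrite -[X in _ --> X](mulr0 `|c t|); apply: (@cvgM R); first exact: cvg_cst.
  by apply: expRN_cvg0; rewrite normr_gt0; case/andP: t1 => /lt0r_neq0.
have H := @I_dct (fun n t => `|c t| * expR (- (2 * n%:R * `|t|))) (fun _ => 0) (fun t => `|c t|).
have {}H : (fun n : nat => I (fun t => `|c t| * expR (- (2 * n%:R * `|t|)))) @ \oo --> (0 : R).
  rewrite -[X in _ --> X](@I0 R); apply: H => //.
  - by move=> n; apply: L1_meas; exact: L_.
  - exact: L1norm.
  - move=> n t; rewrite normrM normr_id ler_piMr // ger0_norm ?expR_ge0 //.
move/cvgrPdist_lt : H => /(_ e e0)[N _ HN]; exists N%:R => x Nx.
have x0 : 0 <= x by apply: le_trans (ltW Nx).
have := HN N (leqnn N); rewrite /= sub0r normrN => /(le_lt_trans (ler_norm _)).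
apply: le_lt_trans; apply: (@le_trans _ _ (I (fun t => `|c t| * expR (- (2 * x * `|t|))))).
  apply: (cI_le (cL1_Lap (0 +i* x)%C nc) (L_ x x0)) => t.
  have [/andP[t0 t1]|t1] := boolP (0 < t <= 1); last by rewrite (sc _ t1) rC0 mul0r normc0 normr0 mul0r.
  rewrite normcM normcC ek_norm (gtr0_norm t0); exact: lexx.
apply: (I_le (L_ x x0) (L_ N%:R _)) => [|t]; first exact: ler0n.
apply: ler_wpM2l; first exact: normr_ge0.
by rewrite ler_expR lerN2; apply: ler_wpM2r; [exact: normr_ge0 | rewrite ler_pM2l // ltW].
Qed.

(** A convolution whose second factor may change with y: its transform is int a(y) e^{2iky} T^(y, k)
    dy, where T^(y, k) is the transform of T(y, .). *)
Definition kconv (a : R -> R) (T : R * R -> R) t := I (fun y => a y * T (y, t - y)).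

Lemma kconvP (a : R -> R) (T : R * R -> R) (M S : R) k : nice a -> measurable_fun setT T ->
  0 <= M -> 0 <= S -> (forall y s, 0 <= y -> `|T (y, s)| <= M * win S s) ->
  [/\ L1 (kconv a T), forall t, ~~ ((0 < t) && (t < 1 + S)) -> kconv a T t = 0,
      forall y, 0 <= y -> cL1 (fun s => (T (y, s))%:C%C * ek k s) &
      cI (fun t => (kconv a T t)%:C%C * ek k t) = cI (fun y => (a y)%:C%C * (ek k y * cI (fun s => (T (y, s))%:C%C * ek k s)))].
Proof.
move=> na mT M0 S0 HT; have [La sa] := na.
set E := expR (2 * nC k * (1 + S)); have E0 : 0 <= E by exact: expR_ge0.
have ekE t : 0 < t -> t < 1 + S -> nC (ek k t) <= E.
  move=> t0 t1; rewrite ek_norm ler_expR.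
  have := normc_Im k; rewrite ler_norml => /andP[b _]; have := normc_ge0 k => n0.
  apply: (@le_trans _ _ (2 * nC k * t)); last by apply: ler_wpM2l; [rewrite mulr_ge0 | exact: ltW].
  by rewrite -mulNr; apply: ler_wpM2r; [exact: ltW | lra].
have mTs y : measurable_fun setT (fun s => T (y, s)) by apply: (measurableT_comp mT); exact: measurable_pair1.
have LT y : 0 <= y -> cL1 (fun s => (T (y, s))%:C%C * ek k s).
  move=> y0; apply: (@cL1_le _ _ (fun s => M * E * win S s)).
  - by apply: cmeasM; [apply: cmeas_real; exact: mTs | exact: cmeas_ek].
  - move=> s; have [/andP[s0 s1]|s1] := boolP ((0 < s) && (s < S)); last first.
      have e : T (y, s) = 0 by apply/eqP; rewrite -normr_le0; apply: le_trans (HT y s y0) _; rewrite win_out // mulr0.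
      by rewrite e rC0 mul0r normc0 win_out // mulr0.
    have := HT y s y0; rewrite (win_in s0 s1) !mulr1 normcM normcC => b.
    by apply: ler_pM; rewrite ?normc_ge0 ?ekE //; lra.
  - by apply: L1Z; exact: L1_win.
have z0 y t : 0 < y <= 1 -> ~~ ((0 < t) && (t < 1 + S)) -> T (y, t - y) = 0.
  move=> /andP[y0 y1] t1; apply/eqP; rewrite -normr_le0; apply: le_trans (HT y (t - y) (ltW y0)) _.
  rewrite win_out ?mulr0 //; apply: contra t1 => /andP[? ?]; apply/andP; split; lra.
have ms : measurable_fun setT (fun p : R * R => T (p.1, p.2 - p.1)).
  by apply: (measurableT_comp mT); apply/measurable_fun_pair => //; exact: measurable_funB.
have mc : measurable_fun setT (fun p : R * R => a p.1 * T (p.1, p.2 - p.1)).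
  by apply: measurable_funM => //; apply: (measurableT_comp (L1_meas La)).
have bT y t : `|a y * T (y, t - y)| <= (M * `|a y|) * win (1 + S) t.
  have [y1|y1] := boolP (0 < y <= 1); last by rewrite (sa _ y1) mul0r normr0 mulr0 mul0r.
  have [t1|t1] := boolP ((0 < t) && (t < 1 + S)); last by rewrite (z0 _ _ y1 t1) mulr0 normr0 (win_out t1) mulr0.
  case/andP: t1 => t0 t1; rewrite (win_in t0 t1) mulr1 normrM mulrC; apply: ler_wpM2r => //.
  apply: le_trans (HT y (t - y) _) _; first by case/andP: y1 => /ltW.
  by rewrite ler_piMr // win_le1.
have Lb t : L1 (fun y => a y * T (y, t - y)).
  apply: (@L1_le _ _ (fun y => M * `|a y|)).
  - apply: (measurableT_comp (f := fun p : R * R => a p.1 * T (p.1, p.2 - p.1)) (g := fun y => (y, t)) mc).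
    exact: measurable_pair2.
  - by move=> y; apply: le_trans (bT y t) _; rewrite ler_piMr ?win_le1 // mulr_ge0.
  - by apply: L1Z; exact: L1norm.
have mt1 : measurable_fun setT (fun z : R * R => a z.2 * T (z.2, z.1 - z.2)).
  by apply: (measurableT_comp mc (g := fun z => (z.2, z.1))); exact: measurable_swap.
have Lk : L1 (kconv a T).
  apply: (@L1_le _ _ (fun t => (M * I (fun y => `|a y|)) * win (1 + S) t)).
  - exact: (measurable_I mt1).
  - move=> t; rewrite mulrAC /kconv -IZ; last exact: L1norm.
    apply: I_abs_le; [exact: Lb | by apply: L1Z; exact: L1norm |] => y.
    by apply: le_trans (bT y t) _; rewrite le_eqVlt; apply/orP; left; apply/eqP; ring.
  - by apply: L1Z; exact: L1_win.
split=> //.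
  move=> t t1; rewrite /kconv (@eq_I _ _ (fun _ => 0)) ?I0 // => y.
  have [y1|y1] := boolP (0 < y <= 1); last by rewrite (sa _ y1) mul0r.
  by rewrite (z0 _ _ y1 t1) mulr0.
pose H (p : R * R) : R[i] := (a p.1 * T (p.1, p.2 - p.1))%:C%C * ek k p.2.
have HE y t : H (y, t) = (a y * T (y, t - y))%:C%C * ek k t by [].
have mH : cmeas H by apply: cmeasM; [exact: cmeas_real | exact: (cmeas_comp (cmeas_ek k) (measurable_snd))].
have Hh y t : nC (H (y, t)) <= (M * E * `|a y|) * win (1 + S) t.
  rewrite HE normcM normcC; have [t1|t1] := boolP ((0 < t) && (t < 1 + S)); last first.
    have := bT y t; rewrite (win_out t1) !mulr0 => b.
    have -> : `|a y * T (y, t - y)| = 0 by apply/eqP; rewrite eq_le normr_ge0 b.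
    by rewrite mul0r.
  have := bT y t; case/andP: t1 => t0 t1; rewrite (win_in t0 t1) !mulr1 mulrAC => b.
  by apply: ler_pM; rewrite ?normc_ge0 ?ekE.
have hI y : I (fun t => (M * E * `|a y|) * win (1 + S) t) <= (M * E * I (win (1 + S))) * `|a y|.
  by rewrite IZ; [rewrite mulrAC | exact: L1_win].
have [E1 _ _] := cfubini mH Hh (fun y => L1Z _ (L1_win (1 + S))) hI (L1Z _ (L1norm La)).
rewrite (eq_cI (g := fun t => cI (fun y => H (y, t)))); last first.
  move=> t; rewrite (eq_cI (g := fun y => ek k t * (a y * T (y, t - y))%:C%C)).
    rewrite cIZ; last exact: cL1_real.
    by rewrite cI_real mulrC.
  by move=> y; rewrite HE mulrC.
rewrite -E1 {E1}; apply: eq_cI => y.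
have [y1|y1] := boolP (0 < y <= 1); last first.
  have z t : H (y, t) = 0 by rewrite HE (sa _ y1) mul0r rC0 mul0r.
  rewrite (eq_cI z) cI0 (sa _ y1) rC0 mul0r; reflexivity.
have LTy := LT y (ltW (andP y1).1).
have [Ls Is] := cI_shift (- y) LTy.
rewrite (eq_cI (g := fun t => ((a y)%:C%C * ek k y) * ((T (y, t - y))%:C%C * ek k (t - y)))).
  by rewrite (cIZ _ Ls) Is mulrA.
move=> t; rewrite HE rCM; have -> : ek k t = ek k y * ek k (t - y) by rewrite -ekD subrKC.
move: (a y)%:C%C (ek k y) (T (y, t - y))%:C%C (ek k (t - y)) => b c d e; ring.
Qed.

End Convergence.


(** * Jost solutions *)

Section JostSolution.
Context {R : realType}.
Variables (Q : R -> R) (B : R * R -> R).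
Hypotheses (nQ : nice Q) (kB : is_kernel Q B).
Implicit Types (k : R[i]) (x y s t : R).

Let LQ : L1 Q. Proof. by case: nQ. Qed.
Let sQ y : ~~ (0 < y <= 1) -> Q y = 0. Proof. by case: nQ => _; exact. Qed.
Let mB : measurable_fun setT B. Proof. by case: kB. Qed.
Let sB x t : ~~ ((0 < t) && (x + t < 1)) -> B (x, t) = 0. Proof. by case: kB => _ _ + _; exact. Qed.

(** Its transform is int Q(y) e^{2iky} v(y, k) dy, which turns out to be i k f(0) - f'(0). This is
    the [Y] of the half line problem. *)
Definition jc t := Q t + kconv Q B t.
Definition jF k := jv B 0 k.
Definition jY k := Lap jc k.

Let kP k : exists2 M, 0 <= M & (forall y s, 0 <= y -> `|B (y, s)| <= M * win 1 s).
Proof. exact: (kernel_bound kB). Qed.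

Let Lkc : L1 (kconv Q B).
Proof. by have [M M0 HM] := kP 0; have [] := kconvP 0 nQ mB M0 ler01 HM. Qed.

Lemma nice_jc : nice jc.
Proof.
split; first exact: L1D.
move=> t t1; rewrite /jc (sQ t1) add0r /kconv (@eq_I _ _ (fun _ => 0)) ?I0 // => y.
have [/andP[y0 y1]|y1] := boolP (0 < y <= 1); last by rewrite (sQ y1) mul0r.
rewrite sB ?mulr0 //; apply: contra t1 => /andP[a b]; apply/andP; split; lra.
Qed.

Lemma cmeas_jv k : cmeas (fun y => jv B y k).
Proof.
apply: cmeasD; first exact: cmeas_cst.
apply: (@cmeas_cI _ _ _ (fun p : R * R => (B p)%:C%C * ek k p.2)).
by apply: cmeasM; [exact: cmeas_real | exact: (cmeas_comp (cmeas_ek k) (measurable_snd))].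
Qed.

Lemma jv_bound k : exists M, forall y, 0 <= y -> nC (jv B y k) <= M.
Proof.
have [M M0 HM] := kP k; exists (1 + M * expR (2 * nC k) * I (win 1)) => y y0.
apply: le_trans (normcD _ _) _; rewrite normc1 lerD2l -IZ; last exact: L1_win.
apply: cI_le; [by apply: cL1_Lap; exact: (nice_kernel kB) | by apply: L1Z; exact: L1_win |] => t.
have [/andP[t0 t1]|t1] := boolP ((0 < t) && (t < 1)); last first.
  have -> : B (y, t) = 0 by apply: sB; apply: contra t1 => /andP[a b]; apply/andP; split; lra.
  by rewrite rC0 mul0r normc0 (win_out t1) mulr0.
have := HM y t y0; rewrite (win_in t0 t1) !mulr1 normcM normcC => b.
by apply: ler_pM; rewrite ?normc_ge0 ?ek_bound // t0 ltW.
Qed.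

Lemma jv_bound_closed : exists M, forall k y, 0 <= Im k -> 0 <= y -> nC (jv B y k) <= M.
Proof.
have [M M0 HM] := kP 0; exists (1 + M * I (win 1)) => k y k0 y0.
apply: le_trans (normcD _ _) _; rewrite normc1 lerD2l -IZ; last exact: L1_win.
have nb : nice (fun t => B (y, t)) by exact: (nice_kernel kB).
apply: le_trans (Lap_le nb k0) _; apply: I_le; [by apply: L1norm; case: nb | by apply: L1Z; exact: L1_win |].
by move=> t; exact: HM.
Qed.

Definition jh1 k y : R[i] := (Q y)%:C%C * jv B y k.
Definition jh2 k y : R[i] := (Q y)%:C%C * (ek k y * jv B y k).

Lemma cL1_jh1 k : cL1 (jh1 k).
Proof.
have [M HM] := jv_bound k; apply: (cL1_nice (M := M) nQ (cmeas_jv k)) => t /andP[t0 _].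
by apply: HM; exact: ltW.
Qed.

Lemma cL1_jh2 k : cL1 (jh2 k).
Proof.
have [M HM] := jv_bound k.
apply: (cL1_nice (M := expR (2 * nC k) * M) nQ); first by apply: cmeasM; [exact: cmeas_ek | exact: cmeas_jv].
move=> t t1; rewrite normcM; apply: ler_pM; rewrite ?normc_ge0 ?ek_bound //.
by apply: HM; apply: ltW; case/andP: t1.
Qed.

(** The coefficients of variation of constants: f = e^{ikx} (1 - X / (2ik)) + e^{-ikx} Z / (2ik). *)
Definition jX k x := cI (fun y => (hv (y - x))%:C%C * jh1 k y).
Definition jZ k x := cI (fun y => (hv (y - x))%:C%C * jh2 k y).

Lemma cL1_hvB h x : cL1 h -> cL1 (fun y => (hv (y - x))%:C%C * h y).
Proof.
move=> Lh; apply: (cL1_hv (s := fun y => hv (y - x))) => //; last by move=> y; exact: hv_norm.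
by apply: measurable_hv => //; exact: measurable_funB.
Qed.

Lemma jv_XZ k x : k != 0 -> 0 <= x -> jv B x k = 1 + (ek k (- x) * jZ k x - jX k x) / (2 * 'i%C * k).
Proof.
move=> k0 x0; rewrite (jv_eq nQ kB _ x0); congr (1 + _).
rewrite mulrC -(cIZ (ek k (- x))); last by apply: cL1_hvB; exact: cL1_jh2.
rewrite -cIB; [|by apply: cL1Z; apply: cL1_hvB; exact: cL1_jh2|by apply: cL1_hvB; exact: cL1_jh1].
rewrite -cIZ; last by apply: cL1B; [by apply: cL1Z; apply: cL1_hvB; exact: cL1_jh2|by apply: cL1_hvB; exact: cL1_jh1].
apply: eq_cI => y; rewrite /jh1 /jh2; have [yx|yx] := lerP (y - x) 0.
  by rewrite (ee_neg _ yx) (hv_neg yx) rC0 !mul0r !mulr0 subr0 mulr0.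
rewrite (ee_pos k0 (ltW yx)) (hv_pos yx) rC1 ekD.
move: (2 * 'i%C * k)^-1 (Q y)%:C%C (ek k y) (ek k (- x)) (jv B y k) => a b c d e; ring.
Qed.

Definition jf k x : R[i] := cexp ('i%C * k * x%:C%C) * jv B x k.
(** The derivative that variation of constants predicts for [jf]. Its definition involves no
    differentiation; [cac_jf] and [cac_jd] show that it is the derivative and that f'' = (Q - k^2)
    f. *)
Definition jd k x : R[i] := 'i%C * k * cexp ('i%C * k * x%:C%C) -
  (cexp (- ('i%C * k) * x%:C%C) * jZ k x + cexp ('i%C * k * x%:C%C) * jX k x) / 2.

Lemma rCN x : (- x)%:C%C = - x%:C%C :> R[i]. Proof. exact: rmorphN. Qed.

Lemma ek_cexp k x : ek k x = cexp ('i%C * k * x%:C%C) ^+ 2.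
Proof.
rewrite expr2 -cexpD; congr cexp; move: 'i%C x%:C%C => a b; ring.
Qed.

Lemma cexpNx k x : cexp (- ('i%C * k) * x%:C%C) * cexp ('i%C * k * x%:C%C) = 1.
Proof. by rewrite -cexpD mulNr addNr cexp0. Qed.

Let i0 : ('i%C : R[i]) != 0. Proof. by rewrite -normc_gt0 normci. Qed.
Let i2 : ('i%C : R[i]) * 'i%C = -1. Proof. by rewrite -expr2 sqr_i. Qed.

Lemma jf_XZ k x : k != 0 -> 0 <= x -> jf k x = cexp ('i%C * k * x%:C%C) +
  (cexp (- ('i%C * k) * x%:C%C) * jZ k x - cexp ('i%C * k * x%:C%C) * jX k x) / (2 * 'i%C * k).
Proof.
move=> k0 x0; rewrite /jf (jv_XZ k0 x0).
have -> : ek k (- x) = cexp (- ('i%C * k) * x%:C%C) ^+ 2.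
  by rewrite ek_cexp; congr (cexp _ ^+ 2); rewrite rCN mulrN mulNr.
have := cexpNx k x; move: (cexp (- ('i%C * k) * x%:C%C)) (cexp ('i%C * k * x%:C%C)) (jZ k x) (jX k x) => a b c d ab.
rewrite mulrDr mulr1 mulrA mulrBr; congr (_ + (_ - _) / _).
by rewrite expr2 mulrA mulrA [b * a]mulrC ab mul1r.
Qed.

Lemma cac_jX k A : 0 <= A -> cac A (jX k) (fun y => - jh1 k y).
Proof. by move=> A0; apply: cac_tail => //; exact: cL1_jh1. Qed.
Lemma cac_jZ k A : 0 <= A -> cac A (jZ k) (fun y => - jh2 k y).
Proof. by move=> A0; apply: cac_tail => //; exact: cL1_jh2. Qed.

Lemma cac_jf k A : k != 0 -> 0 <= A -> cac A (jf k) (jd k).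
Proof.
move=> k0 A0; have HE := cac_cexp ('i%C * k) A0; have HN := cac_cexp (- ('i%C * k)) A0.
have HX := cac_jX k A0; have HZ := cac_jZ k A0.
apply: eq_cac (cacD HE (cacZ (2 * 'i%C * k)^-1 (cacD (cac_mul HN HZ) (cacN (cac_mul HE HX))))) => //.
  by move=> x /andP[x0 _]; rewrite (jf_XZ k0 x0) [_ / _]mulrC.
move=> x _; rewrite /jd /jh1 /jh2 ek_cexp; have := cexpNx k x.
move: (cexp (- ('i%C * k) * x%:C%C)) (cexp ('i%C * k * x%:C%C)) (jZ k x) (jX k x) (jv B x k) (Q x)%:C%C => a b c d e q ab.
have -> : - ('i%C * k) * a * c + a * - (q * (b ^+ 2 * e)) - ('i%C * k * b * d + b * - (q * e)) =
  (2 * 'i%C * k) * (- (a * c + b * d) / 2) + q * b * e * (1 - a * b) by field.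
rewrite ab subrr mulr0 addr0 mulrA mulVf ?mul1r; first by rewrite mulNr.
by rewrite !mulf_neq0 // pnatr_eq0.
Qed.

Lemma cac_jd k A : k != 0 -> 0 <= A -> cac A (jd k) (fun x => ((Q x)%:C%C - k ^+ 2) * jf k x).
Proof.
move=> k0 A0; have HE := cac_cexp ('i%C * k) A0; have HN := cac_cexp (- ('i%C * k)) A0.
have HX := cac_jX k A0; have HZ := cac_jZ k A0.
apply: eq_cac (cacD (cacZ ('i%C * k) HE) (cacN (cacZ 2^-1 (cacD (cac_mul HN HZ) (cac_mul HE HX))))) => //.
  by move=> x _; rewrite /jd [_ / _]mulrC.
move=> x /andP[x0 _]; rewrite mulrBl {1}/jf (jf_XZ k0 (ltW x0)) /jh1 /jh2 ek_cexp; have := cexpNx k x.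
move: (cexp (- ('i%C * k) * x%:C%C)) (cexp ('i%C * k * x%:C%C)) (jZ k x) (jX k x) (jv B x k) (Q x)%:C%C => a b c d e q ab.
have -> : k ^+ 2 * (b + (a * c - b * d) / (2 * 'i%C * k)) = k ^+ 2 * b - ('i%C * 'i%C) * (k ^+ 2 * (a * c - b * d) / (2 * 'i%C * k)).
  by rewrite i2; move: (_^-1) => w; ring.
have -> : ('i%C * 'i%C) * (k ^+ 2 * (a * c - b * d) / (2 * 'i%C * k)) = 'i%C * k * (a * c - b * d) / 2.
  by move: i0; move: 'i%C => j j0; field; rewrite j0 k0.
have -> : 'i%C * k * ('i%C * k * b) = - (k ^+ 2 * b) by transitivity (('i%C * 'i%C) * (k ^+ 2 * b)); [move: 'i%C => j; ring | rewrite i2 mulN1r].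
have -> : a * - (q * (b ^+ 2 * e)) = - (q * b * e) * (a * b) by ring.
by rewrite ab; field.
Qed.

Let jtail0 (k : R -> R[i]) x h : 1 <= x -> (forall y, h y = (Q y)%:C%C * k y) -> cI (fun y => (hv (y - x))%:C%C * h y) = 0 :> R[i].
Proof.
move=> x1 hE; rewrite (eq_cI (g := fun _ => 0)) ?cI0 // => y; rewrite hE.
have [y1|y1] := lerP (y - x) 0; first by rewrite (hv_neg y1) rC0 mul0r.
rewrite (sQ (y := y)) ?rC0 ?mul0r ?mulr0 // negb_and -!ltNge; apply/orP; right; lra.
Qed.

Lemma jX1 k x : 1 <= x -> jX k x = 0. Proof. by move=> x1; apply: (jtail0 (k := fun y => jv B y k) x1). Qed.
Lemma jZ1 k x : 1 <= x -> jZ k x = 0. Proof. by move=> x1; apply: (jtail0 (k := fun y => ek k y * jv B y k) x1). Qed.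

Lemma jf1 k x : 1 <= x -> jf k x = cexp ('i%C * k * x%:C%C).
Proof.
move=> x1; rewrite /jf /jv /Lap (eq_cI (g := fun _ => 0)) ?cI0 ?addr0 ?mulr1 // => t.
rewrite sB ?rC0 ?mul0r //; apply/negP => /andP[a b]; lra.
Qed.

Lemma jd1 k x : 1 <= x -> jd k x = 'i%C * k * cexp ('i%C * k * x%:C%C).
Proof. by move=> x1; rewrite /jd jX1 // jZ1 // !mulr0 addr0 mul0r subr0. Qed.

Lemma jf0 k : jf k 0 = jF k.
Proof. by rewrite /jf mulr0 cexp0 mul1r. Qed.

Let hv0 h y : (hv (y - 0))%:C%C * ((Q y)%:C%C * h) = (Q y)%:C%C * h :> R[i].
Proof.
rewrite subr0; have [y1|y1] := boolP (0 < y <= 1); last by rewrite (sQ y1) rC0 mul0r mulr0.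
by rewrite hv_pos ?rC1 ?mul1r //; case/andP: y1.
Qed.

Lemma jZ0 k : jZ k 0 = jY k.
Proof.
have [M M0 HM] := kP k; have [Lk sk LT E] := kconvP k nQ mB M0 ler01 HM.
rewrite /jZ /jY /Lap (eq_cI (g := fun t => (Q t)%:C%C * ek k t + (Q t)%:C%C * (ek k t * cI (fun s => (B (t, s))%:C%C * ek k s)))); last first.
  by move=> y; rewrite hv0 /jv mulrDr mulr1 mulrDr.
have L2 : cL1 (fun y => (Q y)%:C%C * (ek k y * cI (fun s => (B (y, s))%:C%C * ek k s))).
  have := cL1B (cL1_jh2 k) (cL1_Lap k nQ); apply: eq_cL1 => y.
  by rewrite /jh2 /jv mulrDr mulr1 mulrDr addrAC subrr add0r.
have L3 : cL1 (fun t => (kconv Q B t)%:C%C * ek k t).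
  have := cL1B (cL1_Lap k nice_jc) (cL1_Lap k nQ); apply: eq_cL1 => y.
  by rewrite /jc rCD mulrDl addrAC subrr add0r.
rewrite (cID (cL1_Lap k nQ) L2) -E -(cID (cL1_Lap k nQ) L3); apply: eq_cI => y.
by rewrite /jc rCD mulrDl.
Qed.

Lemma jX0 k : jX k 0 = cI (jh1 k).
Proof. by apply: eq_cI => y; exact: hv0. Qed.

Lemma jF_XZ k : k != 0 -> jF k = 1 + (jY k - jX k 0) / (2 * 'i%C * k).
Proof.
move=> k0; rewrite /jF (jv_XZ k0 (lexx 0)) jZ0 oppr0.
have -> : ek k 0 = 1 by rewrite /ek mulr0 cexp0.
by rewrite mul1r.
Qed.

Lemma jd0 k : k != 0 -> jd k 0 = Fder jF jY k.
Proof.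
move=> k0; rewrite /Fder (jF_XZ k0) /jd !mulr0 cexp0 !mul1r mulr1 jZ0.
move: (jY k) (jX k 0) i0; move: 'i%C => j a b j0; field.
by rewrite j0 k0.
Qed.

(** The derivative of conj f f' has imaginary part - 2 Re k Im k |f|^2, and at x = 1, where f =
    e^{ikx}, the flux is Re k e^{-2 Im k}. *)
Lemma jost_flux k : k != 0 -> 0 <= Im k -> 0 <= Re k ->
  Re k * expR (- (2 * Im k)) <= Im ((jF k)^*%C * Fder jF jY k) /\
  (Im k = 0 -> Im ((jF k)^*%C * Fder jF jY k) = Re k).
Proof.
move=> k0 ik rk; have Hf := cac_jf k0 (ler01 : 0 <= (1 : R)); have Hd := cac_jd k0 (ler01 : 0 <= (1 : R)).
have [_ [Lw /(_ 1)]] := cac_mul (cacJ Hf) Hd; rewrite lexx ler01 => /(_ isT).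
rewrite jf0 (jd0 k0) jf1 // jd1 // mulr1.
set W := Im (_ * Fder _ _ _); set D := I _.
have D0 : D <= 0.
  rewrite -(@I0 R); apply: I_le => //; first exact: L1_0.
  move=> t; apply: (@le_trans _ _ (- (2 * Re k * Im k * (Re (jf k t) ^+ 2 + Im (jf k t) ^+ 2)) * win 1 t)).
    rewrite le_eqVlt; apply/orP; left; apply/eqP; congr (_ * _).
    by move: (jf k t) (jd k t) => a b; rewrite expr2 !reim; ring.
  by rewrite mulNr oppr_le0 !mulr_ge0 ?win_ge0 ?addr_ge0 ?sqr_ge0.
have -> : Im ((cexp ('i%C * k))^*%C * ('i%C * k * cexp ('i%C * k))) = Re k * expR (- (2 * Im k)).
  have -> : expR (- (2 * Im k)) = nC (cexp ('i%C * k)) ^+ 2.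
    by rewrite normc_cexp expr2 -expRD; congr expR; rewrite !reim; ring.
  rewrite normc_sq; move: (cexp _) => e; rewrite !reim; ring.
move=> e; split; first by rewrite e; lra.
move=> ik0; have : D = 0.
  rewrite -(@I0 R); apply: eq_I => t; have -> : forall z w : R, z = 0 -> z * w = 0 by move=> z w ->; rewrite mul0r.
    by [].
  move: (jf k t) (jd k t) => a b; rewrite expr2 !reim ik0; ring.
move: e; rewrite ik0 mulr0 oppr0 expR0 mulr1 => -> ->; rewrite addr0; reflexivity.
Qed.

Theorem jost_weyl : weyl jF jY.
Proof.
have nb := nice_kernel kB (lexx 0).
have [M HM] := jv_bound_closed.
have kr k : 0 < Re k -> k != 0 by move=> r0; apply: contraTneq r0 => ->; rewrite Re0 ltxx.
split.
- by move=> k; apply: jetD; [exact: jet_cst | exact: Lap_jet].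
- by move=> k; apply: Lap_jet; exact: nice_jc.
- by move=> k; rewrite /jF /jv Lap_conj //; apply: ceq; rewrite !(ReD, ImD, ReJ, ImJ) // opprD; congr (_ + _); rewrite oppr0.
- by move=> k; apply: Lap_conj; exact: nice_jc.
(* From k (F - 1) = (Y - X) / (2i), with Y and X = int Q v bounded in the closed half plane. *)
- exists ((I (fun t => `|jc t|) + I (fun t => M * `|Q t|)) / 2) => k ik.
  have [->|k0] := eqVneq k 0.
    rewrite normc0 mul0r divr_ge0 // addr_ge0 // I_ge0 // => t; rewrite mulr_ge0 //.
    by apply: le_trans (HM 0 0 _ _); rewrite ?Im0 ?normc_ge0.
  rewrite (jF_XZ k0) addrC addKr normcM normcV !normcM normci mulr1.
  have n2 : nC (2 : R[i]) = 2 by rewrite (_ : 2 = (2 : R)%:C%C) ?normcC ?ger0_norm //; apply: ceq; rewrite !reim; ring.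
  have -> : forall a : R, nC k * (a / (nC 2 * nC k)) = a / 2.
    by move=> a; rewrite n2; field; rewrite lt0r_neq0 // normc_gt0.
  rewrite ler_pM2r ?invr_gt0 //; apply: le_trans (normcB _ _) _; apply: lerD.
    by apply: Lap_le => //; exact: nice_jc.
  rewrite jX0; apply: cI_le; [exact: cL1_jh1 | by apply: L1Z; exact: L1norm |] => y.
  have [/andP[y0 y1]|y1] := boolP (0 < y <= 1); last by rewrite /jh1 (sQ y1) rC0 mul0r normc0 normr0 mulr0.
  by rewrite normcM normcC mulrC ler_wpM2r //; apply: HM => //; exact: ltW.
- exists (I (fun t => `|jc t|)) => k ik; apply: Lap_le => //; exact: nice_jc.
- by move=> e e0; apply: Lap_decay => //; exact: nice_jc.
- move=> k ik rk; have [H _] := jost_flux (kr k rk) ik (ltW rk).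
  by apply: lt_le_trans H; rewrite mulr_gt0 // expR_gt0.
- move=> s s0; have r0 : 0 < Re (s%:C%C : R[i]) by [].
  by have [_ ->] := jost_flux (kr _ r0) (lexx 0) (ltW r0).
Qed.

End JostSolution.


(** * Uniqueness of Laplace transforms *)

Section LaplaceUniqueness.
Context {R : realType}.
Local Notation mu := (@lebesgue_measure R).
Implicit Types (f g : R -> R).

Lemma aeS (P S : R -> Prop) : (forall x, P x -> S x) -> {ae mu, forall x, P x} -> {ae mu, forall x, S x}.
Proof.
by move=> PS; have F := ae_filter_ringOfSetsType mu; move=> H; exact: (@filterS _ _ F _ _ PS H).
Qed.

Lemma aeI (P S : R -> Prop) : {ae mu, forall x, P x} -> {ae mu, forall x, S x} -> {ae mu, forall x, P x /\ S x}.
Proof.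
by move=> H K; have F := ae_filter_ringOfSetsType mu; exact: (@filterI _ _ F _ _ H K).
Qed.

(** The primitive of g is constant, and by Lebesgue differentiation its derivative is g almost
    everywhere. *)
Lemma I_tail_ae0 g : L1 g -> (forall x, I (fun t => g t * hv (t - x)) = 0) -> I g = 0 ->
  {ae mu, forall t, g t = 0}.
Proof.
move=> Lg H Ig.
have LE : locally_integrable [set: R] g by apply: open_integrable_locally => //; exact: openT.
have iE y : mu.-integrable `]-oo, y] (EFin \o g).
  by apply: (integrableS measurableT) Lg.
apply: aeS (FTC1Ny iE LE) => x [_ <-].
rewrite (_ : (fun x => _) = fun _ => 0); first by rewrite derive1E; exact: derive_cst.
apply/funext => y; rewrite Rintegral_mkcond.
have Lh : L1 (fun t => g t * hv (t - y)).
  apply: (L1M (M := 1)) => //; [|by move=> t; exact: hv_norm].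
  by apply: measurable_hv => //; exact: measurable_funB.
rewrite (_ : Rintegral _ _ _ = I (fun t => g t - g t * hv (t - y))); first by rewrite IB // Ig H subr0.
apply: eq_I => t; rewrite patchE; have [ty|ty] := lerP t y.
  by rewrite mem_set ?hv_neg ?subr_le0 ?mulr0 ?subr0 //= in_itv.
rewrite memNset ?hv_pos ?subr_gt0 ?mulr1 ?subrr //= in_itv /=; apply/negP; by rewrite -ltNge.
Qed.

Lemma measurable_expabs c : measurable_fun setT (fun t : R => expR (- (c * `|t|))).
Proof.
apply: continuous_measurable_fun => t.
apply: (@continuous_comp _ _ _ (fun t : R => - (c * `|t|)) (@expR R)); last exact: continuous_expR.
apply: (@cvgN R R^o); apply: (@cvgM R); first exact: cvg_cst.
exact: (@norm_continuous _ R^o).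
Qed.

Lemma expabs_le1 c (t : R) : 0 <= c -> 0 <= expR (- (c * `|t|)) <= 1.
Proof. by move=> c0; rewrite expR_ge0 -[leRHS]expR0 ler_expR oppr_le0 mulr_ge0. Qed.

Lemma expabs_norm c (t : R) : 0 <= c -> `|expR (- (c * `|t|))| <= 1.
Proof. by move=> c0; have /andP[a b] := expabs_le1 t c0; rewrite ger0_norm. Qed.

(* With [m] of order [n e^(n y)] these functions tend to the indicator of [|t| > y]. *)
Let h (n m : nat) (t : R) := (1 - expR (- (n%:R * `|t|))) ^+ m.

Let hm n m : measurable_fun setT (h n m).
Proof. by apply: measurable_funX; apply: measurable_funB => //; exact: measurable_expabs. Qed.

Let h01 n m t : 0 <= h n m t <= 1.
Proof.
have /andP[a b] := expabs_le1 t (ler0n R n).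
rewrite exprn_ge0; last lra.
by rewrite exprn_ile1 //; lra.
Qed.

Let h_norm n m t : `|h n m t| <= 1.
Proof. by have /andP[a b] := h01 n m t; rewrite ger0_norm. Qed.

Lemma bernoulli_pow (a : R) m : 0 <= a <= 1 -> 1 - m%:R * a <= (1 - a) ^+ m.
Proof.
move=> /andP[a0 a1]; elim: m => [|m IH]; first by rewrite expr0 mul0r subr0.
rewrite exprSr; apply: (@le_trans _ _ ((1 - m%:R * a) * (1 - a))); last by apply: ler_wpM2r => //; lra.
rewrite -natr1; have : 0 <= m%:R * a * a by rewrite !mulr_ge0.
by move: (m%:R) => c; nra.
Qed.

Lemma pow_expN (a : R) m : 0 <= a <= 1 -> (1 - a) ^+ m <= expR (- (m%:R * a)).
Proof.
move=> /andP[a0 a1]; rewrite -mulrN expRM_natl; apply: lerXn2r.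
- by rewrite nnegrE; lra.
- by rewrite nnegrE expR_ge0.
- exact: expR_ge1Dx.
Qed.

Lemma expR1_cvg0 : (fun n : nat => expR (1 - n%:R)) @ \oo --> (0 : R).
Proof.
have := @expRN_cvg0 R 2^-1 _; rewrite invr_gt0 ltr0n => /(_ isT) H.
rewrite -[X in _ --> X](mulr0 (expR 1)).
rewrite (_ : (fun n => _) = (fun n : nat => expR 1 * expR (- (2 * n%:R * 2^-1)))).
  by apply: (@cvgM R) => //; exact: cvg_cst.
by apply/funext => n; rewrite -expRD; congr (expR (_ - _)); field.
Qed.

Let m_ y n := Num.truncn (n%:R * expR (n%:R * y) : R).

(** With a = e^{-n|t|}, 1 - m a <= (1 - a)^m <= e^{-m a}, and m a behaves like n e^{n (y - |t|)}: it
    tends to 0 for |t| > y and to infinity for |t| <= y. The factor n settles the case |t| = y. *)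
Let h_cvg y t : 0 < y -> (fun n => h n (m_ y n) t) @ \oo --> hv (`|t| - y).
Proof.
move=> y0; have [ty|ty] := lerP `|t| y.
  rewrite hv_neg ?subr_le0 //.
  apply: (@squeeze_cvgr _ _ _ _ (fun _ => 0) (fun n : nat => expR (1 - n%:R))); last 2 first.
  - exact: cvg_cst.
  - exact: expR1_cvg0.
  apply: nearW => n; have /andP[-> _] := h01 n (m_ y n) t; rewrite andTb.
  have a01 := expabs_le1 t (ler0n R n); apply: le_trans (pow_expN _ a01) _.
  rewrite ler_expR; move: a01 => /andP[a0 a1]; set a := expR _ in a0 a1 *.
  have H : n%:R * expR (n%:R * y) < (m_ y n).+1%:R :> R by exact: truncnS_gt.
  have ea : 1 <= expR (n%:R * y) * a.
    by rewrite -expRD -[leLHS]expR0 ler_expR -mulrBr mulr_ge0 // subr_ge0.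
  rewrite -natr1 in H; set M := (m_ y n)%:R in H *.
  have : (n%:R * expR (n%:R * y)) * a <= (M + 1) * a by apply: ler_wpM2r => //; exact: ltW.
  have : n%:R * 1 <= n%:R * (expR (n%:R * y) * a) by apply: ler_wpM2l.
  by rewrite !mulrA mulr1 mulrDl mul1r; move=> ? ?; lra.
rewrite hv_pos ?subr_gt0 //; set d := `|t| - y; have d0 : 0 < d by rewrite subr_gt0.
(* m a is at most n e^{-nd}, and half of the exponent absorbs the factor n. *)
have bd n : 1 - 2 / d * expR (- (2 * n%:R * (d / 4))) <= h n (m_ y n) t <= 1.
  have /andP[_ ->] := h01 n (m_ y n) t; rewrite andbT.
  have a01 := expabs_le1 t (ler0n R n); apply: le_trans (bernoulli_pow _ a01).
  rewrite lerD2l lerN2; move: a01 => /andP[a0 a1]; set a := expR (- (_ * `|t|)) in a0 a1 *.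
  have H : (m_ y n)%:R <= n%:R * expR (n%:R * y) :> R by rewrite truncn_le mulr_ge0 ?expR_ge0.
  apply: (@le_trans _ _ (n%:R * expR (n%:R * y) * a)); first by apply: ler_wpM2r.
  set z := n%:R * d / 2; have z0 : 0 <= z by rewrite !mulr_ge0 ?invr_ge0 // ltW.
  have e1 : expR (n%:R * y) * a = expR (- z) * expR (- z).
    by rewrite -!expRD; congr expR; rewrite /z /d; field.
  have e2 : - (2 * n%:R * (d / 4)) = - z by rewrite /z; field.
  rewrite -mulrA e1 e2 mulrA; apply: ler_wpM2r; first exact: expR_ge0.
  have := expRN_le z0; have E0 := expR_ge0 (- z); set E := expR _ in E0 * => H2.
  have H3 : E * z <= 1 by rewrite mulrDr mulr1 in H2; lra.
  rewrite ler_pdivlMr //; rewrite (_ : n%:R * E * d = 2 * (E * z)); last by rewrite /z; field.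
  lra.
apply: (@squeeze_cvgr _ _ _ _ (fun n : nat => 1 - 2 / d * expR (- (2 * n%:R * (d / 4)))) (fun _ => 1)).
- exact: nearW.
- rewrite -[X in _ --> X]subr0; apply: (@cvgB R R^o); first exact: cvg_cst.
  rewrite -[X in _ --> X](mulr0 (2 / d)); apply: (@cvgM R); first exact: cvg_cst.
  by apply: expRN_cvg0; rewrite divr_gt0.
- exact: cvg_cst.
Qed.

(** The functions [h] are polynomials in e^{-n|t|}, so [w] is orthogonal to them; in the limit all
    tail integrals of [w] vanish. The weight e^{-|t|} in [w] makes the constant term of these
    polynomials correspond to a positive exponent too. *)
Lemma laplace_unique g : L1 g -> (forall t, t <= 0 -> g t = 0) ->
  (forall x, 0 < x -> I (fun t => g t * expR (- (x * `|t|))) = 0) -> {ae mu, forall t, g t = 0}.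
Proof.
move=> Lg sg Hg; pose w t := g t * expR (- (1 * `|t|)).
have Lw : L1 w.
  by apply: (L1M (M := 1)) => //; [exact: measurable_expabs | move=> t; exact: expabs_norm].
have Lwh n m : L1 (fun t => w t * h n m t) by apply: (L1M (M := 1)) => //; exact: hm.
have LwhE n m c : L1 (fun t => w t * h n m t * expR (- (c%:R * `|t|))).
  by apply: (L1M (M := 1)) => //; [exact: measurable_expabs | move=> t; exact: expabs_norm].
have key n m : forall c : nat, I (fun t => w t * h n m t * expR (- (c%:R * `|t|))) = 0.
  elim: m => [|m IH] c.
    rewrite -(Hg (1 + c%:R)); last by rewrite ltr_wpDr.
    by apply: eq_I => t; rewrite /h expr0 mulr1 /w -mulrA -expRD; congr (_ * expR _); ring.
  transitivity (I (fun t => w t * h n m t * expR (- (c%:R * `|t|)) - w t * h n m t * expR (- ((c + n)%:R * `|t|)))).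
    apply: eq_I => t; rewrite /h exprSr natrD.
    have -> : expR (- ((c%:R + n%:R) * `|t|)) = expR (- (c%:R * `|t|)) * expR (- (n%:R * `|t|)).
      by rewrite -expRD; congr expR; ring.
    by move: (expR _) (expR _) => a b; ring.
  by rewrite IB // !IH subr0.
have H0 n m : I (fun t => w t * h n m t) = 0.
  rewrite -[RHS](key n m 0%N); apply: eq_I => t; by rewrite mul0r oppr0 expR0 mulr1.
have w0 : {ae mu, forall t, w t = 0}.
  apply: I_tail_ae0 => //; last first.
    by rewrite -[RHS](H0 0%N 0%N); apply: eq_I => t; rewrite /h expr0 mulr1.
  have pos x : 0 < x -> I (fun t => w t * hv (t - x)) = 0.
    move=> x0; have -> : I (fun t => w t * hv (t - x)) = I (fun t => w t * hv (`|t| - x)).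
      apply: eq_I => t; have [t0|t0] := lerP t 0; first by rewrite /w sg // !mul0r.
      by rewrite gtr0_norm.
    have mf n : measurable_fun setT (fun t => w t * h n (m_ x n) t) by apply: L1_meas; exact: Lwh.
    have mf' : measurable_fun setT (fun t => w t * hv (`|t| - x)).
      apply: measurable_funM; first exact: L1_meas.
      by apply: measurable_hv => //; apply: measurable_funB => //; exact: measurable_normr.
    have cf t : (fun n => w t * h n (m_ x n) t) @ \oo --> w t * hv (`|t| - x).
      by apply: (@cvgM R); [exact: cvg_cst | exact: h_cvg].
    have bf n t : `|w t * h n (m_ x n) t| <= `|w t| by rewrite normrM ler_piMr.
    have := I_dct mf mf' cf (L1norm Lw) bf.
    under eq_fun do rewrite H0.
    move=> /cvg_lim => /(_ (@Rhausdorff R)) <-; exact: lim_cst.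
  move=> x; have [x0|x0] := ltrP 0 x; first exact: pos.
  have := H0 0%N 0%N; rewrite (@eq_I _ _ (fun t => w t * hv (t - x))) // => t.
  rewrite /h expr0 mulr1; have [t0|t0] := lerP t 0; first by rewrite /w sg // !mul0r.
  by rewrite hv_pos ?mulr1 // subr_gt0; exact: le_lt_trans t0.
apply: aeS w0 => t; rewrite /w => /eqP; rewrite mulf_eq0 => /orP[/eqP //|/eqP e].
by have := expR_gt0 (- (1 * `|t|)); rewrite e ltxx.
Qed.

Lemma I_ae_le f g : L1 f -> L1 g -> {ae mu, forall t, f t <= g t} -> I f <= I g.
Proof.
move=> Lf Lg fg; rewrite -subr_ge0 -IB //.
have [Lp] : L1 (fun t => Num.max 0 (g t - f t)) /\ {ae mu, forall t, setT t -> (EFin \o (fun t => g t - f t)) t = (EFin \o (fun t => Num.max 0 (g t - f t))) t}.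
  split; last by apply: aeS fg => t ft _ /=; rewrite max_r // subr_ge0.
  have mgf : measurable_fun setT (fun t => g t - f t) by apply: measurable_funB; exact: L1_meas.
  apply: (@L1_le _ _ (fun t => `|g t - f t|)).
  - by apply: measurable_maxr.
  - move=> t; rewrite ger0_norm ?le_max ?lexx // ge_max normr_ge0 /=; exact: ler_norm.
  - by apply: L1norm; exact: L1B.
move=> e; have -> : I (fun t => g t - f t) = I (fun t => Num.max 0 (g t - f t)).
  congr fine; apply: ae_eq_integral => //.
  - by apply/measurable_EFinP; apply: measurable_funB; exact: L1_meas.
  - by apply/measurable_EFinP; exact: L1_meas.
by apply: I_ge0 => t; rewrite le_max lexx.
Qed.

Lemma I_norm_ae0 f : L1 f -> I (fun t => `|f t|) = 0 -> {ae mu, forall t, f t = 0}.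
Proof.
move=> Lf; have Ln := L1norm Lf; rewrite /I /Rintegral => e.
have e2 : (\int[mu]_(x in setT) `|(EFin \o f) x| = 0)%E.
  have fn : (\int[mu]_(x in setT) `|(EFin \o f) x|)%E \is a fin_num by exact: (integrable_fin_num measurableT Ln).
  by rewrite -(fineK fn); congr EFin; exact: e.
have mf : measurable_fun setT (EFin \o f) by apply/measurable_EFinP; exact: L1_meas.
have /(ae_eq_integral_abs mu measurableT mf) := e2.
by apply: aeS => x /(_ Logic.I) [].
Qed.

End LaplaceUniqueness.


(** * The Jost solution determines the potential *)

Section PotentialUniqueness.
Context {R : realType}.
Local Notation mu := (@lebesgue_measure R).

Lemma cexp_real (x : R) : cexp x%:C%C = (expR x)%:C%C.
Proof. by apply: ceq; rewrite /cexp /= ?cos0 ?sin0 ?mulr1 ?mulr0. Qed.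

Lemma ek_imag (x t : R) : ek (0 +i* x)%C t = (expR (- (2 * x * t)))%:C%C.
Proof. by rewrite /ek -cexp_real; congr cexp; apply: ceq; rewrite !reim; ring. Qed.

(** Gronwall: since T(y, s) = 0 for s <= 0, |p| <= M A almost everywhere with A the primitive of
    |p|, so A e^{-Mt} is nonincreasing from 0. The interval ends at 2 so that the open window
    contains ]0, 1]. *)
Lemma volterra_ae0 (p : R -> R) (T : R * R -> R) (M S : R) : nice p -> measurable_fun setT T ->
  0 <= M -> (forall y s, 0 <= y -> `|T (y, s)| <= M * win S s) ->
  {ae mu, forall t, p t + kconv p T t = 0} -> {ae mu, forall t, p t = 0}.
Proof.
move=> np mT M0 HT H; have [Lp sp] := np.
have Ln := L1norm Lp.
pose A t := I (fun y => `|p y| * win t y).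
have b y t : `|p y * T (y, t - y)| <= M * (`|p y| * win t y).
  have [/andP[y0 y1]|y1] := boolP (0 < y <= 1); last by rewrite (sp _ y1) !mul0r normr0 mul0r mulr0.
  rewrite normrM mulrCA; apply: ler_wpM2l => //; apply: le_trans (HT _ _ (ltW y0)) _; apply: ler_wpM2l => //.
  have [ty|ty] := ltrP y t; first by rewrite (win_in y0 ty) win_le1.
  by rewrite [leLHS]win_out ?win_ge0 // negb_and -leNgt subr_le0 ty.
have Lw t : L1 (fun y => `|p y| * win t y).
  by apply: (L1M (M := 1)) => //; [exact: measurable_win | move=> y; exact: win_norm].
have kb t : `|kconv p T t| <= M * A t.
  rewrite -IZ; last exact: Lw.
  apply: I_abs_le; [|by apply: L1Z; exact: Lw|by move=> y; exact: b].
  apply: (@L1_le _ _ (fun y => M * (`|p y| * win t y))); [|by move=> y; exact: b|by apply: L1Z; exact: Lw].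
  apply: measurable_funM; first exact: L1_meas.
  by apply: (measurableT_comp mT); apply/measurable_fun_pair => //; exact: measurable_funB.
have A0 : A 0 = 0.
  rewrite /A (@eq_I _ _ (fun _ => 0)) ?I0 // => y; rewrite win_out ?mulr0 //.
  by apply/negP => /andP[? ?]; lra.
have acA : ac 2 A (fun t => `|p t|) by split=> [|x _]; [exact: Lw | rewrite A0 add0r].
have acE : ac 2 (fun t => expR (- M * t)) (fun t => - M * expR (- M * t)).
  have d x : is_derive x (1 : R) (fun t => expR (- M * t)) (- M * expR (- M * x)).
    have := @is_deriveZ _ _ _ (fun t : R => t) (- M) x 1 1 (is_derive_id x 1).
    move=> /(@is_derive1_comp _ (@expR R) (fun t : R => - M * t) x _ _ (is_derive_expR _)).
    have -> : - M * expR (- M * x) = expR (- M * x) * (- M)%:A by rewrite /GRing.scale /= mulr1 mulrC.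
    by [].
  apply: ac_C1 => // x; apply: (@cvgM R); first exact: cvg_cst.
  apply: (@continuous_comp _ _ _ (fun t : R => - M * t) (@expR R)); last exact: continuous_expR.
  by apply: (@cvgM R); [exact: cvg_cst | exact: cvg_id].
have [LW /(_ 2)] := ac_mul acA acE; rewrite lexx ler0n => /(_ isT).
rewrite A0 mul0r add0r => e.
have e0 : A 2 * expR (- M * 2) <= 0.
  rewrite e -(@I0 R); apply: I_ae_le => //; first exact: L1_0.
  apply: aeS H => t /eqP; rewrite addr_eq0 => /eqP pt.
  have := kb t; have := expR_gt0 (- M * t); rewrite -normrN -pt; move: (expR _) => E E0 HE.
  rewrite mulr_le0_ge0 ?win_ge0 //.
  have -> : `|p t| * E + A t * (- M * E) = E * (`|p t| - M * A t) by ring.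
  by rewrite mulr_ge0_le0 ?subr_le0 // ltW.
have A2 : A 2 = I (fun t => `|p t|).
  apply: eq_I => y; have [/andP[y0 y1]|y1] := boolP (0 < y <= 1); last by rewrite (sp _ y1) normr0 mul0r.
  rewrite win_in ?mulr1 //; apply: le_lt_trans y1 _; by rewrite ltr1n.
apply: I_norm_ae0 => //; apply/eqP; rewrite eq_le I_ge0 // andbT -A2.
by move: e0; rewrite pmulr_lle0 // expR_gt0.
Qed.

Variables (Q1 Q2 : R -> R) (B1 B2 : R * R -> R).
Hypotheses (nQ1 : nice Q1) (nQ2 : nice Q2) (kB1 : is_kernel Q1 B1) (kB2 : is_kernel Q2 B2).

Let mB1 : measurable_fun setT B1. Proof. by case: kB1. Qed.
Let mB2 : measurable_fun setT B2. Proof. by case: kB2. Qed.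

Let C x t := kconv (fun y => B1 (x, y)) (fun p => B2 (x, p.2)) t.

(* [1 + Lap (T x)] is the product of the two Jost factors. *)
Let T (p : R * R) := B1 p + B2 p + C p.1 p.2.

Let mT : measurable_fun setT T.
Proof.
apply: measurable_funD; first exact: measurable_funD.
apply: (@measurable_I _ _ _ (fun z : (R * R) * R => B1 (z.1.1, z.2) * B2 (z.1.1, z.1.2 - z.2))).
have m1 : measurable_fun setT (fun z : (R * R) * R => z.1.1).
  by apply: (measurableT_comp measurable_fst); exact: measurable_fst.
have m2 : measurable_fun setT (fun z : (R * R) * R => z.1.2).
  by apply: (measurableT_comp measurable_snd); exact: measurable_fst.
have m3 : measurable_fun setT (fun z : (R * R) * R => z.2) by exact: measurable_snd.
apply: measurable_funM.
  by apply: (measurableT_comp mB1); apply/measurable_fun_pair.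
by apply: (measurableT_comp mB2); apply/measurable_fun_pair => //; exact: measurable_funB.
Qed.

Let win_mono (a b t : R) : a <= b -> win a t <= win b t.
Proof.
move=> ab; have [/andP[t0 t1]|t1] := boolP ((0 < t) && (t < a)); last by rewrite [leLHS]win_out ?win_ge0.
by rewrite !win_in //; exact: lt_le_trans ab.
Qed.

Let T_bound : exists2 M, 0 <= M & forall x s, 0 <= x -> `|T (x, s)| <= M * win 2 s.
Proof.
have [M1 M10 H1] := kernel_bound kB1; have [M2 M20 H2] := kernel_bound kB2.
have J0 : 0 <= I (win (1 : R)) by apply: I_ge0 => t; exact: win_ge0.
exists (M1 + M2 + M1 * M2 * I (win 1)); first by rewrite !addr_ge0 ?mulr_ge0.
move=> x s x0; apply: le_trans (ler_normD _ _) _; rewrite [leRHS]mulrDl; apply: lerD.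
  apply: le_trans (ler_normD _ _) _; rewrite mulrDl; apply: lerD.
    by apply: le_trans (H1 x s x0) _; apply: ler_wpM2l => //; apply: win_mono; rewrite ler1n.
  by apply: le_trans (H2 x s x0) _; apply: ler_wpM2l => //; apply: win_mono; rewrite ler1n.
have mT' : measurable_fun setT (fun p : R * R => B2 (x, p.2)).
  by apply: (measurableT_comp mB2); apply/measurable_fun_pair => //; exact: measurable_snd.
have [_ sC _ _] := kconvP 0 (nice_kernel kB1 x0) mT' M20 ler01 (fun y s _ => H2 x s x0).
have [/andP[s0 s2]|s2] := boolP ((0 < s) && (s < 2)); last first.
  rewrite [C _ _](_ : _ = 0) ?normr0 ?mulr_ge0 ?win_ge0 //; exact: sC.
rewrite (win_in s0 s2) mulr1 -IZ; last exact: L1_win.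
have bb y : `|B1 (x, y) * B2 (x, s - y)| <= M1 * M2 * win 1 y.
  rewrite normrM mulrAC; apply: ler_pM => //; first exact: H1.
  by apply: le_trans (H2 x (s - y) x0) _; rewrite ler_piMr ?win_le1.
apply: I_abs_le; [|by apply: L1Z; exact: L1_win|exact: bb].
apply: L1_le bb _; last by apply: L1Z; exact: L1_win.
apply: measurable_funM; first by apply: (measurableT_comp mB1); exact: measurable_pair1.
by apply: (measurableT_comp mB2); apply/measurable_fun_pair => //; exact: measurable_funB.
Qed.

Let Lap_T k x : 0 <= x -> 1 + cI (fun s => (T (x, s))%:C%C * ek k s) = jv B1 x k * jv B2 x k.
Proof.
move=> x0; have [M2 M20 H2] := kernel_bound kB2.
have mT' : measurable_fun setT (fun p : R * R => B2 (x, p.2)).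
  by apply: (measurableT_comp mB2); apply/measurable_fun_pair => //; exact: measurable_snd.
have n1 := nice_kernel kB1 x0; have n2 := nice_kernel kB2 x0.
have [LC sC _ E] := kconvP k n1 mT' M20 ler01 (fun y s _ => H2 x s x0).
have L1' := cL1_Lap k n1; have L2' := cL1_Lap k n2.
have LCk : cL1 (fun t => (C x t)%:C%C * ek k t).
  apply: (@cL1_le _ _ (fun t => expR (2 * nC k * 2) * `|C x t|)).
  - by apply: cmeasM; [apply: cmeas_real; exact: (L1_meas LC) | exact: cmeas_ek].
  - move=> t; rewrite normcM normcC mulrC.
    have [/andP[t0 t2]|t2] := boolP ((0 < t) && (t < 1 + 1)); last by rewrite [C x t](sC _ t2) normr0 !mulr0.
    apply: ler_wpM2r => //; rewrite ek_norm ler_expR.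
    have := normc_Im k; rewrite ler_norml => /andP[b _]; have := normc_ge0 k => n0.
    apply: (@le_trans _ _ (2 * nC k * t)); last by apply: ler_wpM2l; [rewrite mulr_ge0 | lra].
    by rewrite -mulNr; apply: ler_wpM2r; [exact: ltW | lra].
  - by apply: L1Z; apply: L1norm; exact: LC.
have E2 : cI (fun t => (C x t)%:C%C * ek k t) = Lap (fun s => B2 (x, s)) k * Lap (fun s => B1 (x, s)) k.
  rewrite E -(cIZ _ L1'); apply: eq_cI => y.
  by rewrite -/(Lap (fun s => B2 (x, s)) k) mulrA mulrC.
rewrite (eq_cI (g := fun s => ((B1 (x, s))%:C%C * ek k s + (B2 (x, s))%:C%C * ek k s) + (C x s)%:C%C * ek k s)); last first.
  by move=> s; rewrite /T !rCD !mulrDl.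
rewrite (cID (cL1D L1' L2') LCk) (cID L1' L2') E2 /jv -/(Lap (fun s => B1 (x, s)) k) -/(Lap (fun s => B2 (x, s)) k).
by move: (Lap (fun s => B1 (x, s)) k) (Lap (fun s => B2 (x, s)) k) => a b; ring.
Qed.

Theorem jost_unique : (forall x : R, 0 < x -> jF B1 (0 +i* x)%C = jF B2 (0 +i* x)%C /\
    Fder (jF B1) (jY Q1 B1) (0 +i* x)%C = Fder (jF B2) (jY Q2 B2) (0 +i* x)%C) ->
  {ae mu, forall t, Q1 t = Q2 t}.
Proof.
move=> FF; have [[LQ1 sQ1] [LQ2 sQ2]] := (nQ1, nQ2).
pose p t := Q2 t - Q1 t.
have np : nice p by split; [exact: L1B | move=> t t1; rewrite /p sQ1 ?sQ2 ?subrr].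
have [M M0 HM] := T_bound; have S0 : 0 <= (2 : R) by [].
have [Lk sk _ _] := kconvP 0 np mT M0 S0 HM.
suff H : {ae mu, forall t, p t + kconv p T t = 0}.
  by apply: aeS (volterra_ae0 np mT M0 HM H) => t /subr0_eq.
have p0 t : t <= 0 -> p t + kconv p T t = 0.
  move=> t0; rewrite (proj2 np) ?sk ?addr0 //; apply/negP => /andP[]; lra.
apply: laplace_unique => //; first by apply: L1D => //; case: np.
(* At k = i x / 2 the exponential e^{2ikt} is e^{-xt}. *)
move=> x x0; pose k : R[i] := (0 +i* (x / 2))%C.
have k0 : k != 0 by rewrite -normc_gt0 normc_gt0; apply/eqP => /(congr1 (@complex.Im R)) /= ?; lra.
have x2 : 2 * (x / 2) = x by field.
have kI : 0 <= Im k by rewrite /k /= divr_ge0 // ltW.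
have [_ _ _ Ek] := kconvP k np mT M0 S0 HM.
have [F0 D0] : jF B1 k = jF B2 k /\ Fder (jF B1) (jY Q1 B1) k = Fder (jF B2) (jY Q2 B2) k.
  by apply: FF; rewrite divr_gt0.
have H1 := cac_jf nQ1 kB1 k0 S0; have H2 := cac_jf nQ2 kB2 k0 S0.
have K1 := cac_jd nQ1 kB1 k0 S0; have K2 := cac_jd nQ2 kB2 k0 S0.
(* The Wronskian f1 f2' - f1' f2 has derivative (Q2 - Q1) f1 f2. It vanishes at 0 by hypothesis, and
   at 2 because both solutions are e^{ikx} beyond 1. *)
have HW := cacD (cac_mul H1 K2) (cacN (cac_mul K1 H2)).
have := cacE HW (x := 2); rewrite lexx S0 => /(_ isT).
have i12 : 1 <= (2 : R) by rewrite ler1n.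
rewrite !jf0 (jd0 nQ1 kB1 k0) (jd0 nQ2 kB2 k0) F0 D0 (jf1 kB1 k i12) (jf1 kB2 k i12) (jd1 B1 nQ1 k i12) (jd1 B2 nQ2 k i12).
have cc (a b : R[i]) : a * b - b * a = 0 by rewrite mulrC subrr.
rewrite !cc add0r.
set G := fun t => (p t)%:C%C * ek k t + (p t)%:C%C * (ek k t * cI (fun s => (T (t, s))%:C%C * ek k s)).
have GE t : (win 2 t)%:C%C * (jd Q1 B1 k t * jd Q2 B2 k t + jf B1 k t * (((Q2 t)%:C%C - k ^+ 2) * jf B2 k t) -
    ((((Q1 t)%:C%C - k ^+ 2) * jf B1 k t) * jf B2 k t + jd Q1 B1 k t * jd Q2 B2 k t)) = G t.
  transitivity ((win 2 t * p t)%:C%C * (jf B1 k t * jf B2 k t)).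
    rewrite rCM /p rCD rCN; move: (jf B1 k t) (jf B2 k t) (jd Q1 B1 k t) (jd Q2 B2 k t) (Q1 t)%:C%C (Q2 t)%:C%C (win 2 t)%:C%C.
    by move=> a b c d e f g; ring.
  have [/andP[t0 t1]|t1] := boolP (0 < t <= 1); last first.
    by rewrite /G (proj2 np t t1) mulr0 rC0 !mul0r addr0.
  have t2 : t < 2 by apply: le_lt_trans t1 _; rewrite ltr1n.
  rewrite (win_in t0 t2) mul1r /G -mulrDr -[X in X + _]mulr1 -mulrDr (Lap_T k (ltW t0)) /jf ek_cexp.
  by move: (cexp _) (jv _ _ _) (jv _ _ _) => a b c; ring.
have LG : cL1 G by apply: eq_cL1 (cac_L1 HW) => t; exact: GE.
rewrite (eq_cI GE) => G0.
have Lpk := cL1_Lap k np.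
have L3 : cL1 (fun t => (p t)%:C%C * (ek k t * cI (fun s => (T (t, s))%:C%C * ek k s))).
  by apply: eq_cL1 (cL1B LG Lpk) => t; rewrite /G addrAC subrr add0r.
have mk : cL1 (fun t => (kconv p T t)%:C%C * ek k t).
  apply: (@cL1_le _ _ (fun t => 1 * `|kconv p T t|)).
  - by apply: cmeasM; [apply: cmeas_real; exact: (L1_meas Lk) | exact: cmeas_ek].
  - move=> t; rewrite normcM normcC mulrC.
    have [/andP[t0 t2]|t2] := boolP ((0 < t) && (t < 1 + 2)); last by rewrite (sk _ t2) normr0 !mulr0.
    by apply: (ler_wpM2r (normr_ge0 _)); exact: (ek_le1 kI (ltW t0)).
  - by apply: L1Z; exact: L1norm.
move: G0; rewrite /G (cID Lpk L3) -Ek -(cID Lpk mk) => G0.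
have {}G0 : cI (fun t => ((p t + kconv p T t) * expR (- (x * `|t|)))%:C%C) = 0.
  rewrite [RHS]G0; apply: eq_cI => t; rewrite -mulrDl -rCD ek_imag -rCM x2.
  have [t0|t0] := ltrP 0 t; first by rewrite (gtr0_norm t0); reflexivity.
  by rewrite (p0 t t0) !mul0r; reflexivity.
move: G0; rewrite cI_real => /(congr1 (@complex.Re R)) G0; exact: G0.
Qed.

End PotentialUniqueness.


(** * Smooth functions and mollifiers *)

Section SmoothFunctions.
Context {R : realType}.
Local Notation mu := (@lebesgue_measure R).
Implicit Types (f g : R -> R) (p r : {poly R}).

Lemma derD f g x (a b : R) : is_derive x (1 : R) f a -> is_derive x (1 : R) g b ->
  is_derive x (1 : R) (fun y => f y + g y) (a + b).
Proof. by move=> df dg; exact: is_deriveD. Qed.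

Lemma derM f g x (a b : R) : is_derive x (1 : R) f a -> is_derive x (1 : R) g b ->
  is_derive x (1 : R) (fun y => f y * g y) (a * g x + f x * b).
Proof.
move=> df dg; rewrite (_ : _ + _ = f x * b + g x * a); last by ring.
exact: is_deriveM.
Qed.

Lemma der_affine (a b x : R) : is_derive x (1 : R) (fun t => a * t + b) a.
Proof.
apply: is_derive_quad; exists 0, 1; split=> // h _.
by rewrite mul0r (_ : _ - _ - _ = 0) ?normr0 //; ring.
Qed.

Lemma der_comp_affine f (a b c x d : R) : is_derive (a * x + b) (1 : R) f d ->
  is_derive x (1 : R) (fun t => c * f (a * t + b)) (c * a * d).
Proof.
move=> df; have H := @is_derive1_comp _ f (fun t => a * t + b) x _ _ df (der_affine a b x).
have := derM (is_derive_cst c x (1 : R)) H; rewrite /= mul0r add0r => K.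
by rewrite (_ : c * a * d = c * (d * a)); [exact: K | ring].
Qed.

(** For i > 0, y^i = i^i (y / i)^i <= i^i e^y, from y / i <= e^{y / i}; the sum adds these bounds
    coefficient by coefficient. *)
Lemma poly_exp_bound p : exists C : R, forall y, 0 <= y -> `|p.[y]| * expR (- y) <= C.
Proof.
exists (\sum_(i < size p) `|p`_i| * i%:R ^+ i) => y y0.
rewrite horner_coef; apply: (@le_trans _ _ ((\sum_(i < size p) `|p`_i * y ^+ i|) * expR (- y))).
  by apply: ler_wpM2r; [exact: expR_ge0 | exact: ler_norm_sum].
rewrite mulr_suml; apply: ler_sum => i _; rewrite normrM -mulrA; apply: ler_wpM2l => //.
rewrite ger0_norm ?exprn_ge0 // expRN ler_pdivrMr ?expR_gt0 //.
have [-> | i0] := posnP (i : nat); first by rewrite !expr0 mul1r -[leLHS]expR0 ler_expR.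
have -> : y = i%:R * (y / i%:R) by field; rewrite pnatr_eq0 -lt0n.
rewrite expRM_natl -exprMn; apply: lerXn2r; rewrite ?nnegrE ?mulr_ge0 ?expR_ge0 ?divr_ge0 //.
apply: ler_wpM2l => //; apply: le_trans (expR_ge1Dx _); lra.
Qed.

(* The functions [p (1 / x) exp (- 1 / x)] extended by [0] are closed under derivation. *)
Definition ef p (x : R) := if 0 < x then p.[x^-1] * expR (- x^-1) else 0.

Definition efd p : {poly R} := 'X^2 * (p - p^`()).

Lemma ef_derive p x : is_derive x (1 : R) (ef p) (ef (efd p) x).
Proof.
have [x0|x0|e1] := ltgtP 0 x; last rewrite -{x}e1.
- have e : is_derive x (1 : R) (fun y => p.[y^-1] * expR (- y^-1)) (ef (efd p) x).
    have dV : is_derive x (1 : R) (fun y : R => y^-1) (- x ^- 2).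
      have := @is_deriveV _ (fun y : R => y) x 1 1 (lt0r_neq0 x0) (is_derive_id x 1).
      by rewrite /GRing.scale /= mulr1.
    have dp := @is_derive1_comp _ (fun y => p.[y]) (fun y => y^-1) x _ _ (is_derive_poly p x^-1) dV.
    have dN : is_derive x (1 : R) (fun y : R => - y^-1) (- - x ^- 2) by exact: is_deriveN.
    have de := @is_derive1_comp _ (@expR R) (fun y => - y^-1) x _ _ (is_derive_expR _) dN.
    have := derM dp de; rewrite /comp /=; move=> H.
    rewrite /ef x0 /efd (_ : (_ * _).[_] * _ = p^`().[x^-1] * - x ^- 2 * expR (- x^-1) + p.[x^-1] * (expR (- x^-1) * - - x ^- 2)) //.
    rewrite hornerM hornerXn hornerD hornerN -exprVn; move: (horner p x^-1) (horner (deriv p) x^-1) (expR (- x^-1)) (x^-1 ^+ 2) => a b c d; ring.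
  apply: near_eq_is_derive e; near=> y; rewrite /ef.
  by have -> : 0 < y by near: y; exact: lt_nbhsr.
- have -> : ef (efd p) x = 0 by rewrite /ef ltNge (ltW x0).
  have D : is_derive x (1 : R) (fun _ : R => (0 : R)) 0 := is_derive_cst (0 : R) x (1 : R).
  apply: near_eq_is_derive D.
  near=> y; rewrite /ef; have yx : y < 0 by near: y; exact: lt_nbhsl.
  by rewrite ltNge (ltW yx).
- have [C HC] := poly_exp_bound ('X^2 * p).
  have e0 r : ef r 0 = 0 by rewrite /ef ltxx.
  rewrite e0; apply: is_derive_quad; exists `|C|, 1; split=> // h _.
  rewrite add0r e0 mul0r !subr0 /ef; case: ifPn => h0; last by rewrite normr0 mulr_ge0 ?sqr_ge0.
  have hV : 0 <= h^-1 by rewrite invr_ge0 ltW.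
  have := HC h^-1 hV; rewrite hornerM hornerXn normrM (ger0_norm (exprn_ge0 2 hV)) => H.
  rewrite normrM (ger0_norm (expR_ge0 _)).
  have -> : `|p.[h^-1]| * expR (- h^-1) = (h^-1 ^+ 2 * `|p.[h^-1]| * expR (- h^-1)) * h ^+ 2 by field; rewrite lt0r_neq0.
  by apply: ler_wpM2r; [exact: sqr_ge0 | apply: le_trans H (ler_norm _)].
Unshelve. all: by end_near. Qed.

(** A class closed under derivation clause by clause, so that iterated derivatives need no separate
    study. The clause on primitives admits the double antiderivative of a bump. *)
Inductive smooth : (R -> R) -> Prop :=
| smooth_bump p r : smooth (fun x => ef p (x + 1) * ef r (- x + 1))
| smooth_add f g : smooth f -> smooth g -> smooth (fun x => f x + g x)
| smooth_affine f (a b c : R) : smooth f -> smooth (fun x => c * f (a * x + b))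
| smooth_primitive f g : (forall x, is_derive x (1 : R) f (g x)) -> smooth g -> smooth f.

Lemma smooth_derive f : smooth f -> exists2 g, smooth g & forall x, is_derive x (1 : R) f (g x).
Proof.
elim=> {f} [p r|f g sf [f' sf' df] sg [g' sg' dg]|f a b c sf [f' sf' df]|f g df sg _].
- exists (fun x => ef (efd p) (x + 1) * ef r (- x + 1) + ef p (x + 1) * ef (- efd r) (- x + 1)).
    by apply: smooth_add; exact: smooth_bump.
  move=> x.
  have H1 : is_derive x (1 : R) (fun t => ef p (t + 1)) (ef (efd p) (x + 1)).
    have D : is_derive (1 * x + 1) (1 : R) (ef p) (ef (efd p) (1 * x + 1)) by exact: ef_derive.
    have := @der_comp_affine (ef p) 1 1 1 x _ D; rewrite !mul1r.
    by rewrite (_ : (fun t => _) = fun t => ef p (t + 1)) //; apply/funext => t; rewrite !mul1r.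
  have H2 : is_derive x (1 : R) (fun t => ef r (- t + 1)) (ef (- efd r) (- x + 1)).
    have D : is_derive (-1 * x + 1) (1 : R) (ef r) (ef (efd r) (-1 * x + 1)) by exact: ef_derive.
    have := @der_comp_affine (ef r) (-1) 1 1 x _ D; rewrite !mul1r !mulN1r.
    rewrite (_ : - ef _ _ = ef (- efd r) (- x + 1)); last by rewrite /ef; case: ifP => _; rewrite ?oppr0 // hornerN mulNr.
    by rewrite (_ : (fun t => _) = fun t => ef r (- t + 1)) //; apply/funext => t; rewrite mul1r mulN1r.
  exact: derM H1 H2.
- by exists (fun x => f' x + g' x); [exact: smooth_add | move=> x; exact: derD].
- exists (fun x => c * a * f' (a * x + b)); first exact: smooth_affine.
  by move=> x; apply: der_comp_affine.
- by exists g.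
Qed.

Lemma smooth_derivable f : smooth f -> forall n x, derivable (derive1n n f) x 1.
Proof.
move=> sf n; elim: n f sf => [|n IH] f sf x; have [g sg dg] := smooth_derive sf.
  by have [] := dg x.
rewrite derive1Sn (_ : derive1 f = g); first exact: IH.
by apply/funext => y; rewrite derive1E; have [_ ->] := dg y.
Qed.

Lemma der_continuous f g : (forall x, is_derive x (1 : R) f (g x)) -> continuous f.
Proof.
by move=> df x; apply: differentiable_continuous; apply/derivable1_diffP; have [] := df x.
Qed.

Lemma smooth_continuous f : smooth f -> continuous f.
Proof. by move=> /smooth_derive[g _]; exact: der_continuous. Qed.

Lemma mvt f g (a b : R) : (forall x, is_derive x (1 : R) f (g x)) -> a < b ->
  exists c, [/\ a < c, c < b & f b - f a = g c * (b - a)].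
Proof.
move=> df ab; have [] := @MVT _ f g a b ab (fun x _ => df x).
  by apply: continuous_subspaceT; exact: der_continuous df.
by move=> c; rewrite in_itv /= => /andP[? ?]; exists c.
Qed.

Lemma integrable_itvE f (i : interval R) :
  mu.-integrable [set` i] (EFin \o f) <-> L1 (f \_ [set` i]).
Proof.
have mI : measurable ([set` i] : set (measurableTypeR R)) by exact: measurable_itv.
by rewrite /L1 -restrict_EFin; exact: (@integrable_mkcond _ _ R mu _ (EFin \o f) mI).
Qed.

Lemma L1_continuous_compact f (a b : R) : continuous f -> (forall x, ~~ (a <= x <= b) -> f x = 0) -> L1 f.
Proof.
move=> cf f0; have H : mu.-integrable `[a, b] (EFin \o f).
  apply: continuous_compact_integrable; first exact: segment_compact.
  exact: continuous_subspaceT.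
move/integrable_itvE : H; apply: eq_L1 => x.
rewrite patchE; case: ifPn => // xab; rewrite f0 //.
by apply: contra xab => xab; rewrite mem_setE /= in_itv.
Qed.

Lemma primitive_exists g (a : R) : continuous g -> (forall x, x <= a -> g x = 0) ->
  exists G, (forall x, is_derive x (1 : R) G (g x)) /\ (forall x, x <= a -> G x = 0).
Proof.
move=> cg g0; exists (fun x => \int[mu]_(t in `]-oo, x]) g t); split; last first.
  move=> x xa; rewrite Rintegral_mkcond (_ : (fun _ => _) = fun _ => 0); first exact: I0.
  apply/funext => t; rewrite patchE; case: ifPn => //; rewrite mem_setE /= in_itv /= => tx.
  by rewrite g0 // (le_trans tx).
move=> x; have x1 : x < x + 1 by rewrite ltrDl.
have ig : mu.-integrable [set` Interval -oo%O (BRight (x + 1))] (EFin \o g).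
  apply/integrable_itvE; apply: (@L1_le _ _ (fun t => `|(g \_ `[a, (x + 1)]) t|)).
  - by apply/(measurable_restrictT _ _).1 => //; apply: measurable_funTS; exact: continuous_measurable_fun.
  - move=> t; rewrite !patchE !mem_setE /= !in_itv /=; have [ta|ta] := leP a t; first by [].
    by rewrite (g0 t (ltW ta)); case: ifP; rewrite normr0.
  - apply: L1norm; apply/integrable_itvE.
    apply: continuous_compact_integrable; first exact: segment_compact.
    exact: continuous_subspaceT.
have [D E] := continuous_FTC1 x1 ig (ltNyr _) (cg x).
by rewrite derive1E in E; exact: (DeriveDef D E).
Qed.

(** [S] is a smooth version of c max(x, 0): [S2] is a bump carried by [-1, 1], [S1] and [S] are its
    successive primitives from the left. The mass c of the bump is left unnormalised. *)
Record mollifier (S S1 S2 : R -> R) (c K : R) : Prop := Mollifier {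
  mol_smooth : smooth S;
  mol_der1 : forall x, is_derive x (1 : R) S (S1 x);
  mol_der2 : forall x, is_derive x (1 : R) S1 (S2 x);
  mol_cont : continuous S2;
  mol_ge0 : forall x, 0 <= S2 x;
  mol_supp : forall x, 1 <= `|x| -> S2 x = 0;
  mol_c : 0 < c;
  mol_S1l : forall x, x <= -1 -> S1 x = 0;
  mol_S1r : forall x, 1 <= x -> S1 x = c;
  mol_l : forall x, x <= -1 -> S x = 0;
  mol_r : forall x, 1 <= x -> S x = S 1 + c * (x - 1);
  mol_K : forall x, `|S x - c * ((x + `|x|) / 2)| <= K }.

Lemma mollifier_exists : exists S S1 S2 c K, mollifier S S1 S2 c K.
Proof.
pose S2 (x : R) := ef 1 (x + 1) * ef 1 (- x + 1).
have sS2 : smooth S2 by exact: smooth_bump.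
have cS2 := smooth_continuous sS2.
have ef_ge0 y : 0 <= ef 1 y by rewrite /ef; case: ifP => // _; rewrite hornerC mul1r expR_ge0.
have ef_gt0 y : 0 < y -> 0 < ef 1 y by rewrite /ef => ->; rewrite hornerC mul1r expR_gt0.
have ef_neg y : y <= 0 -> ef 1 y = 0 by rewrite /ef leNgt => /negbTE ->.
have S20 x : 0 <= S2 x by exact: mulr_ge0.
have S2s x : 1 <= `|x| -> S2 x = 0.
  by rewrite /S2 ler_normr => /orP[x1|x1]; [rewrite mulrC|]; rewrite ef_neg ?mul0r //; lra.
have S2l x : x <= -1 -> S2 x = 0 by move=> x1; rewrite S2s // ler_normr; apply/orP; right; lra.
have [S1 [d1 l1]] := primitive_exists cS2 S2l.
have cS1 : continuous S1 by exact: der_continuous d1.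
have [S [d0 l0]] := primitive_exists cS1 l1.
have mono x y : x <= y -> S1 x <= S1 y.
  rewrite le_eqVlt => /orP[/eqP->//|xy]; have [c [_ _ e]] := mvt d1 xy.
  by rewrite -subr_ge0 e mulr_ge0 // subr_ge0 ltW.
have r1 x : 1 <= x -> S1 x = S1 1.
  rewrite le_eqVlt => /orP[/eqP<-//|x1]; have [c [c1 _ e]] := mvt d1 x1.
  by apply/eqP; rewrite -subr_eq0 e S2s ?mul0r // ler_normr (ltW c1).
have c0 : 0 < S1 1.
  have h : (-2^-1 : R) < 2^-1 by lra.
  have [c [c1 c2 e]] := mvt d1 h.
  have a1 : S1 (-1) <= S1 (-2^-1) by apply: mono; lra.
  have a2 : S1 2^-1 <= S1 1 by apply: mono; lra.
  have a3 : 0 < S2 c by apply: mulr_gt0; apply: ef_gt0; lra.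
  have a4 : S1 (-1) = 0 by exact: l1.
  have : 0 < S2 c * (2^-1 - - 2^-1) by rewrite mulr_gt0 // subr_gt0.
  by rewrite -e; lra.
have rS x : 1 <= x -> S x = S 1 + S1 1 * (x - 1).
  rewrite le_eqVlt => /orP[/eqP<-|x1]; first by rewrite subrr mulr0 addr0.
  by have [c [c1 _ e]] := mvt d0 x1; rewrite -(r1 c (ltW c1)) -e addrC subrK.
have mid x : -1 <= x -> x <= 1 -> 0 <= S x <= 2 * S1 1.
  rewrite le_eqVlt => /orP[/eqP<- _|x1 xx]; first by rewrite l0 // lexx mulr_ge0 // ltW.
  have [c [c1 c2 e]] := mvt d0 x1; move: e; rewrite (l0 (-1)) // subr0 => ->.
  have b1 : 0 <= S1 c by rewrite -(l1 (-1)) //; apply: mono; exact: ltW.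
  have b2 : S1 c <= S1 1 by apply: mono; lra.
  rewrite mulr_ge0 //=; last lra.
  by rewrite mulrC; apply: ler_pM => //; lra.
(* On [-1, 1] [S] lies between 0 and 2 c and c max(x, 0) between 0 and c, so 3 c is a safe bound. *)
exists S, S1, S2, (S1 1), (3 * S1 1); split => //.
  by apply: smooth_primitive d0 _; exact: smooth_primitive d1 _.
move=> x; have [x1|x1] := lerP x (-1).
  rewrite l0 // (@ler0_norm _ x); last lra.
  by rewrite subrr mul0r mulr0 subr0 normr0 mulr_ge0 // ltW.
have [x2|x2] := lerP x 1; last first.
  have := mid 1; rewrite lexx => /(_ _ isT) => /(_ ltac:(lra)) /andP[m1 m2].
  rewrite rS ?(ltW x2) // (@gtr0_norm _ x); last lra.
  have -> : S 1 + S1 1 * (x - 1) - S1 1 * ((x + x) / 2) = S 1 - S1 1 by field.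
  rewrite ler_norml; apply/andP; split; lra.
have /andP[m1 m2] := mid x (ltW x1) x2.
have [x0|x0] := lerP 0 x.
  rewrite (ger0_norm x0) (_ : (x + x) / 2 = x); last by field.
  have : 0 <= S1 1 * x by rewrite mulr_ge0 // ltW.
  have : S1 1 * x <= S1 1 * 1 by apply: ler_wpM2l => //; exact: ltW.
  by rewrite mulr1 => ? ?; rewrite ler_norml; apply/andP; split; lra.
by rewrite (ltr0_norm x0) subrr mul0r mulr0 subr0 ger0_norm //; lra.
Qed.

End SmoothFunctions.


(** * Weak solutions on an interval *)

Section DuBoisReymond.
Context {R : realType}.
Local Notation mu := (@lebesgue_measure R).
Variables (v w : R -> R) (s A : R).
Hypotheses (A0 : 0 < A) (cv : continuous v) (Lw : L1 w) (sw : forall y, A <= `|y| -> w y = 0).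
(** The distributional form of v'' = w - s delta on ]-A, A[. *)
Hypothesis weak : forall f f1 f2 : R -> R, smooth f -> (forall x, is_derive x (1 : R) f (f1 x)) ->
  (forall x, is_derive x (1 : R) f1 (f2 x)) -> (forall y, A <= `|y| -> f y = 0) ->
  I (fun y => v y * f2 y) = I (fun y => w y * f y) - s * f 0.

Lemma small0 (X M : R) : 0 <= X -> (forall d, 0 < d -> X <= d * M) -> X = 0.
Proof.
move=> X0 H; apply/eqP; rewrite eq_le X0 andbT leNgt; apply/negP => X1.
have M1 : 0 < `|M| + 1 by rewrite ltr_wpDl.
have := H (X / 2 / (`|M| + 1)) _; rewrite !divr_gt0 // => /(_ isT).
have : X / 2 / (`|M| + 1) * M <= X / 2.
  rewrite mulrAC ler_pdivrMr // ler_pM2l ?divr_gt0 //; have := ler_norm M; lra.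
lra.
Qed.

Lemma I_lin3 (a b c : R) f g h : L1 f -> L1 g -> L1 h ->
  I (fun y => a * f y + (b * g y + c * h y)) = a * I f + (b * I g + c * I h).
Proof.
move=> Lf Lg Lh; rewrite ID; [|exact: L1Z|by apply: L1D; exact: L1Z].
by rewrite ID ?IZ //; exact: L1Z.
Qed.

Lemma bounded_on (g : R -> R) : continuous g -> exists M : R, forall y, `|y| <= A -> `|g y| <= M.
Proof.
move=> cg; have AA : - A <= A by rewrite ge0_cp // ltW.
have cn : {within `[- A, A], continuous (fun y => `|g y|)}.
  apply: continuous_subspaceT => x; apply: (@continuous_comp _ _ _ g (fun y : R => `|y|)); first exact: cg.
  exact: (@norm_continuous _ R^o).
have [c _ H] := EVT_max AA cn.
by exists (`|g c|) => y yA; apply: H; rewrite in_itv /= -ler_norml.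
Qed.

Lemma L1_w (g : R -> R) : continuous g -> L1 (fun y => w y * g y).
Proof.
move=> cg; have [M HM] := bounded_on cg.
apply: (@L1_le _ _ (fun y => M * `|w y|)).
- by apply: measurable_funM; [exact: L1_meas | exact: continuous_measurable_fun].
- move=> y; rewrite normrM mulrC; have [yA|yA] := leP `|y| A; first by apply: ler_wpM2r => //; exact: HM.
  by rewrite (sw (ltW yA)) normr0 !mulr0.
- by apply: L1Z; exact: L1norm.
Qed.

(** The positive part, a fundamental solution of the second derivative. *)
Let ps (t : R) := (t + `|t|) / 2.

Let ps_continuous z : continuous (fun y => ps (y - z)).
Proof.
have c1 : continuous (fun t : R => t - z) by move=> t; apply: (@cvgB R R^o); [exact: cvg_id | exact: cvg_cst].
move=> y; apply: (@cvgM R); last exact: cvg_cst.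
apply: (@cvgD R R^o); first exact: c1.
by apply: (@continuous_comp _ _ _ (fun t : R => t - z) (fun t : R => `|t|)); [exact: c1 | exact: (@norm_continuous _ R^o)].
Qed.

Let psM (e t : R) : 0 <= e -> ps (e * t) = e * ps t.
Proof. by move=> e0; rewrite /ps normrM (ger0_norm e0) -mulrDr mulrA. Qed.

Variables (S S1 S2 : R -> R) (c K : R).
Hypothesis mol : mollifier S S1 S2 c K.

Let dS := mol_der1 mol.
Let dS1 := mol_der2 mol.
Let cS : continuous S. Proof. exact: der_continuous dS. Qed.
Let c0 : 0 < c. Proof. exact: mol_c mol. Qed.
Let K0 : 0 <= K. Proof. exact: le_trans (mol_K mol 0). Qed.

(** [S] rescaled at z; its second derivative [S2e] is c times an approximate identity. The argument
    is spelled as an affine function of y, to fit the affine clause of [smooth]. *)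
Let Se e z y := e * S (e^-1 * y + - (e^-1 * z)).
Let S2e e z y := e^-1 * S2 (e^-1 * y + - (e^-1 * z)).

Let c_aff (f : R -> R) (a b k : R) : continuous f -> continuous (fun y => k * f (a * y + b)).
Proof.
move=> cf y; apply: (@cvgM R); first exact: cvg_cst.
apply: (@continuous_comp _ _ _ (fun y => a * y + b) f); last exact: cf.
exact: (der_continuous (der_affine a b)).
Qed.

Let cSe e z : continuous (Se e z). Proof. exact: c_aff. Qed.
Let cS2e e z : continuous (S2e e z). Proof. by apply: c_aff; exact: mol_cont mol. Qed.

Let S2e_out e z y : 0 < e -> e <= `|y - z| -> S2e e z y = 0.
Proof.
move=> e0 yz; rewrite /S2e (mol_supp mol) ?mulr0 // -mulrN -mulrDr normrM gtr0_norm ?invr_gt0 //.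
by rewrite mulrC ler_pdivlMr // mul1r.
Qed.

Let L1_S2e (g : R -> R) e z : 0 < e -> continuous g -> L1 (fun y => g y * S2e e z y).
Proof.
move=> e0 cg; apply: (@L1_continuous_compact _ _ (z - e) (z + e)).
  by move=> y; apply: (@cvgM R); [exact: cg | exact: cS2e].
move=> y yz; rewrite S2e_out ?mulr0 // leNgt; apply: contra yz => yz.
by move: yz; rewrite ltr_norml => /andP[? ?]; apply/andP; split; lra.
Qed.

Let I_S2e e z : 0 < e -> I (S2e e z) = c.
Proof.
move=> e0; have L : L1 (S2e e z) by apply: eq_L1 (@L1_S2e (fun _ => 1) e z e0 (fun x => cvg_cst _)) => y; rewrite mul1r.
have [_ <-] := I_shift (z - e) L.
have e2 : 0 <= 2 * e by lra.
have d x : is_derive x (1 : R) (fun y => 1 * S1 (e^-1 * y + -1)) (1 * e^-1 * S2 (e^-1 * x + -1)).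
  by apply: der_comp_affine; exact: dS1.
have cd : continuous (fun x => 1 * e^-1 * S2 (e^-1 * x + -1)) by apply: c_aff; exact: mol_cont mol.
have [_ /(_ (2 * e))] := ac_C1 e2 d cd; rewrite e2 lexx => /(_ isT).
rewrite !mul1r mulr0 add0r (mol_S1l mol (lexx _)) add0r.
have -> : e^-1 * (2 * e) + -1 = 1 by field; rewrite lt0r_neq0.
rewrite (mol_S1r mol (lexx _)) => ->; apply: eq_I => y; rewrite /S2e.
have -> : e^-1 * (y + (z - e)) + - (e^-1 * z) = e^-1 * y + -1 by field; rewrite lt0r_neq0.
have [/andP[y0 y1]|y1] := boolP ((0 < y) && (y < 2 * e)); first by rewrite win_in ?mulr1.
rewrite win_out ?mulr0 // (mol_supp mol) ?mulr0 //.
have -> : e^-1 * y + -1 = (y - e) / e by field; rewrite lt0r_neq0.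
rewrite normrM normfV (gtr0_norm e0) ler_pdivlMr // mul1r leNgt; apply: contra y1.
by rewrite ltr_norml => /andP[? ?]; apply/andP; split; lra.
Qed.

(** The defect in the weak identity for the test function [Se e z], which is not admissible because
    its support is unbounded. [E] is its limit as e tends to 0. *)
Let T e z := I (fun y => v y * S2e e z y) - I (fun y => w y * Se e z y) + s * Se e z 0.
Let E z := c * v z - I (fun y => w y * (c * ps (y - z))) + s * (c * ps (0 - z)).

Let Se_close e z y : 0 < e -> `|Se e z y - c * ps (y - z)| <= K * e.
Proof.
move=> e0; have -> : y - z = e * (e^-1 * y + - (e^-1 * z)) by field; rewrite lt0r_neq0.
rewrite psM ?(ltW e0) // /Se mulrCA -mulrBr normrM (gtr0_norm e0) mulrC.
by apply: ler_wpM2r; [exact: ltW | exact: (mol_K mol)].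
Qed.

Let T_close z d : 0 < d -> exists2 e0, 0 < e0 & forall e, 0 < e -> e <= e0 ->
  `|T e z - E z| <= d * (c + K * I (fun y => `|w y|) + `|s| * K).
Proof.
move=> d0; have /cvgrPdist_le/(_ d d0)/nbhs_ballP[r /= r0 Hr] := cv (x := z).
exists (Num.min r d); first by rewrite lt_min r0.
move=> e e0; rewrite le_min => /andP[er ed].
have cps : continuous (fun y => c * ps (y - z)).
  by move=> y; apply: (@cvgM R); [exact: cvg_cst | exact: ps_continuous].
have LS : L1 (S2e e z) by apply: eq_L1 (@L1_S2e (fun _ => 1) e z e0 (fun x => cvg_cst _)) => y; rewrite mul1r.
have h1 : `|I (fun y => v y * S2e e z y) - c * v z| <= d * c.
  rewrite -[X in d * X](I_S2e z e0) -[X in _ - X * _](I_S2e z e0) [X in _ - X]mulrC -!IZ // -IB; last first.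
  - exact: L1Z.
  - exact: L1_S2e.
  apply: I_abs_le; [by apply: L1B; [exact: L1_S2e | exact: L1Z] | exact: L1Z |] => y.
  rewrite -mulrBl normrM; have S20 : 0 <= S2e e z y by rewrite mulr_ge0 ?invr_ge0 ?(ltW e0) // (mol_ge0 mol).
  rewrite (ger0_norm S20); have [yz|yz] := leP e `|y - z|; first by rewrite S2e_out // !mulr0.
  apply: ler_wpM2r => //; rewrite distrC; apply: Hr; rewrite /ball /= distrC; exact: lt_le_trans er.
have h2 : `|I (fun y => w y * Se e z y) - I (fun y => w y * (c * ps (y - z)))| <= d * (K * I (fun y => `|w y|)).
  rewrite -IB; [|exact: L1_w|exact: L1_w].
  apply: (@le_trans _ _ (K * e * I (fun y => `|w y|))); last first.
    by rewrite [K * e]mulrC -mulrA; apply: ler_wpM2r => //; rewrite mulr_ge0 // I_ge0.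
  rewrite -IZ; last exact: L1norm.
  apply: I_abs_le; [by apply: L1B; exact: L1_w | by apply: L1Z; exact: L1norm |] => y.
  by rewrite -mulrBr normrM mulrC; apply: ler_wpM2r => //; exact: Se_close.
have h3 : `|s * Se e z 0 - s * (c * ps (0 - z))| <= d * (`|s| * K).
  rewrite -mulrBr normrM [leRHS]mulrCA; apply: ler_wpM2l => //; apply: le_trans (Se_close z 0 e0) _.
  by rewrite mulrC; apply: ler_wpM2r.
rewrite /T /E !mulrDr.
have -> : forall a b c a' b' c' : R, a - b + c - (a' - b' + c') = (a - a') + - (b - b') + (c - c') by move=> *; ring.
by apply: le_trans (ler_normD _ _) _; apply: lerD => //; apply: le_trans (ler_normD _ _) _; rewrite normrN; apply: lerD.
Qed.

(* Since [S] is affine on [1, +oo[, the combination of the three shifts of [S] has compact support. *)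
Let T_sum e z0 z1 z2 a0 a1 a2 : 0 < e -> `|z0| + e <= A -> `|z1| + e <= A -> `|z2| + e <= A ->
  a0 + a1 + a2 = 0 -> a0 * z0 + a1 * z1 + a2 * z2 = 0 ->
  a0 * T e z0 + (a1 * T e z1 + a2 * T e z2) = 0.
Proof.
move=> e0 b0 b1 b2 s0 s1; have en := lt0r_neq0 e0.
have Lv z : L1 (fun y => v y * S2e e z y) by exact: L1_S2e.
have Lz z : L1 (fun y => w y * Se e z y) by apply: L1_w; exact: cSe.
pose f y := (a0 * e) * S (e^-1 * y + - (e^-1 * z0)) + ((a1 * e) * S (e^-1 * y + - (e^-1 * z1)) + (a2 * e) * S (e^-1 * y + - (e^-1 * z2))).
pose f1 y := (a0 * e * e^-1) * S1 (e^-1 * y + - (e^-1 * z0)) + ((a1 * e * e^-1) * S1 (e^-1 * y + - (e^-1 * z1)) + (a2 * e * e^-1) * S1 (e^-1 * y + - (e^-1 * z2))).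
pose f2 y := (a0 * e * e^-1 * e^-1) * S2 (e^-1 * y + - (e^-1 * z0)) + ((a1 * e * e^-1 * e^-1) * S2 (e^-1 * y + - (e^-1 * z1)) + (a2 * e * e^-1 * e^-1) * S2 (e^-1 * y + - (e^-1 * z2))).
have sf : smooth f by apply: smooth_add; [|apply: smooth_add]; apply: smooth_affine; exact: mol_smooth mol.
have df x : is_derive x (1 : R) f (f1 x).
  by apply: derD; [|apply: derD]; apply: der_comp_affine; exact: dS.
have df1 x : is_derive x (1 : R) f1 (f2 x).
  by apply: derD; [|apply: derD]; apply: der_comp_affine; exact: dS1.
have f0 y : A <= `|y| -> f y = 0.
  have far z : `|z| + e <= A -> (y <= - A -> e^-1 * y + - (e^-1 * z) <= -1) /\ (A <= y -> 1 <= e^-1 * y + - (e^-1 * z)).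
    move=> zA; have := ler_norm z; have := ler_norm (- z); rewrite normrN => n1 n2.
    have -> : e^-1 * y + - (e^-1 * z) = (y - z) / e by field.
    rewrite ler_pdivlMr // ler_pdivrMr // mul1r mulN1r; split; lra.
  have [[l0 r0] [l1 r1]] := (far _ b0, far _ b1); have [l2 r2] := far _ b2.
  rewrite ler_normr => /orP[yA|yA].
    rewrite /f (mol_r mol (r0 yA)) (mol_r mol (r1 yA)) (mol_r mol (r2 yA)).
    transitivity (e * (S 1 - c) * (a0 + a1 + a2) + c * ((a0 + a1 + a2) * y - (a0 * z0 + a1 * z1 + a2 * z2))); first by field.
    by rewrite s0 s1 mulr0 mul0r subr0 mulr0 addr0.
  have yA' : y <= - A by lra.
  by rewrite /f (mol_l mol (l0 yA')) (mol_l mol (l1 yA')) (mol_l mol (l2 yA')) !mulr0 !addr0.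
have := weak sf df df1 f0.
rewrite (@eq_I _ _ (fun y => a0 * (v y * S2e e z0 y) + (a1 * (v y * S2e e z1 y) + a2 * (v y * S2e e z2 y)))); last first.
  by move=> y; rewrite /f2 /S2e !mulfK //; move: (S2 _) (S2 _) (S2 _) => p q r; ring.
rewrite (@eq_I _ (fun y => w y * f y) (fun y => a0 * (w y * Se e z0 y) + (a1 * (w y * Se e z1 y) + a2 * (w y * Se e z2 y)))); last first.
  by move=> y; rewrite /f /Se; move: (S _) (S _) (S _) => p q r; ring.
rewrite !I_lin3 // => H; rewrite /T.
move: H; rewrite (_ : f 0 = a0 * Se e z0 0 + (a1 * Se e z1 0 + a2 * Se e z2 0)); last first.
  by rewrite /f /Se; move: (S _) (S _) (S _) => p q r; ring.
move: (I _) (I _) (I _) (I _) (I _) (I _) (Se e z0 0) (Se e z1 0) (Se e z2 0) => x1 x2 x3 x4 x5 x6 x7 x8 x9 H.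
transitivity ((a0 * x6 + (a1 * x5 + a2 * x4)) - (a0 * x3 + (a1 * x2 + a2 * x1) - s * (a0 * x7 + (a1 * x8 + a2 * x9)))); first by ring.
by rewrite H subrr.
Qed.

(** The relation for [T] in the limit. It says that [E] respects every affine relation between three
    points, hence is affine. *)
Let E_sum z0 z1 z2 a0 a1 a2 : `|z0| < A -> `|z1| < A -> `|z2| < A ->
  a0 + a1 + a2 = 0 -> a0 * z0 + a1 * z1 + a2 * z2 = 0 ->
  a0 * E z0 + (a1 * E z1 + a2 * E z2) = 0.
Proof.
move=> b0 b1 b2 s0 s1; apply/eqP; rewrite -normr_eq0; apply/eqP.
apply: (@small0 _ ((`|a0| + (`|a1| + `|a2|)) * (c + K * I (fun y => `|w y|) + `|s| * K))) => // d d0.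
set C := c + _ + _.
have [e0 e00 H0] := T_close z0 d0; have [e1 e10 H1] := T_close z1 d0; have [e2 e20 H2] := T_close z2 d0.
pose m := Num.min (Num.min e0 (Num.min e1 e2)) (Num.min (A - `|z0|) (Num.min (A - `|z1|) (A - `|z2|))).
have m0 : 0 < m by rewrite !lt_min e00 e10 e20 !subr_gt0 b0 b1 b2.
have : m <= m by []; rewrite {2}/m !le_min => /andP[/and3P[m1 m2 m3] /and3P[m4 m5 m6]].
have := T_sum m0 (z0 := z0) (z1 := z1) (z2 := z2) (a0 := a0) (a1 := a1) (a2 := a2).
move=> /(_ ltac:(lra) ltac:(lra) ltac:(lra) s0 s1) Ts.
have -> : a0 * E z0 + (a1 * E z1 + a2 * E z2) = - (a0 * (T m z0 - E z0)) + (- (a1 * (T m z1 - E z1)) - a2 * (T m z2 - E z2)).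
  rewrite -[LHS]subr0 -[X in _ - X = _]Ts.
  by move: (T m z0) (T m z1) (T m z2) (E z0) (E z1) (E z2) => *; ring.
rewrite mulrCA [d * _]mulrC.
have K3 a z : `|T m z - E z| <= d * C -> `|a * (T m z - E z)| <= `|a| * (d * C).
  by move=> H; rewrite normrM; apply: ler_wpM2l.
rewrite [C * d]mulrC !mulrDl; apply: le_trans (ler_normD _ _) _; rewrite normrN; apply: lerD; first exact/K3/H0.
by apply: le_trans (ler_normB _ _) _; rewrite normrN; apply: lerD; [exact/K3/H1 | exact/K3/H2].
Qed.

(** [E / c] with the positive part of y - z replaced by |y - z| / 2, which changes it by an affine
    function of z. *)
Let E' z := v z - I (fun y => w y * `|y - z|) / 2 + s * `|z| / 2.

Let LwN z : L1 (fun y => w y * `|y - z|).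
Proof.
apply: L1_w => y; apply: (@continuous_comp _ _ _ (fun t : R => t - z) (fun t : R => `|t|)); last exact: (@norm_continuous _ R^o).
by apply: (@cvgB R R^o); [exact: cvg_id | exact: cvg_cst].
Qed.

Let E_E' z : E z = c * (E' z + (- (I (fun y => w y * y) / 2) + z * ((I w - s) / 2))).
Proof.
have Lwy : L1 (fun y => w y * y) by apply: L1_w => y; exact: cvg_id.
rewrite /E /E' (@eq_I _ _ (fun y => c / 2 * (w y * `|y - z|) + (c / 2 * (w y * y) + (- (c * z / 2)) * w y))).
  by rewrite I_lin3 // /ps sub0r normrN; field.
by move=> y; rewrite /ps; field.
Qed.

Lemma weak_solution_formula : exists al be : R, forall x, `|x| < A ->
  v x = al + be * x + I (fun y => w y * `|y - x|) / 2 - s * `|x| / 2.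
Proof.
pose d := A / 2; have d0 : 0 < d by rewrite divr_gt0.
have dA : `|d| < A by rewrite gtr0_norm // /d ltr_pdivrMr // ltr_pMr // ltr1n.
have zA : `|0 : R| < A by rewrite normr0.
(* The affine function is read off at 0 and at d = A / 2; the weights below interpolate x between
   these points. *)
exists (E' 0), ((E' d - E' 0) / d) => x xA.
have := @E_sum 0 d x (x / d - 1) (- (x / d)) 1 zA dA xA.
have dn := lt0r_neq0 d0.
move=> /(_ ltac:(ring) ltac:(by field)); rewrite !E_E'.
set X := (I w - s) / 2; set Y := - (_ / 2).
have -> : (x / d - 1) * (c * (E' 0 + (Y + 0 * X))) + (- (x / d) * (c * (E' d + (Y + d * X))) + 1 * (c * (E' x + (Y + x * X)))) =
   c * (E' x - (E' 0 + (E' d - E' 0) / d * x)) by field.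
move/eqP; rewrite mulf_eq0 (negbTE (lt0r_neq0 c0)) /= subr_eq0 => /eqP <-.
by rewrite /E'; ring.
Qed.

End DuBoisReymond.


(** * From distributions to differential equations *)

Section WeakToODE.
Context {R : realType}.
Local Notation mu := (@lebesgue_measure R).

Lemma ac_tail (g : R -> R) A : L1 g -> 0 <= A -> ac A (fun x => I (fun y => g y * hv (y - x))) (fun y => - g y).
Proof.
move=> Lg A0; have [H _] := cac_tail (cL1_real Lg) A0.
apply: ac_ext H => x.
  by rewrite /=; apply: eq_I => y /=; rewrite mul0r subr0 mulrC.
by rewrite !reim.
Qed.

(** On the right of 0, [d] is the derivative of the formula: |y - x| / 2 has x-derivative 1/2 -
    [hv (y - x)] away from y = x. *)
Lemma formula_ac (v w : R -> R) (s A al be b : R) : L1 w -> (forall y, A <= `|y| -> w y = 0) -> 0 <= b -> b < A ->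
  (forall x, `|x| < A -> v x = al + be * x + I (fun y => w y * `|y - x|) / 2 - s * `|x| / 2) ->
  let d x := be - s / 2 + I w / 2 - I (fun y => w y * hv (y - x)) in ac b v d /\ ac b d w.
Proof.
move=> Lw sw b0 bA H d.
have Lwy : L1 (fun y => w y * y).
  apply: (@L1_le _ _ (fun y => A * `|w y|)); [|move=> y|by apply: L1Z; exact: L1norm].
    by apply: measurable_funM => //; exact: L1_meas.
  rewrite normrM mulrC; have [yA|yA] := leP A `|y|; first by rewrite (sw _ yA) normr0 !mulr0.
  by apply: ler_wpM2r => //; exact: ltW.
have Lh (g : R -> R) x : L1 g -> L1 (fun y => g y * hv (y - x)).
  move=> Lg; apply: (L1M (M := 1)) => //; [|by move=> t; exact: hv_norm].
  by apply: measurable_hv => //; exact: measurable_funB.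
set k := be - s / 2 + I w / 2.
have HT := ac_tail Lw b0; have HU := ac_tail Lwy b0.
split.
  apply: eq_ac (acD (ac_cst b (al - I (fun y => w y * y) / 2)) (acD (acZ k (ac_id b0)) (acD HU (acN (ac_mul (ac_id b0) HT))))) => //.
    move=> x /andP[x0 xb]; rewrite (H x); last by rewrite ger0_norm //; exact: le_lt_trans bA.
    rewrite (ger0_norm x0) (@eq_I _ (fun y => w y * `|y - x|) (fun y => (2 * (w y * y * hv (y - x)) - w y * y) + (x * w y - 2 * x * (w y * hv (y - x))))); last first.
      move=> y; have [yx|yx] := lerP (y - x) 0; first by rewrite (ler0_norm yx) (hv_neg yx); ring.
      by rewrite (gtr0_norm yx) (hv_pos yx); ring.
    have L2 := L1Z 2 (Lh _ x Lwy); have L3 := L1Z (2 * x) (Lh _ x Lw); have L4 := L1Z x Lw.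
    rewrite ID; [|exact: L1B|exact: L1B].
    by rewrite !IB // !IZ ?/k //; [field | exact: Lh | exact: Lh].
  by move=> x _; rewrite /d -/k; ring.
apply: eq_ac (acD (ac_cst b k) (acN HT)) => // x _; last by rewrite add0r opprK.
Qed.

(** The left side becomes a half line by reflection. In the sum of the two outward derivatives at 0
    the slopes cancel, as do the integrals of w, and - s remains. *)
Lemma weak_solution_ode (v w : R -> R) (s A b : R) : 0 <= b -> b < A -> continuous v -> L1 w ->
  (forall y, A <= `|y| -> w y = 0) ->
  (forall f f1 f2 : R -> R, smooth f -> (forall x, is_derive x (1 : R) f (f1 x)) ->
  (forall x, is_derive x (1 : R) f1 (f2 x)) -> (forall y, A <= `|y| -> f y = 0) ->
  I (fun y => v y * f2 y) = I (fun y => w y * f y) - s * f 0) ->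
  exists vr vl, [/\ ac b v vr, ac b vr w, ac b (fun x => v (- x)) vl, ac b vl (fun x => w (- x)) &
    vr 0 + vl 0 = - s].
Proof.
move=> b0 bA cv Lw sw weak; have A0 : 0 < A by exact: le_lt_trans bA.
have [S [S1 [S2 [c [K mol]]]]] := @mollifier_exists R.
have [al [be H]] := weak_solution_formula A0 cv Lw sw weak mol.
have [Lw' Iw'] := I_reflect Lw.
have sw' y : A <= `|y| -> w (- y) = 0 by move=> yA; rewrite sw // normrN.
have H' x : `|x| < A -> v (- x) = al + - be * x + I (fun y => w (- y) * `|y - x|) / 2 - s * `|x| / 2.
  move=> xA; rewrite H normrN // mulrN mulNr; congr (_ + _ / 2 - _).
  have Lx : L1 (fun y => w y * `|y - - x|).
    apply: (L1_w A0 Lw sw) => y; apply: (@continuous_comp _ _ _ (fun t : R => t - - x) (fun t : R => `|t|)); last exact: (@norm_continuous _ R^o).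
    by apply: (@cvgB R R^o); [exact: cvg_id | exact: cvg_cst].
  have [_ <-] := I_reflect Lx; apply: eq_I => y; congr (_ * _).
  by rewrite -normrN; congr `|_|; ring.
have [r1 r2] := formula_ac Lw sw b0 bA H; have [l1 l2] := formula_ac Lw' sw' b0 bA H'.
eexists; eexists; split; [exact: r1 | exact: r2 | exact: l1 | exact: l2 |].
have Lp : L1 (fun y => w y * hv (y - 0)).
  by apply: (L1M (M := 1)) => //; [apply: measurable_hv => //; exact: measurable_funB | move=> t; exact: hv_norm].
have Ln : L1 (fun y => w y * hv (- y - 0)).
  apply: (L1M (M := 1)) => //; [|by move=> t; exact: hv_norm].
  by apply: measurable_hv => //; apply: measurable_funB => //; exact: oppr_measurable.
have -> : I (fun y => w (- y) * hv (y - 0)) = I (fun y => w y * hv (- y - 0)).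
  by have [_ <-] := I_reflect Ln; apply: eq_I => y; rewrite opprK.
have E : I w = I (fun y => w y * hv (y - 0)) + I (fun y => w y * hv (- y - 0)).
  rewrite -ID //; apply/eqP; rewrite -subr_eq0 -IB //; last exact: L1D.
  apply/eqP; apply: (@I_singleton _ _ 0) => t; rewrite !subr0 neq_lt => /orP[t0|t0].
    by rewrite (hv_neg (ltW t0)) hv_pos ?oppr_gt0 // mulr0 add0r mulr1 subrr.
  by rewrite (hv_pos t0) hv_neg ?oppr_le0 ?(ltW t0) // mulr0 addr0 mulr1 subrr.
by rewrite Iw' E; field.
Qed.

Lemma potential_L1 (q : R -> R) : potential q -> L1 q.
Proof.
move=> [iq q0]; move/integrable_itvE : iq; apply: eq_L1 => x.
rewrite patchE; case: ifPn => // x1; rewrite q0 // ltNge; apply: contra x1.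
by rewrite ler_norml mem_setE /= in_itv.
Qed.

Let ind (A y : R) : R := hv (y + A) * hv (A - y).

Let ind_in A y : `|y| < A -> ind A y = 1.
Proof. by rewrite ltr_norml => /andP[? ?]; rewrite /ind !hv_pos ?mulr1; lra. Qed.

Let ind_out A y : A <= `|y| -> ind A y = 0.
Proof.
by rewrite ler_normr => /orP[yA|yA]; rewrite /ind; [rewrite mulrC|]; rewrite hv_neg ?mul0r //; lra.
Qed.

Lemma weak_real_ode (q v : R -> R) (k s b : R) : potential q -> continuous v -> 0 <= b ->
  (forall f f1 f2 : R -> R, smooth f -> (forall x, is_derive x (1 : R) f (f1 x)) ->
    (forall x, is_derive x (1 : R) f1 (f2 x)) -> (exists a : R, forall x : R, a < `|x| -> f x = 0) ->
    I (fun y => v y * f2 y) + k * I (fun y => v y * f y) - I (fun y => q y * v y * f y) = - (s * f 0)) ->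
  exists vr vl, [/\ ac b v vr, ac b vr (fun x => (q x - k) * v x), ac b (fun x => v (- x)) vl,
    ac b vl (fun x => (q (- x) - k) * v (- x)) & vr 0 + vl 0 = - s].
Proof.
move=> pq cv b0 weak; have Lq := potential_L1 pq.
(* The cutoff at A makes [w] integrable, and test functions supported in [-A, A] do not notice
   it. *)
pose A := b + 1; have bA : b < A by rewrite ltrDl.
have A0 : 0 < A by exact: le_lt_trans bA.
pose w y := (q y - k) * v y * ind A y.
have mind : measurable_fun setT (ind A).
  by apply: measurable_funM; apply: measurable_hv => //; [exact: measurable_funD | exact: measurable_funB].
have mv : measurable_fun setT v by exact: continuous_measurable_fun.
have [M HM] := bounded_on A0 cv.
have bi y : `|v y * ind A y| <= M.
  have [yA|yA] := leP A `|y|; last by rewrite ind_in // mulr1 HM // ltW.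
  by rewrite ind_out // mulr0 normr0; apply: le_trans (HM 0 _); rewrite ?normr0 // ltW.
have Lw : L1 w.
  apply: (@eq_L1 _ (fun y => q y * (v y * ind A y) - k * (v y * ind A y))); first by move=> y; rewrite /w; ring.
  apply: L1B; first by apply: (L1M (M := M)) => //; exact: measurable_funM.
  apply: L1Z; apply: (@L1_bounded _ _ (- A) A M) => //; first exact: measurable_funM.
  by move=> x xA; rewrite ind_out ?mulr0 // ler_normr; case/orP: xA => xA; apply/orP; [right|left]; lra.
have sw y : A <= `|y| -> w y = 0 by move=> yA; rewrite /w ind_out // mulr0.
have [|vr [vl [H1 H2 H3 H4 H5]]] := @weak_solution_ode v w s A b b0 bA cv Lw sw.
  move=> f f1 f2 sf df df1 f0.
  have cf := smooth_continuous sf.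
  have cvf : continuous (fun y => v y * f y) by move=> y; apply: (@cvgM R); [exact: cv | exact: cf].
  have Lvf : L1 (fun y => v y * f y).
    apply: (@L1_continuous_compact _ _ (- A) A) => // x xA; rewrite f0 ?mulr0 //.
    by apply: ltW; rewrite ltNge ler_norml.
  have [M' HM'] := bounded_on A0 cvf.
  have Lqvf : L1 (fun y => q y * v y * f y).
    apply: (@eq_L1 _ (fun y => q y * (v y * f y))); first by move=> y; rewrite mulrA.
    apply: (L1M (M := M')) => //; first exact: continuous_measurable_fun.
    move=> y; have [yA|yA] := leP A `|y|; last by apply: HM'; exact: ltW.
    by rewrite f0 // mulr0 normr0; apply: le_trans (HM' 0 _); rewrite ?normr0 // ltW.
  have := weak f f1 f2 sf df df1 (ex_intro _ A (fun x xA => f0 x (ltW xA))).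
  have -> : I (fun y => w y * f y) = I (fun y => q y * v y * f y) - k * I (fun y => v y * f y).
    rewrite -IZ // -IB //; last exact: L1Z.
    apply: eq_I => y; rewrite /w; have [yA|yA] := leP A `|y|; first by rewrite f0 // !mulr0 subr0.
    by rewrite ind_in //; ring.
  by move=> e; lra.
exists vr, vl; split => //.
- apply: eq_ac H2 => // x /andP[x0 xb]; rewrite /w ind_in ?mulr1 // gtr0_norm //; exact: lt_trans bA.
- apply: eq_ac H4 => // x /andP[x0 xb]; rewrite /w ind_in ?mulr1 // normrN gtr0_norm //; exact: lt_trans bA.
Qed.

Lemma point_source_ode (q : R -> R) (k b : R) (u : R -> R[i]) : potential q -> point_source_solution q k u -> 0 <= b ->
  exists ur ul : R -> R[i], [/\ cac b u ur, cac b ur (fun x => ((q x)%:C%C - k%:C%C ^+ 2) * u x),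
    cac b (fun x => u (- x)) ul, cac b ul (fun x => ((q (- x))%:C%C - k%:C%C ^+ 2) * u (- x)) & ur 0 + ul 0 = -1].
Proof.
move=> pq [[cr ci] weak _] b0.
have W (f f1 f2 : R -> R) : smooth f -> (forall x, is_derive x (1 : R) f (f1 x)) ->
    (forall x, is_derive x (1 : R) f1 (f2 x)) -> (exists a : R, forall x : R, a < `|x| -> f x = 0) ->
    regular_distr u f2 + (k ^+ 2)%:C%C * regular_distr u f - regular_distr (fun x => (q x)%:C%C * u x) f = - (f 0)%:C%C.
  move=> sf df df1 sup; have <- := weak f (conj (smooth_derivable sf) sup).
  have -> : f2 = derive1 (derive1 f); last by rewrite /distr_derive opprK.
  have -> : derive1 f = f1 by apply/funext => x; rewrite derive1E; have [_ ->] := df x.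
  by apply/funext => x; rewrite derive1E; have [_ ->] := df1 x.
(* The source is real: strength 1 for the real part and 0 for the imaginary part. *)
have [|vr [vl [r1 r2 r3 r4 r5]]] := @weak_real_ode q (fun x => Re (u x)) (k ^+ 2) 1 b pq cr b0.
  move=> f f1 f2 sf df df1 sup; rewrite mul1r.
  have := congr1 (@complex.Re R) (W f f1 f2 sf df df1 sup).
  rewrite !(ReD, ReN, ReM) /= mul0r subr0 => <-; congr (_ + _ * _ - _); apply: eq_I => y; rewrite !reim; ring.
have [|wr [wl [i1 i2 i3 i4 i5]]] := @weak_real_ode q (fun x => Im (u x)) (k ^+ 2) 0 b pq ci b0.
  move=> f f1 f2 sf df df1 sup; rewrite mul0r oppr0.
  have := congr1 (@complex.Im R) (W f f1 f2 sf df df1 sup).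
  rewrite !(ImD, ImN, ImM) /= oppr0 mul0r addr0 => <-; congr (_ + _ * _ - _); apply: eq_I => y; rewrite !reim; ring.
exists (fun x => (vr x +i* wr x)%C), (fun x => (vl x +i* wl x)%C); split.
- by split.
- split; [apply: ac_ext r2 => x // | apply: ac_ext i2 => x //]; rewrite expr2 !reim; ring.
- by split.
- split; [apply: ac_ext r4 => x // | apply: ac_ext i4 => x //]; rewrite expr2 !reim; ring.
- by apply: ceq; rewrite !reim /=; [exact: r5 | rewrite i5 oppr0].
Qed.

End WeakToODE.


(** * Radiation condition and data *)

Section Radiation.
Context {R : realType}.
Local Notation mu := (@lebesgue_measure R).
Local Notation ik k := ('i%C * k%:C%C).
Local Notation ex k x := (cexp ('i%C * k%:C%C * x%:C%C)).

Lemma exJ (k x : R) : (ex k x)^*%C = (ex k x)^-1.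
Proof.
rewrite -cexpJ -cexpN; congr cexp; apply: ceq; rewrite !reim; ring.
Qed.

Lemma normc_ex (k x : R) : nC (ex k x) = 1.
Proof. by rewrite normc_cexp -expR0; congr expR; rewrite !reim; ring. Qed.

Lemma cI_singleton (f : R -> R[i]) x : (forall t, t != x -> f t = 0) -> cI f = 0.
Proof. by move=> H; apply: ceq; apply: (@I_singleton _ _ x) => t tx; rewrite H // ?Re0 ?Im0. Qed.

(* The value of the derivative at [1] is not controlled, but the integrand is supported at a point. *)
Lemma cac_const_from (A : R) (f g : R -> R[i]) : cac A f g -> (forall x, 1 < x -> g x = 0) ->
  forall x, 1 <= x <= A -> f x = f 1.
Proof.
move=> H g0 x /andP[x1 xA]; have A1 : 1 <= A by exact: le_trans xA.
have x0 : 0 <= x <= A by rewrite xA (le_trans ler01).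
have a0 : 0 <= (1 : R) <= A by rewrite ler01.
rewrite (cacE H x0) (cacE H a0); congr (_ + _); apply/eqP; rewrite -subr_eq0 -cIB; last first.
- exact: (cac_L1 (cac_le A1 H)).
- exact: (cac_L1 (cac_le xA H)).
apply/eqP; apply: (@cI_singleton _ 1) => t; rewrite neq_lt => /orP[t1|t1]; last by rewrite g0 // !mulr0 subrr.
have [t0|t0] := lerP t 0; last by rewrite !win_in ?subrr //; exact: lt_le_trans x1.
by rewrite !win_out ?subrr // negb_and -leNgt t0.
Qed.

(** * Solutions beyond the support of the potential *)

Section Side.
Variables (p : R -> R) (k b : R) (u d : R -> R[i]).
Hypotheses (k0 : 0 < k) (p0 : forall x, 1 < x -> p x = 0).
Hypotheses (Hu : cac b u d) (Hd : cac b d (fun x => ((p x)%:C%C - k%:C%C ^+ 2) * u x)) (b1 : 1 < b).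

Let kn : ik k != 0.
Proof.
have i0 : ('i%C : R[i]) != 0 by rewrite -normc_gt0 normci.
by apply: mulf_neq0 => //; rewrite -normc_gt0 normcC normr_gt0 lt0r_neq0.
Qed.

Let i2 : ik k * ik k = - k%:C%C ^+ 2.
Proof. by rewrite mulrACA -expr2 sqr_i mulN1r expr2. Qed.

(** Beyond the support (u' - i k u) e^{ikx} and (u' + i k u) e^{-ikx} are constant; eliminating u'
    gives u. *)
Lemma plane_waves x : 1 <= x <= b ->
  u x = (2 * ik k)^-1 * ((d 1 + ik k * u 1) / ex k 1 * ex k x - (d 1 - ik k * u 1) * ex k 1 / ex k x).
Proof.
move=> x1; have b0 : 0 <= b by rewrite (le_trans ler01) // ltW.
have He := cac_cexp (ik k) b0; have Hn := cac_cexp (- ik k) b0.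
have exN y : cexp (- ik k * y%:C%C) = (ex k y)^-1 by rewrite mulNr cexpN.
have G : (d x - ik k * u x) * ex k x = (d 1 - ik k * u 1) * ex k 1.
  apply: (cac_const_from (cac_mul (cacD Hd (cacN (cacZ (ik k) Hu))) He)) => // t t1.
  rewrite (p0 t1) rC0 sub0r -i2; move: (ik k) (u t) (d t) (ex k t) => *; ring.
have H : (d x + ik k * u x) / ex k x = (d 1 + ik k * u 1) / ex k 1.
  rewrite -!exN; apply: (cac_const_from (cac_mul (cacD Hd (cacZ (ik k) Hu)) Hn)) => // t t1.
  rewrite (p0 t1) rC0 sub0r -i2; move: (ik k) (u t) (d t) (cexp _) => *; ring.
have e0 : ex k x != 0 := cexp_ne0 _.
rewrite -G -H divfK // mulfK //; move: kn; move: (ik k) (u x) (d x) => a c e an; field.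
exact: an.
Qed.

(** The defect is the incoming wave, up to a constant factor, and its modulus does not depend on the
    point. The sign [sg] covers both ends of the line. The derivative is computed on the plane waves
    [F], which agree with [f] near the point. *)
Lemma defect_norm (sg x0 : R) (f : R -> R[i]) : sg * sg = 1 -> 1 < x0 < b -> (forall x, 0 <= x <= b -> u x = f (sg * x)) ->
  nC (radiation_defect k f (sg * x0)) = nC (d 1 - ik k * u 1).
Proof.
move=> s2 /andP[x1 x2] fu.
set h := (2 * ik k)^-1 * ((d 1 + ik k * u 1) / ex k 1); set g := (2 * ik k)^-1 * ((d 1 - ik k * u 1) * ex k 1).
have ks : ik k * (sg%:C%C) * (sg * x0)%:C%C = ik k * x0%:C%C.
  by rewrite -mulrA -rCM [sg * (sg * x0)]mulrA s2 mul1r.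
have sn : sg != 0 by apply/eqP => s0; move: s2; rewrite s0 mul0r => /esym/eqP; rewrite oner_eq0.
have sN : `|sg| = 1.
  by apply/eqP; rewrite -(@eqrXn2 _ 2) // expr1n expr2 -normrM s2 normr1.
pose F y : R[i] := h * cexp (ik k * sg%:C%C * y%:C%C) - g * cexp (- (ik k * sg%:C%C) * y%:C%C).
pose D : R[i] := h * (ik k * sg%:C%C * ex k x0) - g * (- (ik k * sg%:C%C) / ex k x0).
have nearF : \forall y \near sg * x0, F y = f y.
  have r0 : 0 < Num.min (x0 - 1) (b - x0) by rewrite lt_min !subr_gt0 x1.
  apply/nbhs_ballP; exists (Num.min (x0 - 1) (b - x0)) => //= y; rewrite /ball /= => yr.
  have yE : sg * (sg * y) = y by rewrite mulrA s2 mul1r.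
  have : `|x0 - sg * y| < Num.min (x0 - 1) (b - x0).
    have -> : x0 - sg * y = sg * (sg * x0 - y) by rewrite mulrBr mulrA s2 mul1r.
    by rewrite normrM sN mul1r.
  rewrite lt_min !ltr_norml => /andP[/andP[a1 a2] /andP[a3 a4]].
  have y1 : 1 <= sg * y <= b by apply/andP; split; lra.
  have y0 : 0 <= sg * y <= b by apply/andP; split; lra.
  rewrite -{2}yE -(fu _ y0) (plane_waves y1) /F /h /g mulNr cexpN.
  have -> : ik k * sg%:C%C * y%:C%C = ik k * (sg * y)%:C%C by rewrite rCM mulrA.
  by rewrite mulrBr !mulrA.
have dF : is_derive (sg * x0) (1 : R) (fun y => Re (F y)) (Re D) /\ is_derive (sg * x0) (1 : R) (fun y => Im (F y)) (Im D).
  have dr z := cexp_Re_derive z (sg * x0); have di z := cexp_Im_derive z (sg * x0).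
  have dZ (c : R) (f0 : R -> R) a : is_derive (sg * x0) (1 : R) f0 a -> is_derive (sg * x0) (1 : R) (fun y => c * f0 y) (c * a).
    by move=> df; have := derM (is_derive_cst c (sg * x0) (1 : R)) df; rewrite mul0r add0r.
  have DE : D = h * (ik k * sg%:C%C * cexp (ik k * sg%:C%C * (sg * x0)%:C%C)) - g * (- (ik k * sg%:C%C) * cexp (- (ik k * sg%:C%C) * (sg * x0)%:C%C)).
    have e1 : cexp (- (ik k * sg%:C%C) * (sg * x0)%:C%C) = (ex k x0)^-1 by rewrite mulNr cexpN ks.
    by rewrite /D ks e1.
  set z := ik k * sg%:C%C in dr di DE *.
  split.
    have := derD (derD (dZ (Re h) _ _ (dr z)) (dZ (- Im h) _ _ (di z))) (derD (dZ (- Re g) _ _ (dr (- z))) (dZ (Im g) _ _ (di (- z)))).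
    have -> : (fun y => Re (F y)) = (fun y => Re h * Re (cexp (z * y%:C%C)) + - Im h * Im (cexp (z * y%:C%C)) +
       (- Re g * Re (cexp (- z * y%:C%C)) + Im g * Im (cexp (- z * y%:C%C)))).
      by apply/funext => y; rewrite /F -/z ReD ReN !ReM; ring.
    have -> : Re D = Re h * Re (z * cexp (z * (sg * x0)%:C%C)) + - Im h * Im (z * cexp (z * (sg * x0)%:C%C)) +
       (- Re g * Re (- z * cexp (- z * (sg * x0)%:C%C)) + Im g * Im (- z * cexp (- z * (sg * x0)%:C%C))).
      by rewrite DE; move: (z * cexp _) (- z * cexp _) => p1 p2; rewrite ReD ReN !ReM; ring.
    by [].
  have := derD (derD (dZ (Re h) _ _ (di z)) (dZ (Im h) _ _ (dr z))) (derD (dZ (- Re g) _ _ (di (- z))) (dZ (- Im g) _ _ (dr (- z)))).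
  have -> : (fun y => Im (F y)) = (fun y => Re h * Im (cexp (z * y%:C%C)) + Im h * Re (cexp (z * y%:C%C)) +
     (- Re g * Im (cexp (- z * y%:C%C)) + - Im g * Re (cexp (- z * y%:C%C)))).
    by apply/funext => y; rewrite /F -/z ImD ImN !ImM; ring.
  have -> : Im D = Re h * Im (z * cexp (z * (sg * x0)%:C%C)) + Im h * Re (z * cexp (z * (sg * x0)%:C%C)) +
     (- Re g * Im (- z * cexp (- z * (sg * x0)%:C%C)) + - Im g * Re (- z * cexp (- z * (sg * x0)%:C%C))).
    by rewrite DE; move: (z * cexp _) (- z * cexp _) => p1 p2; rewrite ImD ImN !ImM; ring.
  by [].
have cf : cderive f (sg * x0) = D.
  have nr : \forall y \near sg * x0, Re (F y) = Re (f y) by apply: filterS nearF => y ->.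
  have ni : \forall y \near sg * x0, Im (F y) = Im (f y) by apply: filterS nearF => y ->.
  have [_ er] := near_eq_is_derive nr dF.1; have [_ ei] := near_eq_is_derive ni dF.2.
  by rewrite /cderive !derive1E er ei; case: (D).
have sgE : Num.sg (sg * x0) = sg.
  have : sg = 1 \/ sg = -1.
    by move/eqP: sN; rewrite eqr_norml ler01 andbT => /orP[/eqP->|/eqP->]; [left|right].
  have x00 : 0 < x0 by exact: lt_trans x1.
  by case=> ->; rewrite ?mulN1r ?sgrN ?mul1r gtr0_sg.
have x0b : 0 <= x0 <= b by apply/andP; split; lra.
have fx : f (sg * x0) = h * ex k x0 - g / ex k x0.
  by rewrite -(nbhs_singleton nearF) /F mulNr cexpN ks.
rewrite /radiation_defect sgE cf fx.
have -> : sg%:C%C * D - ik k * (h * ex k x0 - g / ex k x0) = 2 * ik k * g / ex k x0.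
  have s2C : sg%:C%C * sg%:C%C = 1 :> R[i] by rewrite -rCM s2.
  transitivity ((sg%:C%C * sg%:C%C) * ik k * (h * ex k x0 + g / ex k x0) - ik k * (h * ex k x0 - g / ex k x0)).
    by rewrite /D; move: (ik k) ((ex k x0)^-1) => *; ring.
  by rewrite s2C; move: (ik k) ((ex k x0)^-1) => *; ring.
have k2 : 2 * ik k != 0 by apply: mulf_neq0; rewrite ?pnatr_eq0.
rewrite /g (mulVKf k2).
by rewrite !normcM normcV !normc_ex invr1 !mulr1.
Qed.

End Side.

(** The modulus of the defect is the same at all points beyond 1 and tends to 0. The solution on
    [0, 3] and one on a longer interval are compared at the common point 2. *)
Lemma radiation_side (p : R -> R) (k sg : R) (f : R -> R[i]) : 0 < k -> (forall x, 1 < x -> p x = 0) -> sg * sg = 1 ->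
  (forall b, 0 <= b -> exists d, cac b (fun x => f (sg * x)) d /\
     cac b d (fun x => ((p x)%:C%C - k%:C%C ^+ 2) * f (sg * x))) ->
  (forall e, 0 < e -> exists M : R, forall x, M < x -> nC (radiation_defect k f (sg * x)) < e) ->
  forall d, cac 3 (fun x => f (sg * x)) d -> cac 3 d (fun x => ((p x)%:C%C - k%:C%C ^+ 2) * f (sg * x)) ->
  d 1 = ik k * f (sg * 1).
Proof.
move=> k0 p0 s2 ode rad d H1 H2; apply/eqP; rewrite -subr_eq0 -normc_eq0; apply/eqP.
apply: (@small0 R _ 1) => [|e e0]; first exact: normc_ge0.
have [M HM] := rad e e0; set x := Num.max M 2 + 1.
have xM : M < x by rewrite /x ltr_pwDr // le_max lexx.
have x2 : 2 < x by rewrite /x ltr_pwDr // le_max lexx orbT.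
have x0 : 0 <= x + 1 by lra.
have [d' [K1 K2]] := ode (x + 1) x0.
have b3 : 1 < (3 : R) by lra.
have bx : 1 < x + 1 by lra.
have two : 1 < (2 : R) < 3 by apply/andP; split; lra.
have twox : 1 < (2 : R) < x + 1 by apply/andP; split; lra.
have xx : 1 < x < x + 1 by apply/andP; split; lra.
have fu b y : 0 <= y <= b -> f (sg * y) = f (sg * y) by [].
rewrite -(defect_norm k0 p0 H1 H2 b3 s2 two (fu 3)) (defect_norm k0 p0 K1 K2 bx s2 twox (fu _)).
by rewrite -(defect_norm k0 p0 K1 K2 bx s2 xx (fu _)) mulr1 ltW // HM.
Qed.

Lemma normc_realk (k : R) : 0 < k -> (k%:C%C : R[i]) != 0.
Proof. by move=> k0; rewrite -normc_gt0 normcC normr_gt0 lt0r_neq0. Qed.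

(* Wronskians of an outgoing solution with the Jost solution and with its conjugate. *)
Lemma outgoing_data (p Q : R -> R) (B : R * R -> R) (k : R) (u d : R -> R[i]) : 0 < k -> nice Q -> is_kernel Q B ->
  (forall x, 0 < x < 1 -> p x = Q x) -> cac 1 u d -> cac 1 d (fun x => ((p x)%:C%C - k%:C%C ^+ 2) * u x) ->
  d 1 = ik k * u 1 ->
  u 0 * Fder (jF B) (jY Q B) k%:C%C = d 0 * jF B k%:C%C /\ u 1 * jF B k%:C%C = u 0 * ex k 1.
Proof.
move=> k0 nQ kB pQ Hu Hd out; have kn := normc_realk k0.
have Hf := cac_jf nQ kB kn (ler01 : 0 <= (1 : R)); have Hg := cac_jd nQ kB kn (ler01 : 0 <= (1 : R)).
have a1 : 0 <= (1 : R) <= 1 by rewrite ler01 lexx.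
have W1 := cac_const (cacD (cac_mul Hu Hg) (cacN (cac_mul Hd Hf))) _ a1.
have {}W1 : u 1 * jd Q B k%:C%C 1 - d 1 * jf B k%:C%C 1 = u 0 * jd Q B k%:C%C 0 - d 0 * jf B k%:C%C 0.
  by apply: W1 => x x1; rewrite (pQ x x1); move: (_%:C%C - _) (u x) (d x) (jf _ _ _) (jd _ _ _ _) => *; ring.
have W2 := cac_const (cacD (cac_mul Hu (cacJ Hg)) (cacN (cac_mul Hd (cacJ Hf)))) _ a1.
have {}W2 : u 1 * (jd Q B k%:C%C 1)^*%C - d 1 * (jf B k%:C%C 1)^*%C = u 0 * (jd Q B k%:C%C 0)^*%C - d 0 * (jf B k%:C%C 0)^*%C.
  apply: W2 => x x1; rewrite (pQ x x1) conjcM.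
  have -> : ((Q x)%:C%C - k%:C%C ^+ 2)^*%C = (Q x)%:C%C - k%:C%C ^+ 2 :> R[i] by rewrite expr2 -rCM conjcB !conjc_real.
  by move: (_%:C%C - _) (u x) (d x) ((jf _ _ _)^*%C) ((jd _ _ _ _)^*%C) => *; ring.
move: W1 W2; rewrite !(jf1 kB _ (lexx 1)) !(jd1 B nQ _ (lexx 1)) !jf0 !(jd0 nQ kB kn) out.
set F := jF B _; set D := Fder _ _ _.
have e0 : ex k 1 != 0 := cexp_ne0 _.
move=> W1 W2; have H1 : u 0 * D = d 0 * F.
  by apply/eqP; rewrite -subr_eq0 -W1; apply/eqP; move: (ik k) (ex k 1) => *; ring.
split=> //.
(* The Wronskian of the Jost solution with its conjugate, known from the conserved flux. *)
have HF : F * D^*%C - D * F^*%C = - (2 * ik k).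
  have ik1 : F^*%C * D - D^*%C * F = 2 * 'i%C * (Im (F^*%C * D))%:C%C.
    by move: (F) (D) => f g; apply: ceq; rewrite !reim; ring.
  have [_ im] := jost_flux nQ kB kn (lexx 0) (ltW k0 : 0 <= Re (k%:C%C : R[i])).
  rewrite -[LHS]opprK opprB (_ : D * F^*%C - F * D^*%C = F^*%C * D - D^*%C * F) ?ik1; last by rewrite mulrC [F * _]mulrC.
  by rewrite (im erefl) /= mulrA.
have : (u 1 * (ik k * ex k 1)^*%C - ik k * u 1 * (ex k 1)^*%C) * F = u 0 * (F * D^*%C - D * F^*%C).
  by rewrite W2 mulrBl mulrBr mulrA [u 0 * D^*%C * F]mulrAC [d 0 * _ * F]mulrAC -H1; ring.
rewrite HF conjcM exJ.
have -> : (ik k)^*%C = - ik k by apply: ceq; rewrite !reim; ring.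
have kik : 2 * ik k != 0.
  by rewrite !mulf_neq0 ?pnatr_eq0 //; rewrite -normc_gt0 normci.
move=> E; have {}E : (2 * ik k) * (u 1 * F) / ex k 1 = (2 * ik k) * u 0.
  move: E; move: (ik k) (ex k 1)^-1 (u 1) (u 0) => a e x y E.
  transitivity (- ((x * (- a * e) - a * x * e) * F)); first by ring.
  by rewrite E; ring.
apply: (mulfI kik); apply: (mulIf (invr_neq0 e0)).
by rewrite E [2 * ik k * (u 0 * ex k 1)]mulrA mulfK.
Qed.

(** Multiplying the jump condition by a b gives u0 W = a b, that is, u0 is the Green function at the
    source. *)
Lemma source_algebra (u0 u1 u2 a b a' b' ra la e : R[i]) : a != 0 -> b != 0 -> e != 0 ->
  u0 * a' = ra * a -> u1 * a = u0 * e -> u0 * b' = la * b -> u2 * b = u0 * e -> ra + la = -1 ->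
  b / - (a' * b + a * b') = u1 / e /\ a / - (a' * b + a * b') = u2 / e.
Proof.
move=> a0 b0 e0 Ha E1 Hb E2 jump; set W := - (a' * b + a * b').
have HW : u0 * W = a * b.
  transitivity (- (u0 * a' * b + a * (u0 * b'))); first by rewrite /W; ring.
  rewrite Ha Hb; transitivity (- (ra + la) * (a * b)); first by ring.
  by rewrite jump opprK mul1r.
have W0 : W != 0 by apply: contraTneq (mulf_neq0 a0 b0) => w0; rewrite -HW w0 mulr0 eqxx.
split; apply/eqP; rewrite eqr_div //; apply/eqP.
  by apply: (mulfI a0); rewrite mulrA -HW mulrA [a * u1]mulrC E1; ring.
by apply: (mulfI b0); rewrite mulrA [b * a]mulrC -HW mulrA [b * u2]mulrC E2; ring.
Qed.

Theorem source_data (q Qa Qb : R -> R) (Ba Bb : R * R -> R) (k : R) (u : R -> R[i]) : 0 < k -> potential q ->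
  nice Qa -> nice Qb -> is_kernel Qa Ba -> is_kernel Qb Bb ->
  (forall x, 0 < x < 1 -> q x = Qa x) -> (forall x, 0 < x < 1 -> q (- x) = Qb x) ->
  point_source_solution q k u ->
  jF Bb k%:C%C / Wr (jF Ba) (jY Qa Ba) (jF Bb) (jY Qb Bb) k%:C%C = u 1 / ex k 1 /\
  jF Ba k%:C%C / Wr (jF Ba) (jY Qa Ba) (jF Bb) (jY Qb Bb) k%:C%C = u (-1) / ex k 1.
Proof.
move=> k0 pq nQa nQb kBa kBb qa qb ps.
have b3 : 0 <= (3 : R) by [].
have [ur [ul [r1 r2 l1 l2 jump]]] := point_source_ode pq ps b3.
have [_ q0] := pq; have [_ _ [_ _ radr radl]] := ps.
have s1 : (1 : R) * 1 = 1 by rewrite mulr1.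
have s2 : (-1 : R) * -1 = 1 by rewrite mulrNN mulr1.
have outr : ur 1 = ik k * u 1.
  have := @radiation_side q k 1 u k0 _ s1 _ _ ur; rewrite mul1r; apply.
  - by move=> x x1; apply: q0; apply: lt_le_trans x1 (ler_norm _).
  - move=> b b0; have [d [_ [K1 K2 _ _ _]]] := point_source_ode pq ps b0; exists d.
    by split; [apply: cac_ext K1 => x | apply: cac_ext K2 => x]; rewrite ?mul1r.
  - move=> e e0; move/cvgrPdist_lt: radr => /(_ e e0)[M [_ HM]]; exists M => x Mx; rewrite mul1r.
    by have := HM x Mx; rewrite sub0r normrN ger0_norm ?normc_ge0.
  - by apply: cac_ext r1 => x; rewrite ?mul1r.
  - by apply: cac_ext r2 => x; rewrite ?mul1r.
have outl : ul 1 = ik k * u (-1).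
  have := @radiation_side (fun x => q (- x)) k (-1) u k0 _ s2 _ _ ul; rewrite mulr1; apply.
  - by move=> x x1; apply: q0; rewrite normrN; apply: lt_le_trans x1 (ler_norm _).
  - move=> b b0; have [_ [d [_ _ K1 K2 _]]] := point_source_ode pq ps b0; exists d.
    by split; [apply: cac_ext K1 => x | apply: cac_ext K2 => x]; rewrite ?mulN1r.
  - move=> e e0; move/cvgrPdist_lt: radl => /(_ e e0)[M [_ HM]]; exists (- M) => x Mx; rewrite mulN1r.
    have xM : - x < M by rewrite ltrNl.
    by have := HM (- x) xM; rewrite sub0r normrN ger0_norm ?normc_ge0.
  - by apply: cac_ext l1 => x; rewrite ?mulN1r.
  - by apply: cac_ext l2 => x; rewrite ?mulN1r.
have i13 : 1 <= (3 : R) by lra.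
have [Da Ea] := outgoing_data k0 nQa kBa qa (cac_le i13 r1) (cac_le i13 r2) outr.
have [Db Eb] := outgoing_data k0 nQb kBb qb (cac_le i13 l1) (cac_le i13 l2) outl.
have rk : Re (k%:C%C : R[i]) != 0 by rewrite /= lt0r_neq0.
have Fa := weyl_ne0 (jost_weyl nQa kBa) (lexx 0 : 0 <= Im (k%:C%C : R[i])) rk.
have Fb := weyl_ne0 (jost_weyl nQb kBb) (lexx 0 : 0 <= Im (k%:C%C : R[i])) rk.
rewrite oppr0 in Db Eb.
exact: (source_algebra Fa Fb (cexp_ne0 _) Da Ea Db Eb jump).
Qed.

End Radiation.


(** * Absence of negative eigenvalues *)

Section Eigenfunction.
Context {R : realType}.
Local Notation mu := (@lebesgue_measure R).

Lemma L1_expabs (c : R) : 0 < c -> L1 (fun x : R => expR (- (c * `|x|))).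
Proof.
move=> c0; have Lp : L1 (exponential_pdf c).
  apply/integrableP; split; first by apply/measurable_EFinP; exact: measurable_exponential_pdf.
  rewrite (@eq_integral _ _ _ mu setT (fun x => (exponential_pdf c x)%:E)).
    by rewrite integral_exponential_pdf // ltry.
  by move=> x _; apply: gee0_abs; rewrite lee_fin exponential_pdf_ge0 // ltW.
have [Ln _] := I_reflect Lp.
apply: L1_le (L1Z c^-1 (L1D Lp Ln)); first exact: measurable_expabs.
have key x : 0 <= x -> expR (- (c * x)) = c^-1 * exponential_pdf c x.
  by move=> x0; rewrite exponential_pdfE // mulrA mulVf ?lt0r_neq0 // mul1r mulNr.
have p0 x : 0 <= c^-1 * exponential_pdf c x.
  by apply: mulr_ge0; [rewrite invr_ge0 ltW | apply: exponential_pdf_ge0; exact: ltW].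
move=> x; rewrite ger0_norm ?expR_ge0 // mulrDr; have [x0|x0] := lerP 0 x.
  by rewrite (ger0_norm x0) (key x x0) lerDl p0.
by rewrite (ltr0_norm x0) key ?oppr_ge0 ?(ltW x0) // lerDr p0.
Qed.

Lemma Lfun2_sqr (f : R -> R) : measurable_fun setT f -> L1 (fun x => f x ^+ 2) -> f \in Lfun mu 2%:E.
Proof.
move=> mf /integrableP[_ H]; rewrite inE; apply/andP; split; rewrite inE //=.
rewrite /finite_norm unlock; apply: poweR_lty; apply: le_lt_trans H.
rewrite le_eqVlt; apply/orP; left; apply/eqP; apply: eq_integral => x _.
by rewrite /= ?poweR_EFin powR_mulrn ?normr_ge0 // normrX.
Qed.

Lemma cL2_exp (f : R -> R[i]) (c M : R) : 0 < c -> cmeas f -> (forall x, nC (f x) <= M * expR (- (c * `|x|))) -> cL2 f.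
Proof.
move=> c0 [mr mi] H; have c20 : 0 < 2 * c by rewrite mulr_gt0.
have key (g : R -> R) : measurable_fun setT g -> (forall x, `|g x| <= nC (f x)) -> g \in Lfun mu 2%:E.
  move=> mg gf; apply: Lfun2_sqr => //; apply: (@L1_le _ _ (fun x => M ^+ 2 * expR (- (2 * c * `|x|)))).
  - exact: measurable_funX.
  - move=> x; rewrite normrX.
    have -> : M ^+ 2 * expR (- (2 * c * `|x|)) = (M * expR (- (c * `|x|))) ^+ 2.
      by rewrite exprMn; congr (_ * _); rewrite expr2 -expRD; congr expR; ring.
    have b : `|g x| <= M * expR (- (c * `|x|)) by apply: le_trans (H x).
    by apply: lerXn2r => //; rewrite nnegrE //; apply: le_trans b.
  - by apply: L1Z; exact: L1_expabs.
by split; apply: key => // x; [exact: normc_Re | exact: normc_Im].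
Qed.

Lemma der_far (f g : R -> R) (a : R) : (forall x, is_derive x (1 : R) f (g x)) ->
  (forall x, a < `|x| -> f x = 0) -> forall x, a < `|x| -> g x = 0.
Proof.
move=> df f0 x ax.
have n : \forall y \near x, f y = (fun _ => 0) y.
  apply/nbhs_ballP; exists (`|x| - a); first by rewrite /= subr_gt0.
  move=> y; rewrite /ball /= => yr; apply: f0.
  have := ler_normB x (x - y); rewrite (_ : x - (x - y) = y); last by ring.
  move=> _; have := ler_normD (x - y) y; rewrite subrK; lra.
have [_ e] := near_eq_is_derive n (df x); have [_ <-] := df x.
by rewrite (near_eq_derive _ n); exact: derive_cst.
Qed.

Lemma cI_two_sides (A : R) (G : R -> R[i]) : cL1 G -> (forall x, A <= `|x| -> G x = 0) ->
  cI G = cI (fun t => (win A t)%:C%C * G t) + cI (fun t => (win A t)%:C%C * G (- t)).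
Proof.
have key (g : R -> R) : L1 g -> (forall x, A <= `|x| -> g x = 0) ->
    I g = I (fun t => win A t * g t) + I (fun t => win A t * g (- t)).
  move=> Lg g0.
  have Lw (h : R -> R) (s : R -> R) : L1 h -> measurable_fun setT s -> L1 (fun t => win A (s t) * h t).
    move=> Lh ms; apply: (@eq_L1 _ (fun t => h t * win A (s t))); first by move=> t; rewrite mulrC.
    by apply: (L1M (M := 1)) => //; [exact: (measurableT_comp (measurable_win A) ms) | move=> t; exact: win_norm].
  have mN : measurable_fun setT (fun t : R => - t) by exact: oppr_measurable.
  have L2 := Lw g (fun t => - t) Lg mN; have L1' := Lw g (fun t => t) Lg (@measurable_id _ _ _).
  have -> : I (fun t => win A t * g (- t)) = I (fun t => win A (- t) * g t).
    by have [_ <-] := I_reflect L2; apply: eq_I => t; rewrite opprK.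
  rewrite -ID //; apply/eqP; rewrite -subr_eq0 -IB //; last exact: L1D.
  apply/eqP; apply: (@I_singleton _ _ 0) => t t0.
  have [tA|tA] := leP A `|t|; first by rewrite g0 // !mulr0 addr0 subr0.
  move: t0; rewrite neq_lt => /orP[t0|t0].
    have tN : 0 < - t by rewrite oppr_gt0.
    have tA' : - t < A by rewrite -(ltr0_norm t0).
    by rewrite (win_in tN tA') win_out ?mul0r ?add0r ?mul1r ?subrr // negb_and -leNgt (ltW t0).
  have tA' : t < A by rewrite -(gtr0_norm t0).
  rewrite (win_in t0 tA') win_out ?mul0r ?addr0 ?mul1r ?subrr // negb_and -leNgt oppr_le0.
  by rewrite (ltW t0).
move=> [a b] G0.
have [ka kb] := (key _ a (fun x xA => congr1 (@complex.Re R) (G0 x xA)), key _ b (fun x xA => congr1 (@complex.Im R) (G0 x xA))).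
apply: ceq; rewrite ?ReD ?ImD; [rewrite [LHS]ka | rewrite [LHS]kb]; congr (_ + _); apply: eq_I => t; rewrite !reim; ring.
Qed.

(** A nonzero vector in the kernel of the singular matrix with rows (Fa, - Fb) and (Da, Db), taken
    from whichever row is nonzero. *)
Lemma glue_coefficients (Fa Da Fb Db : R[i]) : Da * Fb + Fa * Db = 0 ->
  exists ca cb : R[i], [/\ (ca != 0) || (cb != 0), ca * Fa = cb * Fb & ca * Da + cb * Db = 0].
Proof.
move=> W; have [a0|a0] := boolP ((Fb != 0) || (Fa != 0)).
  by exists Fb, Fa; split => //; [exact: mulrC | rewrite mulrC].
have [/eqP fb /eqP fa] : Fb == 0 /\ Fa == 0 by move: a0; rewrite negb_or !negbK => /andP[].
rewrite fa fb; have [d0|d0] := boolP ((Db != 0) || (Da != 0)).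
  by exists Db, (- Da); split; rewrite ?oppr_eq0 // ?mulr0 // mulNr mulrC subrr.
have [/eqP -> /eqP ->] : Db == 0 /\ Da == 0 by move: d0; rewrite negb_or !negbK => /andP[].
by exists 1, 1; split; rewrite ?oner_neq0 // !mulr0 ?addr0.
Qed.

(** Green's identity on [0, A]; the boundary terms at A vanish with f and f1. *)
Lemma green_side (p Q : R -> R) (B : R * R -> R) (k : R[i]) (A : R) (f f1 f2 : R -> R) : k != 0 -> nice Q -> is_kernel Q B ->
  (forall x, 0 < x -> p x = Q x) -> 0 <= A -> (forall x, is_derive x (1 : R) f (f1 x)) ->
  (forall x, is_derive x (1 : R) f1 (f2 x)) -> continuous f2 -> f A = 0 -> f1 A = 0 ->
  let g t := (win A t)%:C%C * (jf B k t * (f2 t)%:C%C - ((p t)%:C%C - k ^+ 2) * jf B k t * (f t)%:C%C) in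
  cL1 g /\ cI g = - (jF B k * (f1 0)%:C%C - Fder (jF B) (jY Q B) k * (f 0)%:C%C).
Proof.
move=> k0 nQ kB pQ A0 df df1 cf2 fA f1A g.
have Hf := cac_jf nQ kB k0 A0; have Hd := cac_jd nQ kB k0 A0.
have H0 := cac_real (ac_C1 A0 df (der_continuous df1)); have H1 := cac_real (ac_C1 A0 df1 cf2).
have HW := cacD (cac_mul Hf H1) (cacN (cac_mul Hd H0)).
have AA : 0 <= A <= A by rewrite A0 lexx.
have gE t : (win A t)%:C%C * (jd Q B k t * (f1 t)%:C%C + jf B k t * (f2 t)%:C%C -
  (((Q t)%:C%C - k ^+ 2) * jf B k t * (f t)%:C%C + jd Q B k t * (f1 t)%:C%C)) = g t.
  rewrite /g; have [/andP[t0 tA]|t1] := boolP ((0 < t) && (t < A)); last by rewrite (win_out t1) rC0 !mul0r.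
  rewrite (pQ t t0); congr (_ * _).
  by move: (jd Q B k t * _) (jf B k t * _) (_ * (f t)%:C%C) => x y z; ring.
split; first exact: eq_cL1 gE (cac_L1 HW).
have := cacE HW AA; rewrite fA f1A rC0 !mulr0 subrr jf0 (jd0 nQ kB k0) (eq_cI gE) => E.
by apply/eqP; rewrite -addr_eq0 addrC -E.
Qed.

Lemma ae_itv (a b : R) (P : R -> Prop) : a < b -> {ae mu, forall x, P x} -> exists x, [/\ a < x, x < b & P x].
Proof.
move=> ab H; apply: contrapT => H'.
have : I (fun x => hv (x - a) * hv (b - x)) <= I (fun _ => 0).
  apply: I_ae_le; [exact: L1_itv | exact: L1_0 |]; apply: aeS H => x Px.
  have [xa|xa] := ltP a x; last by rewrite hv_neg ?mul0r ?subr_le0.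
  have [xb|xb] := ltP x b; last by rewrite [hv (b - x)]hv_neg ?mulr0 ?subr_le0.
  by exfalso; apply: H'; exists x.
by rewrite I0 I_itv ?(ltW ab) // leNgt subr_gt0 ab.
Qed.

(* A zero of the Wronskian at [i kap] lets the two decaying Jost solutions be glued into an
   eigenfunction with eigenvalue [- kap^2]. *)
Theorem no_eigenvalue_wronskian (q Qa Qb : R -> R) (Ba Bb : R * R -> R) (kap : R) : potential q ->
  no_negative_eigenvalue q -> nice Qa -> nice Qb -> is_kernel Qa Ba -> is_kernel Qb Bb ->
  (forall x, 0 < x -> q x = Qa x) -> (forall x, 0 < x -> q (- x) = Qb x) -> 0 < kap ->
  Wr (jF Ba) (jY Qa Ba) (jF Bb) (jY Qb Bb) (0 +i* kap)%C != 0.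
Proof.
move=> pq hneg nQa nQb kBa kBb qa qb kap0; set k := (0 +i* kap)%C.
have k0 : k != 0 by rewrite -normc_gt0 normc_gt0; apply/eqP => /(congr1 (@complex.Im R)) /= ?; lra.
have kI : 0 <= Im k by exact: ltW.
apply/eqP; rewrite /Wr => /eqP; rewrite oppr_eq0 => /eqP W.
have [ca [cb [c0 cF cD]]] := glue_coefficients W.
(* The two decaying solutions, each on its side; [cF] makes them match at 0 and [cD] matches their
   derivatives. *)
pose f x := (1 - hv (- x))%:C%C * (ca * jf Ba k x) + (hv (- x))%:C%C * (cb * jf Bb k (- x)).
have fpos x : 0 <= x -> f x = ca * jf Ba k x.
  by move=> x0; rewrite /f hv_neg ?oppr_le0 // subr0 rC0 rC1 mul1r mul0r addr0.
have fneg x : 0 < x -> f (- x) = cb * jf Bb k x.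
  by move=> x0; rewrite /f opprK hv_pos // subrr rC0 rC1 mul1r mul0r add0r.
have mhv : measurable_fun setT (fun x : R => hv (- x)) by apply: measurable_hv => //; exact: oppr_measurable.
have mjf B (Q : R -> R) : is_kernel Q B -> cmeas (jf B k).
  by move=> kB; apply: cmeasM; [exact: cmeas_cexp | exact: (cmeas_jv kB)].
have mf : cmeas f.
  apply: cmeasD; apply: cmeasM.
  - by apply: cmeas_real; apply: measurable_funB.
  - by apply: cmeasM; [exact: cmeas_cst | exact: mjf kBa].
  - exact: cmeas_real.
  - apply: cmeasM; first exact: cmeas_cst.
    by apply: (cmeas_comp (mjf _ _ kBb)); exact: oppr_measurable.
have jb B (Q : R -> R) : nice Q -> is_kernel Q B -> exists M, forall x, 0 <= x -> nC (jf B k x) <= M * expR (- (kap * x)).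
  move=> nQ kB; have [M HM] := jv_bound_closed kB; exists M => x x0.
  rewrite normcM normc_cexp mulrC; have -> : Re ('i%C * k * x%:C%C) = - (kap * x) by rewrite !reim; ring.
  by apply: ler_wpM2r; [exact: expR_ge0 | exact: HM].
have [Ma HMa] := jb _ _ nQa kBa; have [Mb HMb] := jb _ _ nQb kBb.
pose M := nC ca * Ma + nC cb * Mb.
have pos N B (Q : R -> R) : (forall x, 0 <= x -> nC (jf B k x) <= N * expR (- (kap * x))) -> 0 <= N.
  by move=> H; have := H 0 (lexx 0); rewrite mulr0 oppr0 expR0 mulr1; apply: le_trans; exact: normc_ge0.
have Ma0 := pos _ _ Qa HMa; have Mb0 := pos _ _ Qb HMb.
have fb x : nC (f x) <= M * expR (- (kap * `|x|)).
  have [x0|x0] := lerP 0 x.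
    rewrite (fpos _ x0) normcM (ger0_norm x0) mulrDl -mulrA.
    by apply: ler_wpDr; [rewrite !mulr_ge0 ?normc_ge0 ?expR_ge0 | apply: ler_wpM2l; [exact: normc_ge0 | exact: HMa]].
  have x1 : 0 < - x by rewrite oppr_gt0.
  rewrite -[x in f x]opprK (fneg _ x1) normcM (ltr0_norm x0) mulrDl -[nC cb * Mb * _]mulrA.
  by apply: ler_wpDl; [rewrite !mulr_ge0 ?normc_ge0 ?expR_ge0 | apply: ler_wpM2l; [exact: normc_ge0 | exact: HMb (ltW x1)]].
have M0 : 0 <= M by rewrite addr_ge0 // mulr_ge0 // normc_ge0.
have fM x : nC (f x) <= M.
  apply: le_trans (fb x) _; rewrite ler_piMr // -[leRHS]expR0 ler_expR oppr_le0 mulr_ge0 // ltW.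
have Lq := potential_L1 pq.
have Lqf : cL1 (fun x => (q x)%:C%C * f x) by exact: cL1M fM.
have k2 : k ^+ 2 = (- kap ^+ 2)%:C%C by apply: ceq; rewrite expr2 !reim; ring.
apply: (hneg (- kap ^+ 2)); first by rewrite oppr_lt0 exprn_gt0.
exists f; split.
  (* Beyond distance 1 a Jost solution is an exponential, which has no zero, so the side with
     nonzero coefficient contradicts f = 0 almost everywhere. *)
  move=> f0; case/orP: c0 => [ca0|cb0].
    have [x [x1 _ fx]] := @ae_itv 1 2 _ (ltr1n _ 2) f0.
    move: fx; rewrite (fpos _ (ltW (lt_trans ltr01 x1))) (jf1 kBa) ?(ltW x1) // => /eqP.
    by rewrite (negbTE (mulf_neq0 ca0 (cexp_ne0 _))).
  have h : - 2 < - 1 :> R by rewrite ltrN2 ltr1n.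
  have [x [_ x1 fx]] := @ae_itv (- 2) (- 1) _ h f0.
  have xN : 1 < - x by rewrite ltrNr.
  move: fx; rewrite -[x in f x]opprK (fneg _ (lt_trans ltr01 xN)) (jf1 kBb) ?(ltW xN) // => /eqP.
  by rewrite (negbTE (mulf_neq0 cb0 (cexp_ne0 _))).
split.
- exact: cL2_exp kap0 mf fb.
- apply: (cL2_exp (M := nC (- kap ^+ 2)%:C%C * M) kap0); first by apply: cmeasM => //; exact: cmeas_cst.
  by move=> x; rewrite normcM -mulrA; apply: ler_wpM2l; [exact: normc_ge0 | exact: fb].
- by case: Lqf => a b; split; apply: open_integrable_locally => //; exact: openT.
move=> phi [dphi [a sa]].
pose f1 := derive1 phi; pose f2 := derive1 f1; pose A := `|a| + 1.
have aA : a < A by apply: le_lt_trans (ler_norm a) _; rewrite ltrDl.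
have A0 : 0 <= A by rewrite addr_ge0.
have d0 x : is_derive x (1 : R) phi (f1 x) by rewrite /f1 derive1E; apply: derivableP; exact: (dphi 0%N x).
have d1 x : is_derive x (1 : R) f1 (f2 x) by rewrite /f2 derive1E; apply: derivableP; exact: (dphi 1%N x).
have cf2 : continuous f2.
  by move=> x; apply: differentiable_continuous; apply/derivable1_diffP; exact: (dphi 2 x).
have s1 := der_far d0 sa; have s2 := der_far d1 s1.
have far x : A <= `|x| -> a < `|x| by exact: lt_le_trans.
have out (g : R -> R) : (forall x, a < `|x| -> g x = 0) -> forall x, ~~ (- A <= x <= A) -> g x = 0.
  by move=> g0 x; rewrite -ler_norml -ltNge => xA; apply: g0; exact: lt_trans xA.
have cphi := der_continuous d0.
have Lphi := L1_continuous_compact cphi (out _ sa).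
have L2 := L1_continuous_compact cf2 (out _ s2).
have [C HC] := bounded_on (ltr_wpDl (normr_ge0 a) ltr01 : 0 < A) cphi.
have C0 : 0 <= C by apply: le_trans (HC 0 _); rewrite ?normr0.
have Lff2 : cL1 (fun x => f x * (f2 x)%:C%C) by apply: eq_cL1 (cL1M L2 mf fM) => x; rewrite mulrC.
have Lfphi : cL1 (fun x => f x * (phi x)%:C%C) by apply: eq_cL1 (cL1M Lphi mf fM) => x; rewrite mulrC.
have Lqfphi : cL1 (fun x => (q x)%:C%C * f x * (phi x)%:C%C).
  apply: (@eq_cL1 _ (fun x => (q x)%:C%C * (f x * (phi x)%:C%C))); first by move=> x; rewrite mulrA.
  apply: (cL1M (M := M * C)) => //.
    by apply: cmeasM => //; apply: cmeas_real; exact: continuous_measurable_fun.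
  move=> x; rewrite normcM normcC; have [xA|xA] := leP A `|x|.
    by rewrite sa ?far // normr0 mulr0 mulr_ge0.
  by apply: ler_pM => //; [exact: normc_ge0 | apply: HC; exact: ltW].
pose G x := f x * (f2 x)%:C%C - ((q x)%:C%C - k ^+ 2) * f x * (phi x)%:C%C.
have GE x : G x = f x * (f2 x)%:C%C - ((q x)%:C%C * f x * (phi x)%:C%C - k ^+ 2 * (f x * (phi x)%:C%C)).
  by rewrite /G; ring.
have Lr : cL1 (fun x => (q x)%:C%C * f x * (phi x)%:C%C - k ^+ 2 * (f x * (phi x)%:C%C)) := cL1B Lqfphi (cL1Z _ Lfphi).
have LG : cL1 G by apply: eq_cL1 (cL1B Lff2 Lr) => x; rewrite GE.
have G0 x : A <= `|x| -> G x = 0 by move=> xA; rewrite /G s2 ?far // sa ?far // rC0 !mulr0 subrr.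
have AN : a < `|A| by rewrite ger0_norm.
have AN' : a < `|- A| by rewrite normrN.
have [Lgr Er] := green_side k0 nQa kBa qa A0 d0 d1 cf2 (sa _ AN) (s1 _ AN).
have dN (g g1 : R -> R) : (forall x, is_derive x (1 : R) g (g1 x)) -> forall x, is_derive x (1 : R) (fun y => g (- y)) (- g1 (- x)).
  move=> dg x; have nd : is_derive x (1 : R) (fun y : R => - y) (-1) by apply: is_deriveN.
  by rewrite -mulrN1; exact: (@is_derive1_comp _ g (fun y => - y) x _ _ (dg _) nd).
have d0' := dN _ _ d0.
have d1' x : is_derive x (1 : R) (fun y => - f1 (- y)) (f2 (- x)).
  by rewrite -[f2 _]opprK; apply: is_deriveN; exact: dN.
have cf2' : continuous (fun x => f2 (- x)).
  by move=> x; apply: (@continuous_comp _ _ _ (fun y : R => - y) f2); [by apply: (@cvgN R R^o); exact: cvg_id | exact: cf2].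
have sl : - f1 (- A) = 0 by rewrite s1 ?oppr0.
have [Lgl El] := green_side k0 nQb kBb qb A0 d0' d1' cf2' (sa _ AN') sl.
have GI : cI G = 0.
  rewrite (cI_two_sides LG G0).
  rewrite (eq_cI (g := fun t => ca * ((win A t)%:C%C * (jf Ba k t * (f2 t)%:C%C - ((q t)%:C%C - k ^+ 2) * jf Ba k t * (phi t)%:C%C)))); last first.
    move=> t; have [/andP[t0 tA]|t1] := boolP ((0 < t) && (t < A)); last by rewrite (win_out t1) rC0 !mul0r mulr0.
    rewrite /G (fpos _ (ltW t0)); move: (win A t)%:C%C (jf Ba k t) (f2 t)%:C%C (q t)%:C%C (phi t)%:C%C => *; ring.
  rewrite (eq_cI (f := fun t => (win A t)%:C%C * G (- t)) (g := fun t => cb * ((win A t)%:C%C * (jf Bb k t * (f2 (- t))%:C%C - ((q (- t))%:C%C - k ^+ 2) * jf Bb k t * (phi (- t))%:C%C)))); last first.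
    move=> t; have [/andP[t0 tA]|t1] := boolP ((0 < t) && (t < A)); last by rewrite (win_out t1) rC0 !mul0r mulr0.
    rewrite /G (fneg _ t0); move: (win A t)%:C%C (jf Bb k t) (f2 _)%:C%C (q _)%:C%C (phi _)%:C%C => *; ring.
  rewrite (cIZ ca Lgr) (cIZ cb Lgl) Er El oppr0 rCN.
  move: cF cD; set Fa := jF Ba k; set Fb := jF Bb k; set Da := Fder _ _ k; set Db := Fder _ _ k => cF cD.
  (* The boundary terms at 0: matching derivatives cancel the factor of [phi 0], continuity that of
     [f1 0]. *)
  transitivity ((ca * Da + cb * Db) * (phi 0)%:C%C - (ca * Fa - cb * Fb) * (f1 0)%:C%C).
    by move: (phi 0)%:C%C (f1 0)%:C%C => x y; ring.
  by rewrite cD cF subrr !mul0r subrr.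
move: GI; rewrite (eq_cI GE) (cIB Lff2 Lr) (cIB Lqfphi (cL1Z _ Lfphi)) (cIZ _ Lfphi) => GI.
rewrite /distr_derive opprK -/f1 -/f2.
have -> : regular_distr f f2 = cI (fun x => f x * (f2 x)%:C%C) by [].
have -> : regular_distr (fun x => (q x)%:C%C * f x) phi = cI (fun x => (q x)%:C%C * f x * (phi x)%:C%C) by [].
have -> : regular_distr (fun x => (- kap ^+ 2)%:C%C * f x) phi = k ^+ 2 * cI (fun x => f x * (phi x)%:C%C).
  by rewrite -(cIZ _ Lfphi) k2; apply: eq_cI => x; rewrite mulrA.
move: GI; move: (cI _) (cI _) (k ^+ 2 * cI _) => x y z /eqP; rewrite subr_eq0 => /eqP ->; ring.
Qed.

End Eigenfunction.


(** * The theorem *)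

Section Data.
Context {R : realType}.
Local Notation mu := (@lebesgue_measure R).

(* The restriction to the half line of direction [sg], which is [1] or [-1]. *)
Definition half (q : R -> R) (sg x : R) : R := if 0 < x <= 1 then q (sg * x) else 0.

Lemma halfE q sg x : potential q -> sg * sg = 1 -> 0 < x -> q (sg * x) = half q sg x.
Proof.
move=> [_ q0] s2 x0; rewrite /half x0 /=; case: ifP => // /negbT; rewrite -ltNge => x1.
have s1 : `|sg| = 1 by apply/eqP; rewrite -(@eqrXn2 _ 2) // expr1n expr2 -normrM s2 normr1.
by rewrite q0 // normrM s1 mul1r gtr0_norm.
Qed.

Lemma nice_half q sg : potential q -> sg = 1 \/ sg = -1 -> nice (half q sg).
Proof.
move=> pq s1; have Lq := potential_L1 pq; split; last by move=> t; rewrite /half => /negbTE ->.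
have L : L1 (fun x => q (sg * x)).
  case: s1 => ->; first by apply: eq_L1 Lq => x; rewrite mul1r.
  by have [L _] := I_reflect Lq; apply: eq_L1 L => x; rewrite mulN1r.
apply: (@eq_L1 _ (fun x => q (sg * x) * (hv x * (1 - hv (x - 1))))).
  move=> x; rewrite /half; have [x0|x0] := ltP 0 x; last by rewrite hv_neg // mul0r mulr0.
  have [x1|x1] := leP x 1; first by rewrite (hv_pos x0) hv_neg ?subr_le0 // subr0 !mulr1.
  by rewrite [hv (x - 1)]hv_pos ?subr_gt0 // subrr !mulr0.
apply: (L1M (M := 1)) => //.
  apply: measurable_funM; first exact: measurable_hv.
  by apply: measurable_funB => //; apply: measurable_hv => //; exact: measurable_funB.
move=> x; rewrite normrM -[leRHS]mulr1; apply: ler_pM => //; first exact: hv_norm.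
by rewrite ger0_norm ?subr_ge0 ?hv_le1 // gerBl hv_ge0.
Qed.

Lemma ae_reflect (P : R -> Prop) : {ae mu, forall t, P t} -> {ae mu, forall t, P (- t)}.
Proof.
move=> [N [mN N0 PN]]; exists (-%R @^-1` N); split.
- by rewrite -[X in measurable X]setTI; exact: oppr_measurable.
- by rewrite -(lebesgue_measureN mN) in N0; exact: N0.
- by move=> t nP; exact: PN.
Qed.

Lemma ae_neq0 : {ae mu, forall t : R, t != 0}.
Proof.
exists [set 0]; split; [exact: measurable_set1 | exact: lebesgue_measure_set1 |].
by move=> t /= /negP; rewrite negbK => /eqP.
Qed.

End Data.

Theorem theorem6p1 (R : realType) (q1 q2 : R -> R) (u1 u2 : R -> R -> R[i])
    (hq1 : potential q1) (hq2 : potential q2)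
    (hneg1 : no_negative_eigenvalue q1) (hneg2 : no_negative_eigenvalue q2)
    (hu1 : forall k : R, 0 < k -> point_source_solution q1 k (fun x => u1 x k))
    (hu2 : forall k : R, 0 < k -> point_source_solution q2 k (fun x => u2 x k))
    (hdata : forall k : R, 0 < k -> u1 (-1) k = u2 (-1) k /\ u1 1 k = u2 1 k) :
  {ae @lebesgue_measure R, forall x : R, q1 x = q2 x}.
Proof.
have s1 : (1 : R) * 1 = 1 by rewrite mulr1.
have s2 : (-1 : R) * -1 = 1 by rewrite mulrNN mulr1.
have na1 := nice_half hq1 (or_introl erefl); have nb1 := nice_half hq1 (or_intror erefl).
have na2 := nice_half hq2 (or_introl erefl); have nb2 := nice_half hq2 (or_intror erefl).
have [A1 kA1] := kernel_exists na1; have [B1 kB1] := kernel_exists nb1.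
have [A2 kA2] := kernel_exists na2; have [B2 kB2] := kernel_exists nb2.
have ea1 x : 0 < x -> q1 x = half q1 1 x by move=> x0; rewrite -(halfE hq1 s1 x0) mul1r.
have eb1 x : 0 < x -> q1 (- x) = half q1 (-1) x by move=> x0; rewrite -(halfE hq1 s2 x0) mulN1r.
have ea2 x : 0 < x -> q2 x = half q2 1 x by move=> x0; rewrite -(halfE hq2 s1 x0) mul1r.
have eb2 x : 0 < x -> q2 (- x) = half q2 (-1) x by move=> x0; rewrite -(halfE hq2 s2 x0) mulN1r.
have W1 x (x0 : 0 < x) := no_eigenvalue_wronskian hq1 hneg1 na1 nb1 kA1 kB1 ea1 eb1 x0.
have W2 x (x0 : 0 < x) := no_eigenvalue_wronskian hq2 hneg2 na2 nb2 kA2 kB2 ea2 eb2 x0.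
have D1 (k : R) (k0 : 0 < k) := source_data k0 hq1 na1 nb1 kA1 kB1
  (fun x (x1 : 0 < x < 1) => ea1 x (andP x1).1) (fun x (x1 : 0 < x < 1) => eb1 x (andP x1).1) (hu1 k k0).
have D2 (k : R) (k0 : 0 < k) := source_data k0 hq2 na2 nb2 kA2 kB2
  (fun x (x1 : 0 < x < 1) => ea2 x (andP x1).1) (fun x (x1 : 0 < x < 1) => eb2 x (andP x1).1) (hu2 k k0).
have dB s : 0 < s -> jF B1 s%:C%C / Wr (jF A1) (jY (half q1 1) A1) (jF B1) (jY (half q1 (-1)) B1) s%:C%C =
    jF B2 s%:C%C / Wr (jF A2) (jY (half q2 1) A2) (jF B2) (jY (half q2 (-1)) B2) s%:C%C.
  by move=> s0; rewrite (D1 s s0).1 (D2 s s0).1 (hdata s s0).2.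
have dA s : 0 < s -> jF A1 s%:C%C / Wr (jF A1) (jY (half q1 1) A1) (jF B1) (jY (half q1 (-1)) B1) s%:C%C =
    jF A2 s%:C%C / Wr (jF A2) (jY (half q2 1) A2) (jF B2) (jY (half q2 (-1)) B2) s%:C%C.
  by move=> s0; rewrite (D1 s s0).2 (D2 s s0).2 (hdata s s0).1.
(* The Wronskian is symmetric in the two half lines, so the same argument with their roles exchanged
   treats the left one. *)
have WC (Fa Ya Fb Yb : R[i] -> R[i]) k : Wr Fa Ya Fb Yb k = Wr Fb Yb Fa Ya k by rewrite /Wr; ring.
have wa1 := jost_weyl na1 kA1; have wb1 := jost_weyl nb1 kB1.
have wa2 := jost_weyl na2 kA2; have wb2 := jost_weyl nb2 kB2.
have Ua : {ae @lebesgue_measure R, forall t, half q1 1 t = half q2 1 t}.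
  by apply: (jost_unique na1 na2 kA1 kA2) => x x0; exact: (weyl_core wa1 wb1 wa2 wb2 W1 W2 dB dA x0).
have Ub : {ae @lebesgue_measure R, forall t, half q1 (-1) t = half q2 (-1) t}.
  apply: (jost_unique nb1 nb2 kB1 kB2) => x x0.
  apply: (weyl_core wb1 wa1 wb2 wa2 _ _ _ _ x0).
  - by move=> y y0; rewrite WC; exact: W1.
  - by move=> y y0; rewrite WC; exact: W2.
  - by move=> s s0; rewrite WC [in RHS]WC; exact: dA.
  - by move=> s s0; rewrite WC [in RHS]WC; exact: dB.
have Ub' := ae_reflect Ub.
(* Neither half line contains the point 0. *)
have U0 : {ae @lebesgue_measure R, forall t : R, t != 0} by exact: ae_neq0.
apply: aeS (aeI U0 (aeI Ua Ub')) => x [x0 [Hp Hn]].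
move: x0; rewrite neq_lt => /orP[x0|x0]; last by rewrite ea1 // ea2.
have xN : 0 < - x by rewrite oppr_gt0.
by rewrite -[x]opprK eb1 // eb2.
Qed.
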